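(* Consider the one-well system described in the context. The family $\widehat H^\varepsilon_t$, $0\le t\le T$, satisfies the large deviation principle as $\varepsilon\downarrow0$ in $C_{[0,T]}([H_0,\overline H])$ with normalizing factor $\varepsilon^{-1}$ and action functional $S_{0T}$. That is: (0) The set $\Phi(s)=\{\varphi\in C_{[0,T]}([H_0,\overline H]):S_{0T}(\varphi)\le s\}$ is compact for every $s\ge0$. (I) For any $\nu>0$, any $\delta>0$ and any $\varphi\in C_{[0,T]}([H_0,\overline H])$ there exists $\varepsilon_0>0$ such that for all $0<\varepsilon\le\varepsilon_0$ $$\mathbb{P}\{\rho_{0T}(\widehat H^\varepsilon,\varphi)<\delta\}\ge\exp(-\varepsilon^{-1}(S_{0T}(\varphi)+\nu)).$$ (II) For any $\delta>0$, any $\nu>0$ and any $s>0$ there exists $\varepsilon_0>0$ such that for all $0<\varepsilon\le\varepsilon_0$ $$\mathbb{P}\{\rho_{0T}(\widehat H^\varepsilon,\Phi(s))\ge\delta\}\le\exp(-\varepsilon^{-1}(s-\nu)).$$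
   Context: **The system.** A particle moves between the two walls of a single well of width $D>0$. Let $\{\xi_k\}_{k\ge1}$ and $\{\eta_k\}_{k\ge1}$ be i.i.d. sequences, mutually independent, with continuous densities, $\mathbb{P}\{|\xi_k|\le M\}=\mathbb{P}\{|\eta_k|\le M\}=1$ for some $M>0$, and $\mathbb{E}(\xi_k+\eta_k)>0$. Let $\xi,\eta$ denote independent variables with the laws of $\xi_k,\eta_k$. In rescaled time, let $H^\varepsilon_t$ be the energy at time $t$, and let $Q^\varepsilon_t$ be $q_0$ (the initial position) plus the total horizontal distance travelled up to time $t$. Then $\dot Q^\varepsilon_t=\frac1\varepsilon\sqrt{2H^\varepsilon_t}$. The process $H^\varepsilon_t$ is a step function that jumps by $-\varepsilon\xi_k$ when $Q^\varepsilon_t$ reaches $(2k-1)D$ and by $-\varepsilon\eta_k$ when $Q^\varepsilon_t$ reaches $2kD$, $k\ge1$. The initial energy $H^\varepsilon_0=x$ is fixed. It is assumed that $0<H_0\le H^\varepsilon_t\le\overline H<\infty$ for $0\le t\le T$, where $H_0$ and $\overline H$ are constants. The process $\widehat H^\varepsilon_t$ is the continuous piecewise linear modification of $H^\varepsilon_t$ obtained by joining consecutive corners. Let $0<s_1<s_2<\dots$ be the collision (jump) times. Then $\widehat H^\varepsilon=x$ on $[0,s_1]$, and on $[s_k,s_{k+1}]$ the function $\widehat H^\varepsilon$ is linear from $H^\varepsilon_{s_k-}$ to $H^\varepsilon_{s_k}$. **The action functional.** For $h\in[H_0,\overline H]$ and $\alpha,\beta\in\mathbb{R}$ let $$\mathcal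 H(h,\beta)=\frac{\sqrt{2h}}{2D}\ln\mathbb{E}\exp(-\beta(\xi+\eta)),\qquad \mathcal L(h,\alpha)=\sup_{\beta\in\mathbb{R}}(\alpha\beta-\mathcal H(h,\beta)).$$ For $\varphi\in C_{[0,T]}([H_0,\overline H])$, the continuous functions $[0,T]\to[H_0,\overline H]$, set $S_{0T}(\varphi)=\int_0^T\mathcal L(\varphi_s,\dot\varphi_s)\,ds$ if $\varphi$ is absolutely continuous with $\varphi_0=x$, and $S_{0T}(\varphi)=+\infty$ otherwise. Finally, $\rho_{0T}(\varphi,\psi)=\max_{0\le t\le T}|\varphi(t)-\psi(t)|$, and $\rho_{0T}(\varphi,\Phi(s))=\min_{\psi\in\Phi(s)}\rho_{0T}(\varphi,\psi)$. *)

(* Defs.v *)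
From mathcomp Require Import all_boot all_order all_algebra.
From mathcomp Require Import all_classical all_reals all_analysis.

Set Implicit Arguments.
Unset Strict Implicit.
Unset Printing Implicit Defensive.

Import Order.TTheory GRing.Theory Num.Theory.
Import numFieldNormedType.Exports.

Local Open Scope classical_set_scope.
Local Open Scope ring_scope.

Section Probability.
Context {d : measure_display} {Omega : measurableType d} {R : realType}.
Variable P : probability Omega R.

Definition independent_family (I : choiceType) (X : I -> {RV P >-> R}) : Prop :=
  forall (s : seq I) (A : I -> set R), uniq s ->
    (forall i, measurable (A i)) ->
    P (\bigcap_(i in [set` s]) (X i @^-1` A i)) =
    (\prod_(i <- s) P (X i @^-1` A i))%E.

Definition identically_distributed (X : nat -> {RV P >-> R}) : Prop :=
  forall (i j : nat) (A : set R), measurable A ->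
    distribution P (X i) A = distribution P (X j) A.

Definition has_continuous_density (X : {RV P >-> R}) : Prop :=
  exists f : R -> R, [/\ continuous f, (forall r, 0 <= f r) &
    forall A : set R, measurable A ->
      distribution P X A = (\int[lebesgue_measure]_(r in A) (f r)%:E)%E].

End Probability.

(* A trajectory of the particle for given sequences of energy losses.  The
   sequences are numbered from 0, so [xi k] and [eta k] stand for xi_{k+1} and
   eta_{k+1}; collisions are numbered from 1. *)
Section OneWell.
Context {R : realType}.
Variables (D q0 x eps : R) (xi eta : nat -> R).

(* Loss at collision n.+1, where Q = n.+1 * D: xi_k if n.+1 = 2k - 1 and
   eta_k if n.+1 = 2k. *)
Definition loss (n : nat) : R := if odd n then eta n./2 else xi n./2.

Definition energy (n : nat) : R := x - eps * \sum_(j < n) loss j.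

Definition speed (h : R) : R := eps^-1 * Num.sqrt (2 * h).

(* The value of Q at collision n, and at time 0 for n = 0. *)
Definition wall (n : nat) : R := if n is 0 then q0 else n%:R * D.

(* [collision n] is s_n, with s_0 = 0: between s_n and s_{n+1} the particle
   has energy [energy n] and travels from [wall n] to [wall n.+1]; if it has
   no energy left it never gets there. *)
Fixpoint collision (n : nat) : \bar R :=
  if n is m.+1 then
    (collision m +
     if (0 < energy m)%R then ((wall m.+1 - wall m) / speed (energy m))%:E
     else +oo)%E
  else 0%E.

Definition collisions_before (t : R) : nat :=
  xget 0%N [set n | (collision n <= t%:E < collision n.+1)%E].

(* The step function H_t. *)
Definition energy_path (t : R) : R := energy (collisions_before t).

(* Q_t. *)
Definition distance_path (t : R) : R :=
  let n := collisions_before t in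
  wall n + speed (energy n) * (t - fine (collision n)).

(* \hat H_t: for s_n <= t < s_{n+1}, the value at t of the line from
   (s_n, energy n.-1) to (s_{n+1}, energy n), the energies just before
   collisions n and n.+1; for n = 0 it is constantly x. *)
Definition interpolated_path (t : R) : R :=
  let n := collisions_before t in
  let s := fine (collision n) in
  let s' := fine (collision n.+1) in
  energy n.-1 + (t - s) / (s' - s) * (energy n - energy n.-1).

Hypotheses (D_gt0 : 0 < D) (q0_ltD : q0 < D) (eps_gt0 : 0 < eps).

Lemma speed_gt0 h : 0 < h -> 0 < speed h.
Proof. by move=> h0; rewrite mulr_gt0 ?invr_gt0 ?sqrtr_gt0 ?mulr_gt0. Qed.

Lemma wall_lt n : wall n < wall n.+1.
Proof.
case: n => [|n] /=; first by rewrite mul1r.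
by rewrite ltr_pM2r // ltr_nat.
Qed.

Lemma collision_lt n : collision n \is a fin_num ->
  (collision n < collision n.+1)%E.
Proof.
move=> fn /=; case: ifPn => [E0|_]; last first.
  by rewrite addey ?ltey_eq ?fn //; case: (collision n) fn.
by rewrite lteDl // lte_fin divr_gt0 ?speed_gt0 // subr_gt0 (wall_lt n).
Qed.

Lemma collision_ge0 n : (0 <= collision n)%E.
Proof.
elim: n => //= n IH; rewrite adde_ge0 //; case: ifPn => // E0.
by rewrite lee_fin divr_ge0 ?ltW ?speed_gt0 // subr_gt0 (wall_lt n).
Qed.

Lemma collision_le n m : (n <= m)%N -> (collision n <= collision m)%E.
Proof.
elim: m => [|m IH]; first by rewrite leqn0 => /eqP ->.
rewrite leq_eqVlt => /orP[/eqP -> //|/IH /le_trans]; apply.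
have := collision_ge0 m; case E: (collision m) => [r| |] // _.
- by rewrite -E ltW // collision_lt // E.
- by rewrite /= E; case: ifP.
Qed.

Lemma collisions_beforeE n t : (collision n <= t%:E < collision n.+1)%E ->
  collisions_before t = n.
Proof.
move=> nt; apply: xget_unique => // m /= /andP[mt tm].
case/andP: nt => nt tn.
apply/eqP; rewrite eqn_leq; apply/andP; split; rewrite leqNgt; apply/negP.
- by move/collision_le/(lt_le_trans tn)/lt_le_trans => /(_ _ mt); rewrite ltxx.
- by move/collision_le/(lt_le_trans tm)/lt_le_trans => /(_ _ nt); rewrite ltxx.
Qed.

Lemma collisions_before_at n t : collision n = t%:E -> collisions_before t = n.
Proof.
by move=> nt; apply: collisions_beforeE; rewrite nt lexx -{1}nt collision_lt ?nt.
Qed.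

(* The following lemmas say that Q starts at q0, is continuous with
   Q' = eps^-1 sqrt(2 H) between collisions, that s_n is the time at which Q
   reaches n * D and that H drops by eps * loss then. *)
Lemma path0 : [/\ distance_path 0 = q0, energy_path 0 = x &
  interpolated_path 0 = x].
Proof.
have e : collisions_before 0 = 0%N by exact: collisions_before_at.
rewrite /distance_path /energy_path /interpolated_path e /energy big_ord0.
by rewrite /= !subrr !mul0r !mulr0 subr0 !addr0.
Qed.

Lemma path_collision n t : collision n.+1 = t%:E ->
  [/\ distance_path t = n.+1%:R * D,
      energy_path t = energy n - eps * loss n &
      interpolated_path t = energy n].
Proof.
move=> nt; rewrite /distance_path /energy_path /interpolated_path.
rewrite (collisions_before_at nt) nt subrr mulr0 !mul0r !addr0; split => //.
by rewrite /energy big_ord_recr /= mulrDr opprD addrA.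
Qed.

Lemma distance_path_derive n t :
  (collision n < t%:E)%E -> (t%:E < collision n.+1)%E ->
  is_derive t 1 distance_path (eps^-1 * Num.sqrt (2 * energy_path t)).
Proof.
move=> nt tn.
have e : collisions_before t = n by apply: collisions_beforeE; rewrite ltW.
rewrite -/(speed _) /energy_path e.
set c := fine (collision n).
have D1 : is_derive t 1 (fun u => wall n + speed (energy n) * (u - c))
    (speed (energy n)).
  by apply: is_derive_eq; rewrite add0r mul1r subr0 /GRing.scale /= mulr1.
apply: near_eq_is_derive D1.
have N1 : \forall u \near t, (collision n < u%:E)%E.
  have := collision_ge0 n; case: (collision n) nt => // r; rewrite lte_fin.
  by move=> rt _; near=> u; rewrite lte_fin; near: u; exact: lt_nbhsr.
have N2 : \forall u \near t, (u%:E < collision n.+1)%E.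
  have := collision_ge0 n.+1; case: (collision n.+1) tn => // [r|_ _].
    rewrite lte_fin => rt _; near=> u; rewrite lte_fin; near: u.
    exact: lt_nbhsl.
  by near=> u; rewrite ltry.
near=> u; rewrite /distance_path (@collisions_beforeE n) // ltW /=.
  by near: u.
by near: u.
Unshelve. all: by end_near. Qed.

Lemma distance_path_left n t : collision n.+1 = t%:E ->
  distance_path u @[u --> t^'-] --> n.+1%:R * D.
Proof.
move=> nt.
have [E0 fn] : 0 < energy n /\ collision n \is a fin_num.
  have := collision_ge0 n; move: nt => /=.
  by case: ifP => //; case: (collision n).
move: nt; rewrite /= E0 -(fineK fn) -EFinD => -[].
set c := fine (collision n) => nt.
have ct : c < t.
  by rewrite -nt ltrDl divr_gt0 ?speed_gt0 // subr_gt0 (wall_lt n).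
have -> : n.+1%:R * D = wall n + speed (energy n) * (t - c).
  rewrite -nt addrAC subrr add0r mulrCA divff ?mulr1 ?gt_eqF ?speed_gt0 //.
  by rewrite addrC subrK.
have C : (fun u => wall n + speed (energy n) * (u - c)) u @[u --> t^'-] -->
    wall n + speed (energy n) * (t - c).
  apply: cvgD; first exact: cvg_cst.
  apply: cvgM; first exact: cvg_cst.
  by apply: cvgB; [exact: cvg_at_left_filter|exact: cvg_cst].
apply: cvg_trans C; apply: near_eq_cvg; near=> u.
rewrite /distance_path (@collisions_beforeE n) //.
rewrite -(fineK fn) lee_fin -/c; apply/andP; split.
  by apply: ltW; near: u; exact: nbhs_left_gt.
rewrite /= E0 -(fineK fn) -EFinD -/c nt lte_fin.
by near: u; exact: nbhs_left_lt.
Unshelve. all: by end_near. Qed.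

End OneWell.

Section Action.
Context {R : realType}.

Definition absolutely_continuous_on (a b : R) (f : R -> R) : Prop :=
  forall e : R, 0 < e -> exists2 delta : R, 0 < delta &
    forall (n : nat) (u v : 'I_n -> R),
      (forall i, a <= u i <= v i /\ v i <= b) ->
      (forall i j, i != j -> v i <= u j \/ v j <= u i) ->
      \sum_(i < n) (v i - u i) < delta ->
      \sum_(i < n) `|f (v i) - f (u i)| < e.

(* C_{[0,T]}([H0, H1]), as functions on R of which only the restriction to
   [0, T] matters. *)
Definition path_space (T H0 H1 : R) : set (R -> R) :=
  [set phi | {within `[0, T], continuous phi} /\
             forall t, 0 <= t <= T -> H0 <= phi t <= H1].

Definition rho (T : R) (phi psi : R -> R) : \bar R :=
  ereal_sup [set (`|phi t - psi t|)%:E | t in `[0, T]].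

(* The minimum in the distance to a set, written as an infimum; it is +oo
   when the set is empty. *)
Definition rho_set (T : R) (phi : R -> R) (A : set (R -> R)) : \bar R :=
  ereal_inf [set rho T phi psi | psi in A].

Context {d : measure_display} {Omega : measurableType d}.
Variables (P : probability Omega R) (D : R) (xi eta : {RV P >-> R}).

Definition hamiltonian (h beta : R) : R :=
  Num.sqrt (2 * h) / (2 * D) *
  ln (fine ('E_P[fun w => expR (- beta * (xi w + eta w))])).

Definition lagrangian (h alpha : R) : \bar R :=
  ereal_sup [set (alpha * beta - hamiltonian h beta)%:E | beta in setT].

Variables (T x : R).

Definition action (phi : R -> R) : \bar R :=
  if `[< absolutely_continuous_on 0 T phi /\ phi 0 = x >] then
    (\int[lebesgue_measure]_(s in `[0%R, T]) lagrangian (phi s) (derive1 phi s))%E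
  else +oo%E.

Definition level_set (H0 H1 s : R) : set (R -> R) :=
  [set phi | path_space T H0 H1 phi /\ (action phi <= s%:E)%E].

End Action.

(* Main.v *)
(* Write c h = sqrt (2 h) / (2 D) and let Lam be the cumulant generating
   function of xi + eta, so that the Hamiltonian at (h, beta) is
   c h * Lam (- beta).  A grid 0 = t_0 < ... < t_n = T and multipliers l_i give
     J_l (phi) = sum_i (- l_i (phi t_{i+1} - phi t_i)
                        - Lam l_i * int_{t_i}^{t_{i+1}} c (phi)),
   and the action of a Lipschitz path is the supremum of J over all grids and
   multipliers.  Each J is continuous on the compact set of Lipschitz paths in
   which the interpolated energy lives, hence (0).

   Tilt the k-th pair of losses by l_i when collision 2k+1 falls into the i-th
   cell.  As the tilt depends on earlier losses only, this gives a positive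
   variable W_l of mean 1; as int c (Hhat) counts pairs of collisions up to
   O(eps), log W_l = eps^-1 J_l (Hhat) + O(1) almost surely.

   Upper bound: by compactness, finitely many l_j are such that J_{l_j} >= s for
   some j at every path far from the level set, and Markov's inequality for
   the sum of the exp (- s / eps) W_{l_j} concludes.

   Lower bound, without changing the measure: on a fine grid let l_i be the
   maximizer of l a_i - Lam l for the normalized increments - a_i of phi.  A
   path that is not close to phi has increments for which l is not optimal, so
   W_l <= exp (- g / eps) W_{l'} near it for some l' and g > 0; finitely many l'
   suffice.  Such paths therefore contribute little to the mean 1 of W_l, and
   near phi one has W_l <= exp ((S phi + nu) / eps). *)
From HB Require Import structures.
Require Import Defs.
From mathcomp Require Import all_boot all_order all_algebra.
From mathcomp Require Import all_classical all_reals all_analysis.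
From mathcomp Require Import measurable_realfun.
From mathcomp Require Import ring lra zify.

Set Implicit Arguments.
Unset Strict Implicit.
Unset Printing Implicit Defensive.

Import Order.TTheory GRing.Theory Num.Theory.
Import numFieldNormedType.Exports.

Local Open Scope classical_set_scope.
Local Open Scope ring_scope.

(** * Absolutely continuous functions *)

Section AbsolutelyContinuous.
Context {R : realType}.
Implicit Types (a b c e : R) (f : R -> R) (s : seq R).

(** The action contains a pointwise derivative, while the tilts see only increments over cells. The
    bridge is that an absolutely continuous path is the integral of its almost everywhere
    derivative; this comes from the variation function, whose Stieltjes measure charges no Lebesgue
    null set, and Radon-Nikodym. In the other direction, optimal rates of shrinking cells dominate
    the Lagrangian in the limit, and Fatou's lemma applies. Since [|Lam l| <= 2 M |l|], a finite
    action forces slope at most [M sqrt (2 H1) / D], which is also the slope bound of the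
    interpolated energy: one compact set serves both. Grid and multipliers are fixed before [eps],
    so the O(1) errors are constants, beaten by [exp (- nu / eps)]. The lower bound needs attained
    maximizers of [l a - Lam l], even if [a] is an extreme value of [xi + eta]. There the supremum
    can be finite without being attained only if that value is an atom, which the density of [eta]
    excludes. A one-sided quadratic bound stands in for the derivative of [Lam]. *)

Lemma itv_partition_nth_homo a b s (i j : nat) : itv_partition a b s ->
  (i <= j <= size s)%N -> nth b (a :: s) i <= nth b (a :: s) j.
Proof.
move=> [ps _] /andP[ij js].
have h : sorted <=%R (a :: s) by have /andP[] := @lt_sorted_is_uniq_le _ _ (a :: s) ps.
by rewrite (sorted_leq_nth le_trans lexx b h)// inE /= ltnS // (leq_trans ij).
Qed.

Lemma ac_partition_sum a b f e : 0 < e -> absolutely_continuous_on a b f ->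
  exists2 delta : R, 0 < delta &
    forall c c' s (J : pred nat), a <= c -> c' <= b -> itv_partition c c' s ->
      \sum_(i < size s | J i) (nth c' (c :: s) i.+1 - nth c' (c :: s) i) < delta ->
      \sum_(i < size s | J i) `|f (nth c' (c :: s) i.+1) - f (nth c' (c :: s) i)| < e.
Proof.
move=> e0 /(_ e e0)[delta d0 H]; exists delta => // c c' s J ac cb cs.
pose p := nth c' (c :: s).
(* Cells outside [J] are collapsed to a point: they stay in the sum over all indices but contribute
   nothing. *)
pose v (i : 'I_(size s)) := if J i then p i.+1 else p i.
have pc (i : nat) : (i <= size s)%N -> a <= p i /\ p i <= b.
  move=> si; split; first by rewrite (le_trans ac)// itv_partition_nth_ge.
  by rewrite (le_trans _ cb)// itv_partition_nth_le.
have hm (i j : nat) : (i <= j <= size s)%N -> p i <= p j by exact: itv_partition_nth_homo.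
have pv (i : 'I_(size s)) : p i <= v i <= p i.+1.
  by have := hm i i.+1; have := ltn_ord i; rewrite /v; case: ifP => _ -> /=;
    rewrite ?leqnSn lexx ?andbT => // ->.
move=> small.
have := H _ (fun i => p i) v.
have -> : \sum_(i < size s) (v i - p i) = \sum_(i < size s | J i) (p i.+1 - p i).
  by rewrite [RHS]big_mkcond; apply: eq_bigr => i _; rewrite /v; case: ifP; rewrite ?subrr.
have -> : \sum_(i < size s) `|f (v i) - f (p i)|
          = \sum_(i < size s | J i) `|f (p i.+1) - f (p i)|.
  rewrite [RHS]big_mkcond; apply: eq_bigr => i _.
  by rewrite /v; case: ifP; rewrite ?subrr ?normr0.
apply => //.
- move=> i; have /andP[-> vi] := pv i.
  have [-> _] := pc i (ltnW (ltn_ord i)); split => //.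
  by have [_] := pc i.+1 (ltn_ord i); exact: le_trans.
- move=> i j ij.
  have hlt (i' j' : 'I_(size s)) : (i' < j')%N -> v i' <= p j'.
    move=> lt; have /andP[_ vi] := pv i'; rewrite (le_trans vi)// hm// lt /=.
    by rewrite ltnW.
  have : (i < j)%N || (j < i)%N by rewrite -neq_ltn.
  by case/orP => lt; [left|right]; exact: hlt.
Qed.

Lemma ac_bounded_variation a b f : a <= b ->
  absolutely_continuous_on a b f -> bounded_variation a b f.
Proof.
move=> ab /(ac_partition_sum ltr01)[delta d0 H].
pose h := delta / 2.
have h0 : 0 < h by rewrite divr_gt0.
(* An interval of length at most [h], half of [delta], has variation at most 1, and finitely many of
   them reach [b]. *)
suff : forall n c, a <= c -> c <= b -> c <= a + n%:R * h -> bounded_variation a c f.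
  move=> /(_ (Num.truncn ((b - a) / h)).+1 b ab (lexx _)); apply.
  rewrite -lerBlDl -ler_pdivrMr //; apply/ltW/truncnS_gt.
elim=> [c ac cb|n IH c ac cb].
  rewrite mul0r addr0 => ca; have -> : c = a by apply/eqP; rewrite eq_le ca ac.
  exact: bounded_variationxx.
move=> cn; pose c' := Num.max a (c - h).
have ac' : a <= c' by rewrite le_max lexx.
have c'c : c' <= c by rewrite ge_max ac gerBl ltW.
have BV1 : bounded_variation a c' f.
  apply: IH => //; first exact: le_trans cb.
  rewrite /c' ge_max lerDl mulr_ge0 ?(ltW h0)//=.
  by rewrite lerBlDr -addrA -{2}(mul1r h) -mulrDl natr1.
have BV2 : bounded_variation c' c f.
  exists 1 => _ [s sp <-].
  have := H c' c s xpredT ac' cb sp.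
  rewrite -(big_mkord xpredT (fun i => nth c (c' :: s) i.+1 - nth c (c' :: s) i)).
  rewrite telescope_sumr //.
  move=> K; apply: ltW; rewrite /variation big_mkord; apply: K.
  rewrite (itv_partition_nth_size _ sp) /=.
  have : c - h <= c' by rewrite le_max lexx orbT.
  rewrite /h; lra.
apply/bounded_variationP => //; rewrite (total_variationD f ac' c'c) fin_numD.
by apply/andP; split; apply/bounded_variationP.
Qed.

End AbsolutelyContinuous.

(** * The Stieltjes measure of the variation function *)

Section VariationMeasure.
Context {R : realType}.
Variables (a b : R) (f : R -> R).
Hypotheses (ab : a < b) (acf : absolutely_continuous_on a b f).

Local Notation V := (fun t => fine (total_variation a t f)).

Lemma ac_total_variation_fin t : a <= t <= b -> total_variation a t f \is a fin_num.
Proof.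
move=> /andP[at_ tb]; apply/bounded_variationP => //.
exact: (bounded_variationl at_ tb (ac_bounded_variation (ltW ab) acf)).
Qed.

Lemma ac_variation_increment u v : a <= u -> u <= v -> v <= b ->
  `|f v - f u| <= V v - V u.
Proof.
move=> au uv vb.
have fu : total_variation a u f \is a fin_num.
  by rewrite ac_total_variation_fin // au (le_trans uv).
have fv : total_variation a v f \is a fin_num.
  by rewrite ac_total_variation_fin // vb (le_trans au).
rewrite -lee_fin EFinB !fineK //.
rewrite (total_variationD f au uv) addeAC subee // add0e.
exact: total_variation_ge.
Qed.

(** Absolute continuity passes from [f] to its variation. If the variation along [s0] is within
    [e / 2] of the total, then along any refinement the increments of [V] exceed the absolute
    increments of [f] by less than [e / 2] altogether, hence also on the cells of [J]; the
    increments of [f] on those cells cost the other [e / 2]. *)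
Lemma ac_variation_small (e : R) : 0 < e ->
  exists2 delta : R, 0 < delta & exists2 s0 : seq R, itv_partition a b s0 &
    forall p (J : pred nat), itv_partition a b p -> subseq s0 p ->
      \sum_(i < size p | J i) (nth b (a :: p) i.+1 - nth b (a :: p) i) < delta ->
      \sum_(i < size p | J i) (V (nth b (a :: p) i.+1) - V (nth b (a :: p) i)) < e.
Proof.
move=> e0; have e20 : 0 < e / 2 by rewrite divr_gt0.
have [delta d0 H] := ac_partition_sum e20 acf.
exists delta => //.
have TVb : total_variation a b f \is a fin_num.
  by rewrite ac_total_variation_fin // lexx ltW.
have [_ [_ [s0 ps0 <-] <-] hs0] := ub_ereal_sup_adherent e20 TVb.
exists s0 => // p J pp s0p small.
have vp : V b - e / 2 < variation a b f p.
  rewrite -lte_fin EFinB fineK //; apply: (lt_le_trans hs0).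
  by rewrite lee_fin variation_subseq.
have nn (i : 'I_(size p)) : 0 <= V (nth b (a :: p) i.+1) - V (nth b (a :: p) i)
    - `|f (nth b (a :: p) i.+1) - f (nth b (a :: p) i)|.
  rewrite subr_ge0 ac_variation_increment //.
  - by rewrite itv_partition_nth_ge // ltnS ltnW.
  - by rewrite (itv_partition_nth_homo pp)// leqnSn /=.
  - by rewrite itv_partition_nth_le // ltnS.
have tot : \sum_(i < size p) (V (nth b (a :: p) i.+1) - V (nth b (a :: p) i)
    - `|f (nth b (a :: p) i.+1) - f (nth b (a :: p) i)|) < e / 2.
  rewrite sumrB -(big_mkord xpredT (fun i => V (nth b (a :: p) i.+1) - V (nth b (a :: p) i))).
  rewrite -(big_mkord xpredT (fun i => `|f (nth b (a :: p) i.+1) - f (nth b (a :: p) i)|)).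
  rewrite -/(variation a b f p) telescope_sumr // (itv_partition_nth_size _ pp) /=.
  by rewrite total_variationxx /= subr0 ltrBlDr -ltrBlDl.
have S1 := H a b p J (lexx _) (lexx _) pp small.
have : \sum_(i < size p | J i) (V (nth b (a :: p) i.+1) - V (nth b (a :: p) i)
    - `|f (nth b (a :: p) i.+1) - f (nth b (a :: p) i)|) < e / 2.
  apply: le_lt_trans tot; rewrite [X in _ <= X](bigID (fun i : 'I__ => J i)) /=.
  by rewrite lerDl; apply: sumr_ge0 => i _; exact: nn.
by rewrite sumrB ltrBlDr => /lt_trans; apply; rewrite {2}(splitr e) ltrD2l.
Qed.

Lemma ac_partition_refine (s0 pts : seq R) : itv_partition a b s0 ->
  exists2 p, itv_partition a b p & subseq s0 p /\
    forall t, a < t <= b -> t \in pts -> t \in p.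
Proof.
move=> ps0; pose p := sort <=%O (undup [seq t <- s0 ++ pts | a < t <= b]).
have memp t : (t \in p) = (a < t <= b) && (t \in s0 ++ pts).
  by rewrite mem_sort mem_undup mem_filter.
have srt : sorted <%R p by rewrite sort_lt_sorted undup_uniq.
case: (ps0) => path0 /eqP last0.
have s0ab t : t \in s0 -> a < t <= b.
  move=> ts; rewrite (allP (order_path_min lt_trans path0) t ts)/=.
  have /(nthP b)[j js <-] := ts; exact: (itv_partition_nth_le (m := j.+1) _ ps0).
have bs0 : b \in s0.
  move: last0; case: (s0) => [/= E|x s /= <-]; first by move: ab; rewrite E ltxx.
  exact: mem_last.
have bp : b \in p by rewrite memp ab lexx mem_cat bs0.
have pathp : path <%R a p.
  rewrite path_sortedE; last exact: lt_trans.
  by rewrite srt andbT; apply/allP => t; rewrite memp => /andP[/andP[]].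
have lastp : last a p = b.
  apply/eqP; rewrite eq_le; apply/andP; split.
    have : last a p \in p.
      by move: bp; case: (p) => //= x s _; exact: mem_last.
    by rewrite memp => /andP[/andP[]].
  have lesrt : sorted <=%R (a :: p) by have /andP[] := @lt_sorted_is_uniq_le _ _ (a :: p) pathp.
  move: bp => /(nthP a)[j jp <-]; rewrite (last_nth a) -[X in X <= _]/(nth a (a :: p) j.+1).
  by rewrite (sorted_leq_nth le_trans lexx a lesrt)// inE /= ltnS.
exists p; first by split => //; apply/eqP.
split; last by move=> t abt tpts; rewrite memp abt mem_cat tpts orbT.
suff -> : s0 = [seq t <- p | t \in s0] by exact: filter_subseq.
apply: lt_sorted_eq => //; first exact: path_sorted path0.
  by rewrite lt_sorted_filter.
by move=> t; rewrite mem_filter memp mem_cat; case: (boolP (t \in s0)) => // /s0ab ->.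
Qed.

Lemma itv_partition_cell p x : itv_partition a b p -> a < x <= b ->
  exists i : 'I_(size p), nth b (a :: p) i < x <= nth b (a :: p) i.+1.
Proof.
move=> [pathp /eqP lastp] /andP[ax xb].
have hp : has (fun t => x <= t) p.
  apply/hasP; exists b => //; rewrite -lastp.
  by move: lastp; case: (p) => [/= E|y s _]; [move: (lt_le_trans ax xb); rewrite E ltxx|by rewrite /= mem_last].
have ip : (find (fun t => (x <= t)%R) p < size p)%N by rewrite -has_find.
exists (Ordinal ip) => /=; rewrite (nth_find _ hp) andbT.
case E : (find _ _) => [//|j] /=.
by rewrite ltNge (@before_find _ b (fun t => (x <= t)%R) p j) // E.
Qed.

Lemma itv_partition_cell_le p (i : 'I_(size p)) t : itv_partition a b p ->
  t \in p -> (t < nth b (a :: p) i.+1 -> t <= nth b (a :: p) i) /\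
  (nth b (a :: p) i < t -> nth b (a :: p) i.+1 <= t).
Proof.
move=> pp /(nthP b)[j jp <-].
have h := itv_partition_nth_homo pp; split; rewrite -[nth b p j]/(nth b (a :: p) j.+1).
- move=> lt; apply: (h); rewrite (ltnW (ltn_ord i)) andbT leqNgt; apply/negP => ij.
  by move: lt; rewrite ltNge h // ij.
- move=> lt; apply: (h); rewrite ltnS jp andbT leqNgt; apply/negP => ij.
  by move: lt; rewrite ltNge h // ij /= ltnW.
Qed.

Lemma lebesgue_stieltjes_measure_oc (F : cumulative R R) u v : u <= v ->
  lebesgue_stieltjes_measure F `]u, v]%classic = (F v - F u)%:E.
Proof.
move=> uv; rewrite /lebesgue_stieltjes_measure /measure_extension /=.
rewrite measurable_mu_extE /=; last exact: is_ocitv.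
by rewrite wlength_itv_bnd.
Qed.

Lemma lebesgue_measure_null_cover (E : set R) (delta : R) : 0 < delta ->
  lebesgue_measure E = 0%E ->
  exists z : nat -> R * R, E `<=` \bigcup_k `](z k).1, (z k).2]%classic /\
    forall n, (\sum_(k < n) lebesgue_measure `](z k).1, (z k).2]%classic < delta%:E)%E.
Proof.
move=> d0 E0.
have : (lebesgue_measure E < delta%:E)%E by rewrite E0 lte_fin.
rewrite {1}/lebesgue_measure /lebesgue_stieltjes_measure /measure_extension /mu_ext.
move=> /ereal_inf_lt[_ [A [mA EA] <-] sumA].
have /choice[z zA] : forall k, exists z : R * R, `]z.1, z.2]%classic = A k.
  by move=> k; have [z _ <-] := mA k; exists z.
exists z; split; first by move=> t /EA[k _ Ak]; exists k => //; rewrite zA.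
move=> n; apply: le_lt_trans sumA.
have -> : (\sum_(k < n) lebesgue_measure `](z k).1, (z k).2]%classic)%E =
    (\sum_(0 <= k < n) wlength idfun (A k))%E.
  rewrite big_mkord; apply: eq_bigr => k _; rewrite zA.
  by rewrite /lebesgue_measure /lebesgue_stieltjes_measure /measure_extension measurable_mu_extE.
by apply: nneseries_lim_ge => k _ _; rewrite wlength_ge0.
Qed.

(** Once all endpoints belong to the partition, a cell that meets the union lies inside one of the
    intervals. The total length of such cells is then below [delta], and [ac_variation_small]
    applies. The factor 2 serves the monotone functions [V + f] and [V - f], whose increments are at
    most twice those of [V]. *)
Lemma ac_null_finite (F : cumulative R R) (e : R) : 0 < e ->
  (forall u v, a <= u -> u <= v -> v <= b -> F v - F u <= 2 * (V v - V u)) ->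
  exists2 delta : R, 0 < delta & forall n (z : nat -> R * R),
    (\sum_(k < n) lebesgue_measure `](z k).1, (z k).2]%classic < delta%:E)%E ->
    (lebesgue_stieltjes_measure F
      ((\big[setU/set0]_(k < n) `](z k).1, (z k).2]%classic) `&` `]a, b]%classic) <= e%:E)%E.
Proof.
move=> e0 FV; have e20 : 0 < e / 2 by rewrite divr_gt0.
have [delta d0 [s0 ps0 H]] := ac_variation_small e20.
exists delta => // n z small.
have [p pp [s0p zp]] := ac_partition_refine
  (flatten [seq [:: (z k).1; (z k).2] | k <- iota 0 n]) ps0.
have {zp} zp (k : 'I_n) t : t = (z k).1 \/ t = (z k).2 -> a < t <= b -> t \in p.
  move=> tz abt; apply: zp => //; apply/flattenP; exists [:: (z k).1; (z k).2].
    by apply/mapP; exists (k : nat) => //; rewrite mem_iota /=.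
  by rewrite !inE; case: tz => ->; rewrite eqxx ?orbT.
pose q := nth b (a :: p).
pose J (i : nat) := [exists k : 'I_n, ((z k).1 <= q i) && (q i.+1 <= (z k).2)].
have qle (i : 'I_(size p)) : [/\ a <= q i, q i <= q i.+1 & q i.+1 <= b].
  split; first by rewrite itv_partition_nth_ge // ltnS ltnW.
    by rewrite (itv_partition_nth_homo pp)// leqnSn /=.
  by rewrite itv_partition_nth_le // ltnS.
have cover : (\big[setU/set0]_(k < n) `](z k).1, (z k).2]%classic) `&` `]a, b]%classic `<=`
    \big[setU/set0]_(i < size p | J i) `]q i, q i.+1]%classic.
  move=> t [+ /=]; rewrite in_itv /= -(bigcup_mkord n (fun k => `](z k).1, (z k).2]%classic)) => -[k /= kn].
  rewrite in_itv /= => /andP[kt tk] abt; have /andP[at_ tb] := abt.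
  have [i /andP[it ti]] := itv_partition_cell pp abt.
  rewrite (bigD1 i) /=; first by left; rewrite /= in_itv /= it.
  apply/existsP; exists (Ordinal kn) => /=; apply/andP; split.
    have [ka|ak] := leP (z k).1 a; first by have [/(le_trans ka)] := qle i.
    have kp : (z k).1 \in p by apply: (zp (Ordinal kn)); [left|rewrite ak ltW // (lt_le_trans kt)].
    by have [+ _] := itv_partition_cell_le i pp kp; apply; apply: lt_le_trans ti.
  have [bk|kb] := leP b (z k).2; first by have [_ _ /le_trans] := qle i; apply.
  have kp : (z k).2 \in p by apply: (zp (Ordinal kn)); [right|rewrite (lt_le_trans at_) //= ltW].
  by have [_] := itv_partition_cell_le i pp kp; apply; apply: lt_le_trans tk.
have mcell i : measurable (`]q i, q i.+1]%classic : set R) by exact: measurable_itv.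
have mz : measurable (\big[setU/set0]_(k < n) `](z k).1, (z k).2]%classic : set R).
  by apply: bigsetU_measurable.
have disj : trivIset [set i : 'I_(size p) | J i] (fun i => `]q i, q i.+1]%classic : set R).
  apply/trivIsetP => i j _ _ ij; rewrite -subset0 => t [] /=; rewrite !in_itv /=.
  have hm (i' j' : 'I_(size p)) : (i' < j')%N -> q i'.+1 <= q j'.
    by move=> lt; rewrite (itv_partition_nth_homo pp)// lt /= ltnW.
  move=> /andP[it ti] /andP[jt tj].
  have : (i < j)%N || (j < i)%N by rewrite -neq_ltn.
  case/orP => /hm h.
    by have := lt_le_trans jt (le_trans ti h); rewrite ltxx.
  by have := lt_le_trans it (le_trans tj h); rewrite ltxx.
have sumJ : \sum_(i < size p | J i) (q i.+1 - q i) < delta.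
  rewrite -lte_fin; apply: le_lt_trans small.
  have -> : (\sum_(i < size p | J i) (q i.+1 - q i))%:E =
      lebesgue_measure (\big[setU/set0]_(i < size p | J i) `]q i, q i.+1]%classic : set R).
    rewrite measure_bigsetU_ord_cond // -sumEFin; apply: eq_bigr => i _.
    by have [_ qq _] := qle i; exact/esym/(lebesgue_stieltjes_measure_oc idfun qq).
  apply: (@content_subadditive _ _ _ lebesgue_measure _ (fun k => `](z k).1, (z k).2]%classic) n) => //; first by apply: bigsetU_measurable.
  move=> t; rewrite -bigcup_seq_cond => -[i /= /andP[_ /existsP[k /andP[k1 k2]]]].
  rewrite in_itv /= => /andP[it ti].
  rewrite -(bigcup_mkord n (fun k => `](z k).1, (z k).2]%classic)); exists (k : nat) => //=.
  by rewrite in_itv /= (le_lt_trans k1) //= (le_trans ti).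
have {}H := H p J pp s0p sumJ.
apply: (@le_trans _ _ (lebesgue_stieltjes_measure F
    (\big[setU/set0]_(i < size p | J i) `]q i, q i.+1]%classic : set R))).
  by apply: le_measure => //; rewrite inE; [exact: measurableI|exact: bigsetU_measurable].
rewrite measure_bigsetU_ord_cond //.
rewrite (eq_bigr (fun i : 'I__ => (F (q i.+1) - F (q i))%:E)); last first.
  by move=> i _; have [_ qq _] := qle i; exact: (lebesgue_stieltjes_measure_oc F qq).
rewrite sumEFin lee_fin (le_trans (y := \sum_(i < size p | J i) 2 * (V (q i.+1) - V (q i))))//.
  by apply: ler_sum => i _; have [? ? ?] := qle i; exact: FV.
by rewrite -mulr_sumr -ler_pdivlMl // mulrC ltW.
Qed.

(** A null set has a cover by intervals of total length below any [delta]; finite parts of the cover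
    fall under [ac_null_finite], and continuity from below gives the whole. *)
Lemma ac_null (F : cumulative R R) (E : set R) :
  (forall u v, a <= u -> u <= v -> v <= b -> F v - F u <= 2 * (V v - V u)) ->
  measurable E -> lebesgue_measure E = 0%E ->
  lebesgue_stieltjes_measure F (E `&` `]a, b]%classic) = 0%E.
Proof.
move=> FV mE E0; apply/eqP; rewrite eq_le measure_ge0 andbT.
apply/lee_addgt0Pr => e e0; rewrite add0e.
have [delta d0 H] := ac_null_finite e0 FV.
have [z [Ez small]] := lebesgue_measure_null_cover d0 E0.
pose U n := (\bigcup_(k in `I_n) `](z k).1, (z k).2]%classic) `&` `]a, b]%classic : set R.
have mU n : measurable (U n) by apply: measurableI => //; exact: bigcup_measurable.
have mUU : measurable (\bigcup_n U n) by exact: bigcup_measurable.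
apply: (@le_trans _ _ (lebesgue_stieltjes_measure F (\bigcup_n U n))).
  apply: le_measure; rewrite ?inE //; first exact: measurableI.
  by move=> t [/Ez[k _ zk] abt]; exists k.+1 => //; split => //; exists k => /=.
have ndU : nondecreasing_seq U.
  move=> m n mn; apply/subsetPset => t [[k /= km zk] abt]; split => //.
  by exists k => //=; exact: leq_trans mn.
have := nondecreasing_cvg_mu (mu := lebesgue_stieltjes_measure F) mU mUU ndU.
move=> /cvg_lim <- //; apply: lime_le.
  by apply: ereal_nondecreasing_is_cvgn => m n mn; apply: le_measure; rewrite ?inE; [exact: mU|exact: mU|exact/subsetPset/ndU].
by apply: nearW => n; rewrite /= /U (bigcup_mkord n (fun k => `](z k).1, (z k).2]%classic)); exact: H.
Qed.

End VariationMeasure.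

(** * The fundamental theorem of calculus for absolutely continuous functions *)

Section AbsolutelyContinuousFTC.
Context {R : realType}.
Notation mu := (@lebesgue_measure R).

(** Freezing [G] outside [[a, b]] gives a nondecreasing right-continuous function on the line, as a
    Stieltjes measure asks for. *)
Lemma clamp_cumulative (a b : R) (G : R -> R) : a < b ->
  {in `[a, b] &, {homo G : u v / u <= v}} -> {within `[a, b], continuous G} ->
  exists F : cumulative R R, forall t, a <= t <= b -> F t = G t.
Proof.
move=> ab ndG /(continuous_within_itvP _ ab)[Gc Ga Gb].
pose clamp t := Num.max a (Num.min b t).
have clamp_in t : clamp t \in `[a, b].
  by rewrite in_itv /= le_max lexx ge_max (ltW ab) ge_min lexx.
have clampE t : a <= t <= b -> clamp t = t.
  by move=> /andP[at_ tb]; rewrite /clamp min_r // max_r.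
have nd : nondecreasing (G \o clamp).
  by move=> u v uv /=; apply: ndG => //; apply: le_max2 => //; apply: le_min2.
have rc : right_continuous (G \o clamp).
  move=> t; have [ta|at_] := ltP t a.
    apply: (@cvg_trans _ ((cst (G a)) @ t^'+)).
      apply: near_eq_cvg; near=> u; rewrite /= /clamp max_l // ge_min.
      by rewrite [X in _ || X]ltW ?orbT //; near: u; exact: nbhs_right_lt.
    rewrite /= /clamp max_l; first exact: cvg_cst.
    by rewrite ge_min (ltW ta) orbT.
  have [tb|bt] := ltP t b; last first.
    apply: (@cvg_trans _ ((cst (G b)) @ t^'+)).
      apply: near_eq_cvg; near=> u; rewrite /= /clamp min_l; first by rewrite max_r // ltW.
      by apply: (le_trans bt); apply: ltW; near: u; exact: nbhs_right_gt.
    rewrite /= /clamp min_l // max_r ?(ltW ab) //; exact: cvg_cst.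
  rewrite /= clampE ?at_ ?ltW //.
  apply: (@cvg_trans _ (G @ t^'+)).
    apply: near_eq_cvg; near=> u; rewrite /= clampE //; apply/andP; split.
      by apply: (le_trans at_); apply: ltW; near: u; exact: nbhs_right_gt.
    by apply: ltW; near: u; exact: nbhs_right_lt.
  move: at_; rewrite le_eqVlt => /predU1P[<- //|at_].
  by apply: cvg_within_filter; apply: Gc; rewrite in_itv /= at_.
pose F : cumulative R R := HB.pack (G \o clamp) (isCumulative.Build R _ R (G \o clamp) nd rc).
by exists F => t tab /=; rewrite clampE.
Unshelve. all: by end_near. Qed.

Lemma ac_continuous (a b : R) (f : R -> R) : a < b ->
  absolutely_continuous_on a b f -> {within `[a, b], continuous f}.
Proof.
move=> ab acf; have H e : 0 < e -> exists2 delta : R, 0 < delta &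
    forall u v, a <= u -> u <= v -> v <= b -> v - u < delta -> `|f v - f u| < e.
  move=> e0; have [delta d0 H] := acf e e0; exists delta => // u v au uv vb vu.
  have := H 1%N (fun=> u) (fun=> v); rewrite !big_ord1; apply => //.
  - by move=> _; rewrite au uv.
  - by move=> i j; rewrite (ord1 i) (ord1 j) eqxx.
have K e : 0 < e -> exists2 delta : R, 0 < delta &
    forall u v, a <= u <= b -> a <= v <= b -> `|v - u| < delta -> `|f v - f u| < e.
  move=> /H[delta d0 Hd]; exists delta => // u v /andP[au ub] /andP[av vb] uv.
  have [lt|lt] := leP u v; first by apply: Hd => //; apply: le_lt_trans uv; rewrite ler_norm.
  by rewrite distrC; apply: Hd => //; [exact: ltW|rewrite distrC in uv; apply: le_lt_trans uv; rewrite ler_norm].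
apply/subspace_continuousP => t /= tab; apply/cvgrPdist_lt => e e0.
have [delta d0 Hd] := K e e0.
rewrite near_withinE; near=> u => /= uab.
rewrite !in_itv /= in tab uab.
by rewrite distrC; apply: Hd => //; rewrite distrC; near: u; exact: cvgr_dist_lt.
Unshelve. all: by end_near. Qed.

Section density.
Variables (a b : R) (f : R -> R).
Hypotheses (ab : a < b) (acf : absolutely_continuous_on a b f).
Notation V := (fun t => fine (total_variation a t f)).

Lemma ac_density (G : R -> R) : {within `[a, b], continuous G} ->
  (forall u v, a <= u -> u <= v -> v <= b -> 0 <= G v - G u <= 2 * (V v - V u)) ->
  exists2 g : R -> R, mu.-integrable setT (EFin \o g) &
    forall u v, a <= u -> u <= v -> v <= b ->
      (G v - G u)%:E = (\int[mu]_(t in `]u, v]) (g t)%:E)%E.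
Proof.
move=> cG GV.
have ndG : {in `[a, b] &, {homo G : u v / u <= v}}.
  move=> u v; rewrite !in_itv /= => /andP[au _] /andP[_ vb] uv.
  by rewrite -subr_ge0; have /andP[] := GV u v au uv vb.
have [F FG] := clamp_cumulative ab ndG cG.
have FGV u v : a <= u -> u <= v -> v <= b -> F v - F u <= 2 * (V v - V u).
  move=> au uv vb; rewrite !FG ?au ?vb ?(le_trans uv) ?(le_trans au) //.
  by have /andP[] := GV u v au uv vb.
have mab : measurable (`]a, b]%classic : set (measurableTypeR R)) by exact: measurable_itv.
have fin : (lebesgue_stieltjes_measure F `]a, b]%classic < +oo)%E.
  by rewrite lebesgue_stieltjes_measure_oc ?ltry // ltW.
pose nu : {finite_measure set (measurableTypeR R) -> \bar R} := mfrestr mab fin.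
have numu : nu `<< mu.
  apply/null_content_dominatesP => E mE E0.
  exact: (ac_null ab acf FGV mE E0).
have [g [g0 gfin gint nuE]] := radon_nikodym_sigma_finite numu.
have gE : EFin \o (fine \o g) = g by apply/funext => t /=; rewrite fineK.
exists (fine \o g); first by rewrite gE.
move=> u v au uv vb.
transitivity (nu `]u, v]%classic).
  have -> : nu `]u, v]%classic = lebesgue_stieltjes_measure F (`]u, v]%classic `&` `]a, b]%classic) by [].
  rewrite setIidl; last first.
    by move=> t /=; rewrite !in_itv /= => /andP[ut tv]; rewrite (le_lt_trans au) //= (le_trans tv).
  by rewrite lebesgue_stieltjes_measure_oc // !FG // ?au ?vb ?(le_trans uv) ?(le_trans au).
rewrite nuE //; apply: eq_integral => t _ /=; by rewrite fineK.
Qed.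

Lemma ac_ftc : exists g : R -> R, [/\ mu.-integrable setT (EFin \o g),
  forall u v, a <= u -> u <= v -> v <= b ->
    f v - f u = \int[mu]_(t in `[u, v]) g t &
  {ae mu, forall t, a < t < b -> derivable f t 1 /\ derive1 f t = g t}].
Proof.
have cf := ac_continuous ab acf.
have cV : {within `[a, b], continuous V}.
  by apply: total_variation_continuous => //; apply: ac_bounded_variation => //; exact: ltW.
have Vf u v : a <= u -> u <= v -> v <= b -> `|f v - f u| <= V v - V u.
  by move=> ? ? ?; exact: (ac_variation_increment ab acf).
(* [f] is half the difference of the monotone functions [V + f] and [V - f], each of which has a
   density. *)
have [||g1 ig1 g1E] := @ac_density (fun t => V t + f t).
- by move=> t; apply: cvgD; [exact: cV|exact: cf].
- by move=> u v au uv vb; have := Vf u v au uv vb; rewrite ler_norml; lra.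
have [||g2 ig2 g2E] := @ac_density (fun t => V t - f t).
- by move=> t; apply: cvgB; [exact: cV|exact: cf].
- by move=> u v au uv vb; have := Vf u v au uv vb; rewrite ler_norml; lra.
pose g t := (g1 t - g2 t) / 2.
have ig : mu.-integrable setT (EFin \o g).
  rewrite (_ : _ \o _ = (fun t => (2^-1)%:E * ((g1 t)%:E - (g2 t)%:E))%E); last first.
    by apply/funext => t; rewrite /g /= -EFinB -EFinM mulrC.
  by apply: integrableZl => //; apply: integrableB.
have gE u v : a <= u -> u <= v -> v <= b -> (f v - f u)%:E = (\int[mu]_(t in `]u, v]) (g t)%:E)%E.
  move=> au uv vb.
  have i1 : mu.-integrable `]u, v] (EFin \o g1) by exact: integrableS ig1.
  have i2 : mu.-integrable `]u, v] (EFin \o g2) by exact: integrableS ig2.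
  have -> : (f v - f u)%:E = ((2^-1)%:E * ((V v + f v - (V u + f u))%:E - (V v - f v - (V u - f u))%:E))%E.
    by rewrite -EFinB -EFinM; congr EFin; lra.
  rewrite g1E // g2E // -integralB // -integralZl //; last exact: integrableB.
  by apply: eq_integral => t _; rewrite /g /= -EFinB -EFinM mulrC.
exists g; split => //.
  move=> u v au uv vb; rewrite /Rintegral -integral_itv_obnd_cbnd; last first.
    by apply: (measurable_funS measurableT) => //; have /integrableP[] := ig.
  by rewrite -gE.
have lg : locally_integrable [set: R] g by apply: open_integrable_locally => //; exact: openT.
have iy y : mu.-integrable [set` Interval (BRight a) (BRight y)] (EFin \o g).
  exact: integrableS ig.
have := FTC1 iy lg.
apply: filterS => [|t H /andP[at_ tb]]; first exact: (ae_filter_ringOfSetsType mu).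
have [|dF F'] := H; first by rewrite lte_fin.
have dH : is_derive t 1 (fun u => f a + \int[mu]_(s in `]a, u]) g s) (g t).
  by apply: is_derive_eq (add0r _); apply: is_deriveD; apply: DeriveDef => //; rewrite -derive1E.
have dft : is_derive t 1 f (g t).
  apply: near_eq_is_derive dH; near=> u.
  have au : a <= u by apply: ltW; near: u; exact: lt_nbhsr.
  have ub : u <= b by apply: ltW; near: u; exact: lt_nbhsl.
  by rewrite /Rintegral -gE //= addrC subrK.
by split; [exact: ex_derive|rewrite derive1E; exact: derive_val].
Unshelve. all: by end_near. Qed.

End density.
End AbsolutelyContinuousFTC.

(** * The rate of a path on a grid *)

Section NonmeasurableIntegral.
Context d (X : measurableType d) (R : realType) (mu : {measure set X -> \bar R}).
Local Open Scope ereal_scope.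
Import HBNNSimple.

(* [derive1 phi] is not known to be measurable, so neither is the integrand of
   the action; its integral is still the supremum over the simple functions
   below it. *)
Lemma ge0_le_integral_nonmeas (D : set X) (f g : X -> \bar R) :
  (forall t, D t -> 0 <= f t) -> (forall t, D t -> f t <= g t) ->
  \int[mu]_(t in D) f t <= \int[mu]_(t in D) g t.
Proof.
move=> f0 fg; rewrite integral_mkcond [leRHS]integral_mkcond.
have h t : 0 <= (f \_ D) t <= (g \_ D) t.
  rewrite /patch; case: ifPn => [/set_mem Dt|_]; last by rewrite lexx.
  by rewrite f0 //= fg.
rewrite !ge0_integralTE; last 2 first.
- by move=> t; have /andP[/le_trans] := h t; apply.
- by move=> t; have /andP[] := h t.
apply: le_ereal_sup => _ [k /= kf <-]; exists k => // t.
by apply: (le_trans (kf t)); have /andP[] := h t.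
Qed.

(** The smaller function is the measurable one: the exceptional null set can be removed from its
    integral, after which the comparison is pointwise. *)
Lemma ae_ge0_le_integral_lower (D : set X) (f g : X -> \bar R) : measurable D ->
  measurable_fun D f -> (forall t, D t -> 0 <= f t) -> (forall t, D t -> 0 <= g t) ->
  {ae mu, forall t, D t -> f t <= g t} ->
  \int[mu]_(t in D) f t <= \int[mu]_(t in D) g t.
Proof.
move=> mD mf f0 g0 [N [mN muN fgN]].
rewrite (ge0_negligible_integral _ _ _ _ muN) //.
apply: (@le_trans _ _ (\int[mu]_(t in D `\` N) g t)).
  apply: ge0_le_integral_nonmeas => [t [Dt _]|t [Dt Nt]]; first exact: f0.
  by move/subsetCl : fgN; exact.
rewrite integral_mkcond [leRHS]integral_mkcond; apply: ge0_le_integral_nonmeas => t _.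
  by rewrite /patch; case: ifPn => // /set_mem[/g0].
rewrite /patch; case: ifPn => [/set_mem[Dt _]|_]; first by rewrite mem_set.
by case: ifPn => // /set_mem/g0.
Qed.

(** Here the larger function is the measurable one, and each simple function below [g] is compared
    with it almost everywhere. *)
Lemma ae_ge0_le_integral_upper (D : set X) (f g : X -> \bar R) : measurable D ->
  measurable_fun D f -> (forall t, D t -> 0 <= f t) -> (forall t, D t -> 0 <= g t) ->
  {ae mu, forall t, D t -> g t <= f t} ->
  \int[mu]_(t in D) g t <= \int[mu]_(t in D) f t.
Proof.
move=> mD mf f0 g0 gf; rewrite integral_mkcond ge0_integralTE; last first.
  by move=> t; rewrite /patch; case: ifPn => // /set_mem/g0.
apply: ge_ereal_sup => _ [k /= kg <-].
rewrite -integralT_nnsfun [leRHS]integral_mkcond.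
apply: ae_ge0_le_integral => //.
- by move=> t _; rewrite lee_fin fun_ge0.
- by apply/measurable_EFinP.
- by move=> t _; rewrite /patch; case: ifPn => // /set_mem/f0.
- by apply/(measurable_restrictT _ _).1.
- apply: filterS gf => t gft _; apply: (le_trans (kg t)).
  by rewrite /patch; case: ifPn => // /set_mem/gft.
Qed.

End NonmeasurableIntegral.

(** * Integrals of the clock rate along a path *)

Section Clock.
Context {R : realType}.
Notation mu := (@lebesgue_measure R).
Variables (c : R -> R).
Hypothesis cc : continuous c.

Definition clock (phi : R -> R) (u v : R) : R := \int[mu]_(t in `[u, v]) c (phi t).

Variables (T : R) (phi psi : R -> R).
Hypotheses (cphi : {within `[0, T], continuous phi}) (cpsi : {within `[0, T], continuous psi}).

Lemma sub_continuous (f : R -> R) (u v : R) : 0 <= u -> v <= T ->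
  {within `[0, T], continuous f} -> {within `[u, v], continuous f}.
Proof.
move=> u0 vT; apply: continuous_subspaceW.
by move=> t; rewrite /= !in_itv /= => /andP[ut tv]; rewrite (le_trans u0) //= (le_trans tv).
Qed.

Lemma comp_continuous (f : R -> R) (u v : R) : 0 <= u -> v <= T ->
  {within `[0, T], continuous f} -> {within `[u, v], continuous (c \o f)}.
Proof.
move=> u0 vT cf; apply: within_continuous_comp; last exact: sub_continuous.
by move=> z _; exact: cc.
Qed.

Lemma clock_integrable (f : R -> R) (u v : R) : 0 <= u -> v <= T ->
  {within `[0, T], continuous f} -> mu.-integrable `[u, v] (EFin \o (c \o f)).
Proof.
move=> u0 vT cf; apply: continuous_compact_integrable; first exact: segment_compact.
exact: comp_continuous.
Qed.

Lemma clock_split (u v w : R) : 0 <= u -> u <= v -> v <= w -> w <= T ->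
  clock phi u w = clock phi u v + clock phi v w.
Proof.
move=> u0 uv vw wT.
have iuw := clock_integrable u0 wT cphi.
have ivw := clock_integrable (le_trans u0 uv) wT cphi.
rewrite /clock -(@Rintegral_itv_obnd_cbnd _ v (BRight w)); last first.
  by apply: integrableS ivw => //; apply: subset_itvr; rewrite bnd_simp.
by rewrite -(@Rintegral_itvB _ _ (BLeft u) (BRight w) v) ?bnd_simp // addrC subrK.
Qed.

Lemma Rintegral_itv_cst (k u v : R) : u <= v -> \int[mu]_(_ in `[u, v]) k = k * (v - u).
Proof.
move=> uv; rewrite Rintegral_cst //; congr (_ * _).
transitivity (fine (lebesgue_measure ([set` `[u, v]] : set R))); first by [].
by rewrite lebesgue_measure_itv /= lte_fin; case: ltP => // vu; rewrite (le_anti (introT andP (conj uv vu))) !subrr.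
Qed.

Lemma clock_ge (u v k : R) : 0 <= u -> u <= v -> v <= T ->
  (forall t, u <= t <= v -> k <= c (phi t)) -> k * (v - u) <= clock phi u v.
Proof.
move=> u0 uv vT h; rewrite -Rintegral_itv_cst //; apply: le_Rintegral => //.
- by apply: continuous_compact_integrable; [exact: segment_compact|move=> ?; exact: cvg_cst].
- exact: clock_integrable.
Qed.

Lemma clock_le (u v k : R) : 0 <= u -> u <= v -> v <= T ->
  (forall t, u <= t <= v -> c (phi t) <= k) -> clock phi u v <= k * (v - u).
Proof.
move=> u0 uv vT h; rewrite -Rintegral_itv_cst //; apply: le_Rintegral => //.
- exact: clock_integrable.
- by apply: continuous_compact_integrable; [exact: segment_compact|move=> ?; exact: cvg_cst].
Qed.

Lemma clock_dist (u v k : R) : 0 <= u -> u <= v -> v <= T ->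
  (forall t, u <= t <= v -> `|c (phi t) - c (psi t)| <= k) ->
  `|clock phi u v - clock psi u v| <= k * (v - u).
Proof.
move=> u0 uv vT h; rewrite -Rintegral_itv_cst // /clock -RintegralB //; try exact: clock_integrable.
have ik : mu.-integrable `[u, v] (EFin \o cst k).
  by apply: continuous_compact_integrable; [exact: segment_compact|move=> ?; exact: cvg_cst].
have id : mu.-integrable `[u, v] (EFin \o (fun t => c (phi t) - c (psi t))).
  exact: (integrableB _ (clock_integrable u0 vT cphi) (clock_integrable u0 vT cpsi)).
apply: (le_trans (le_normr_Rintegral _ _)) => //.
apply: le_Rintegral => //.
have := integrable_abse id; apply: eq_integrable => //.
Qed.

End Clock.

(** * Grid rates and the integral of the Legendre transform *)

Section RateFunction.
Context {R : realType}.
Notation mu := (@lebesgue_measure R).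
Variables (c Lam : R -> R) (T : R).
Hypotheses (cc : continuous c) (Lam0 : Lam 0 = 0) (T_gt0 : 0 < T).

Definition grid (n i : nat) : R := T * (i%:R / n%:R).

Definition grid_rate (n : nat) (l : nat -> R) (phi : R -> R) : R :=
  \sum_(i < n) (- l i * (phi (grid n i.+1) - phi (grid n i))
    - Lam (l i) * clock c phi (grid n i) (grid n i.+1)).

(** With [c] the clock rate and [Lam] the cumulant of [xi + eta] this is convertible to
    [lagrangian]; the sign in front of [beta] is that of the exponent in the Hamiltonian. *)
Definition legendre (h alpha : R) : \bar R :=
  ereal_sup [set (alpha * beta - c h * Lam (- beta))%:E | beta in setT].

Lemma legendre_ge0 h alpha : (0 <= legendre h alpha)%E.
Proof.
apply: ereal_sup_ubound; exists 0 => //.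
by rewrite oppr0 Lam0 !mulr0 subr0.
Qed.

Lemma grid0 n : grid n 0 = 0.
Proof. by rewrite /grid mul0r mulr0. Qed.

Lemma gridn n : (0 < n)%N -> grid n n = T.
Proof. by move=> n0; rewrite /grid divff ?mulr1 // pnatr_eq0 -lt0n. Qed.

Lemma grid_le n i j : (i <= j)%N -> grid n i <= grid n j.
Proof. by move=> ij; rewrite ler_pM2l // ler_wpM2r ?invr_ge0 // ler_nat. Qed.

Lemma grid_ge0 n i : 0 <= grid n i.
Proof. by rewrite -(grid0 n) grid_le. Qed.

Lemma grid_leT n i : (i <= n)%N -> grid n i <= T.
Proof.
case: n => [|n] ni; last by rewrite -(gridn (ltn0Sn n)) grid_le.
by rewrite /grid invr0 !mulr0 ltW.
Qed.

Lemma grid_step n i : grid n i.+1 - grid n i = T / n%:R.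
Proof. by rewrite /grid -mulrBr -mulrBl -natr1 addrAC subrr add0r mul1r. Qed.

Lemma ae_neq (a : R) : {ae mu, forall t, t != a}.
Proof.
exists [set a]; split => //; first exact: lebesgue_measure_set1.
by move=> t /= /negP; rewrite negbK => /eqP.
Qed.

Section lower.
Variables (phi g : R -> R).
Hypotheses (cphi : {within `[0, T], continuous phi})
  (ig : mu.-integrable setT (EFin \o g))
  (gE : forall u v, 0 <= u -> u <= v -> v <= T -> phi v - phi u = \int[mu]_(t in `[u, v]) g t)
  (dg : {ae mu, forall t, 0 < t < T -> derivable phi t 1 /\ derive1 phi t = g t}).

Let F (l s : R) : R := - l * g s - Lam l * c (phi s).

Lemma integrable_affine l u v : 0 <= u -> u <= v -> v <= T ->
  mu.-integrable `[u, v] (EFin \o F l) /\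
  \int[mu]_(t in `[u, v]) F l t = - l * (phi v - phi u) - Lam l * clock c phi u v.
Proof.
move=> u0 uv vT.
have i1 : mu.-integrable `[u, v] (EFin \o g) by exact: integrableS ig.
have i2 := clock_integrable cc u0 vT cphi.
have i3 : mu.-integrable `[u, v] (EFin \o (fun t => - l * g t)).
  by apply: eq_integrable (integrableZl _ (- l) i1).
have i4 : mu.-integrable `[u, v] (EFin \o (fun t => Lam l * c (phi t))).
  by apply: eq_integrable (integrableZl _ (Lam l) i2).
split; first by apply: eq_integrable (integrableB _ i3 i4).
by rewrite RintegralB // RintegralZl // RintegralZl // gE.
Qed.

(** A measurable minorant of the Lagrangian along [phi], built from its affine parts at
    [beta = - l i] and [beta = 0]. Taking the maximum over all cells at once keeps the possibly
    nonmeasurable integrand on the whole of [[0, T]]; only the integral of [H] is cut into cells. *)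
Let H (n : nat) (l : nat -> R) (s : R) : R := \big[Num.max/0]_(i < n) F (l i) s.

Lemma measurable_max_affine n l : measurable_fun `[0, T] (H n l).
Proof.
rewrite /H; elim: n l => [|n IH] l.
  rewrite (_ : (fun s => _) = cst 0); first exact: measurable_cst.
  by apply/funext => s; rewrite big_ord0.
rewrite (_ : (fun s => _) =
    (fun s => Num.max (F (l 0%N) s) (\big[Num.max/0]_(i < n) F (l i.+1) s))); last first.
  by apply/funext => s; rewrite big_ord_recl.
apply: measurable_maxr; last exact: (IH (l \o succn)).
have [i1 _] := integrable_affine (l 0%N) (lexx 0) (ltW T_gt0) (lexx T).
by apply/measurable_EFinP; exact: measurable_int i1.
Qed.

Lemma max_affine_ge0 n l s : 0 <= H n l s.
Proof. by rewrite /H; elim/big_rec: _ => // i y _ y0; rewrite le_max y0 orbT. Qed.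

Lemma max_affine_ge n (l : nat -> R) s (i : 'I_n) : F (l i) s <= H n l s.
Proof. exact: le_bigmax. Qed.

Lemma legendre_integral_ge n l :
  (\int[mu]_(s in `[0%R, T]) (H n l s)%:E <=
   \int[mu]_(s in `[0%R, T]) legendre (phi s) (derive1 phi s))%E.
Proof.
apply: ae_ge0_le_integral_lower => //.
- by apply/measurable_EFinP; exact: measurable_max_affine.
- by move=> t _; rewrite lee_fin max_affine_ge0.
- by move=> t _; exact: legendre_ge0.
have aeF := ae_filter_ringOfSetsType mu.
move: dg (ae_neq 0) (ae_neq T); apply: filterS3 => t dt t0 tT /=.
rewrite in_itv /= => /andP[t0' tT'].
have [_ dgt] : derivable phi t 1 /\ derive1 phi t = g t.
  by apply: dt; rewrite !lt_neqAle eq_sym t0 t0' tT tT'.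
rewrite dgt /H; elim/big_rec: _ => [|i y _ yL]; first exact: legendre_ge0.
rewrite /Num.max; case: ifP => // _; apply: ereal_sup_ubound; exists (- l i) => //.
by rewrite opprK /F; congr EFin; rewrite mulrC [c _ * _]mulrC.
Qed.

Lemma cell_le n (l : nat -> R) (i : 'I_n) u v : 0 <= u -> u <= v -> v <= T ->
  ((- l i * (phi v - phi u) - Lam (l i) * clock c phi u v)%:E <=
   \int[mu]_(s in `[u, v[) (H n l s)%:E)%E.
Proof.
move=> u0 uv vT; have [iF <-] := integrable_affine (l i) u0 uv vT.
have mH : measurable_fun `[u, v] (H n l).
  apply: (measurable_funS _ _ (measurable_max_affine n l)) => //.
  by move=> t; rewrite /= !in_itv /= => /andP[ut tv]; rewrite (le_trans u0) //= (le_trans tv).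
rewrite integral_itv_bndo_bndc; last first.
  apply/measurable_EFinP; apply: measurable_funS mH => //.
  by apply: subset_itvl; rewrite bnd_simp.
rewrite /Rintegral fineK; last exact: integrable_fin_num.
(* The integral of [F (l i)] is at most that of its positive part, which [H] dominates. *)
apply: (@le_trans _ _ (\int[mu]_(t in `[u, v]) ((EFin \o F (l i))^\+ t))%E).
  by rewrite [leLHS]integralE geeDl // leeNl oppe0 integral_ge0.
apply: ge0_le_integral_nonmeas => t _; first exact: funepos_ge0.
by rewrite funeposE ge_max /= !lee_fin max_affine_ge max_affine_ge0.
Qed.

(** The endpoints are arbitrary, not only grid points: this will bound the slope of every path of
    finite rate. *)
Lemma cell_rate_le l u v : 0 <= u -> u <= v -> v <= T ->
  ((- l * (phi v - phi u) - Lam l * clock c phi u v)%:E <=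
   \int[mu]_(s in `[0%R, T]) legendre (phi s) (derive1 phi s))%E.
Proof.
move=> u0 uv vT; apply: le_trans (legendre_integral_ge 1 (fun=> l)).
apply: (le_trans (cell_le (fun=> l) (ord0 : 'I_1) u0 uv vT)).
apply: ge0_subset_integral => //.
- by apply/measurable_EFinP; exact: measurable_max_affine.
- by move=> t _; rewrite lee_fin max_affine_ge0.
- move=> t; rewrite /= !in_itv /= => /andP[ut tv].
  by rewrite (le_trans u0) //= (le_trans _ vT) // ltW.
Qed.

Lemma grid_rate_le n l : (0 < n)%N -> ((grid_rate n l phi)%:E <=
   \int[mu]_(s in `[0%R, T]) legendre (phi s) (derive1 phi s))%E.
Proof.
move=> n0; apply: le_trans (legendre_integral_ge n l).
have mH : measurable_fun `[0, T] (fun s => (H n l s)%:E).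
  by apply/measurable_EFinP; exact: measurable_max_affine.
have step j : (j <= n)%N -> ((\sum_(i < n | (i < j)%N) (- l i * (phi (grid n i.+1) - phi (grid n i))
    - Lam (l i) * clock c phi (grid n i) (grid n i.+1)))%:E <=
    \int[mu]_(s in `[0%R, grid n j[) (H n l s)%:E)%E.
  elim: j => [_|j IH jn].
    by rewrite big_pred0 //; apply: integral_ge0 => t _; rewrite lee_fin max_affine_ge0.
  rewrite (bigD1 (Ordinal jn)) //= addrC EFinD.
  rewrite (@itv_bndbnd_setU _ _ _ (BLeft (grid n j))) ?bnd_simp ?grid_ge0 ?grid_le //.
  rewrite ge0_integral_setU //; last 3 first.
  - apply: measurable_funS mH => // t.
    by move=> []; rewrite /= !in_itv /= => /andP[t0 tj]; rewrite (le_trans _ t0) ?grid_ge0 //= (le_trans (ltW tj)) // grid_leT // ltnW.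
  - by move=> t _; rewrite lee_fin max_affine_ge0.
  - by apply/disj_setPS => t []; rewrite /= !in_itv /= => /andP[_ tj] /andP[jt _]; move: (lt_le_trans tj jt); rewrite ltxx.
  apply: leeD; last first.
    by apply: (cell_le l (Ordinal jn)); [exact: grid_ge0|exact: grid_le|exact: grid_leT].
  apply: le_trans (IH (ltnW jn)).
  rewrite lee_fin le_eqVlt; apply/orP; left; apply/eqP; apply: eq_bigl => i.
  by rewrite ltnS leq_eqVlt -val_eqE /=; case: (ltngtP i j) => // ->; rewrite eqxx.
apply: (@le_trans _ _ (\int[mu]_(s in `[0%R, grid n n[) (H n l s)%:E)%E).
  by apply: le_trans (step n (leqnn n)); rewrite lee_fin le_eqVlt; apply/orP; left; apply/eqP; apply: eq_bigl => i; rewrite ltn_ord.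
rewrite gridn //; apply: ge0_subset_integral => //.
  by move=> t _; rewrite lee_fin max_affine_ge0.
by apply: subset_itvl; rewrite bnd_simp.
Qed.

End lower.

Section upper.
Variables (phi : R -> R) (K : R).
Hypotheses (lip : forall u v, 0 <= u -> u <= v -> v <= T -> `|phi v - phi u| <= K * (v - u)).

Lemma lipschitz_ac : absolutely_continuous_on 0 T phi.
Proof.
move=> e e0; have K0 : 0 < `|K| + 1 by rewrite ltr_wpDl.
exists (e / (`|K| + 1)); first by rewrite divr_gt0.
move=> n u v uv _ small; apply: (@le_lt_trans _ _ ((`|K| + 1) * \sum_(i < n) (v i - u i))).
  rewrite mulr_sumr; apply: ler_sum => i _; have [/andP[ui uvi] vi] := uv i.
  apply: (le_trans (lip ui uvi vi)); apply: ler_wpM2r; first by rewrite subr_ge0.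
  by rewrite (le_trans (ler_norm _)) // lerDl.
by rewrite mulrC -ltr_pdivlMr.
Qed.

Lemma lipschitz_continuous : {within `[0, T], continuous phi}.
Proof. exact: ac_continuous lipschitz_ac. Qed.

(** As [t] may lie anywhere in the cell, the quotient is compared through [t]: at both ends [phi]
    deviates from the tangent by at most [e] times the distance to [t], and the two distances add up
    to the cell length. *)
Lemma quotient_cvg t (u v : nat -> R) : derivable phi t 1 ->
  (forall n, u n <= t <= v n) -> (forall n, u n < v n) ->
  (v n - u n) @[n --> \oo] --> 0 ->
  ((phi (v n) - phi (u n)) / (v n - u n)) @[n --> \oo] --> derive1 phi t.
Proof.
move=> dphi utv uv cvg0; apply/cvgrPdist_le => e e0.
have e20 : 0 < e / 2 by rewrite divr_gt0.
have : h^-1 *: (phi (h + t) - phi t) @[h --> 0^'] --> derive1 phi t.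
  move: dphi; rewrite /derivable /derive1 (_ : (fun h => _ *: ((phi \o _) _ - _)) =
    (fun h => h^-1 *: (phi (h + t) - phi t))) //.
  by apply/funext => h /=; rewrite /GRing.scale /= mulr1.
move/cvgrPdist_le => /(_ e e0); rewrite near_withinE => -[r /= r0 Hr].
have key y : `|y - t| < r -> `|phi y - phi t - derive1 phi t * (y - t)| <= e * `|y - t|.
  move=> yr; have [->|yt] := eqVneq y t; first by rewrite !subrr mulr0 subr0 normr0 mulr0.
  have := Hr (y - t); rewrite /ball_ /= sub0r normrN => /(_ yr); rewrite subr_eq0 => /(_ yt).
  rewrite subrK; set q := _ *: _ => Hq.
  have -> : phi y - phi t - derive1 phi t * (y - t) = (q - derive1 phi t) * (y - t).
    rewrite mulrBl /q -[_ *: _]/((y - t)^-1 * (phi y - phi t)) mulrAC mulVf ?mul1r //.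
    by rewrite subr_eq0.
  by rewrite normrM ler_wpM2r // distrC.
have : \forall n \near \oo, `|v n - u n| < r.
  by have /cvgrPdist_lt/(_ r r0) := cvg0; apply: filterS => n; rewrite sub0r normrN.
apply: filterS => n; have /andP[ut tv] := utv n; have uvn := uv n.
rewrite gtr0_norm ?subr_gt0 // => small.
have h1 : `|v n - t| < r by rewrite ger0_norm ?subr_ge0 //; apply: le_lt_trans small; rewrite lerD2l lerN2.
have h2 : `|u n - t| < r by rewrite ler0_norm ?subr_le0 // opprB; apply: le_lt_trans small; rewrite lerD2r.
have := key _ h1; have := key _ h2.
rewrite [`|v n - t|]ger0_norm ?subr_ge0 // [`|u n - t|]ler0_norm ?subr_le0 // opprB => k2 k1.
rewrite -[X in _ <= X](mulfK (_ : v n - u n != 0)); last by rewrite subr_eq0 gt_eqF.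
rewrite -[X in `|X - _|](mulfK (_ : v n - u n != 0)); last by rewrite subr_eq0 gt_eqF.
rewrite -mulrBl normrM [`|(v n - u n)^-1|]gtr0_norm ?invr_gt0 ?subr_gt0 //.
rewrite ler_pM2r ?invr_gt0 ?subr_gt0 //.
have -> : derive1 phi t * (v n - u n) - (phi (v n) - phi (u n)) =
  (phi (u n) - phi t - derive1 phi t * (u n - t)) - (phi (v n) - phi t - derive1 phi t * (v n - t)) by ring.
apply: (le_trans (ler_normB _ _)); apply: (le_trans (lerD k2 k1)).
by rewrite -mulrDr; apply: ler_wpM2l; [exact: ltW|rewrite addrC subrKA].
Qed.

Lemma clock_quotient_cvg t (u v : nat -> R) : 0 < t < T ->
  (forall n, [/\ 0 <= u n, u n <= t <= v n, u n < v n & v n <= T]) ->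
  (v n - u n) @[n --> \oo] --> 0 ->
  (clock c phi (u n) (v n) / (v n - u n)) @[n --> \oo] --> c (phi t).
Proof.
move=> /andP[t0 tT] uv cvg0; apply/cvgrPdist_le => e e0.
have cont : {for t, continuous (c \o phi)}.
  apply: continuous_comp; last exact: cc.
  have /(continuous_within_itvP _ T_gt0)[+ _ _] := lipschitz_continuous; apply.
  by rewrite in_itv /= t0.
have /cvgrPdist_le/(_ e e0)[r /= r0 Hr] := cont.
have : \forall n \near \oo, `|v n - u n| < r.
  by have /cvgrPdist_lt/(_ r r0) := cvg0; apply: filterS => n; rewrite sub0r normrN.
apply: filterS => n; have [u0 /andP[ut tv] uvn vT] := uv n.
rewrite gtr0_norm ?subr_gt0 // => small.
have near_t s : u n <= s <= v n -> `|c (phi t) - c (phi s)| <= e.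
  move=> /andP[us sv]; apply: Hr; rewrite /ball /= ltr_norml; lra.
have cphi := lipschitz_continuous.
have lo := @clock_ge _ _ cc T phi cphi (u n) (v n) (c (phi t) - e) u0 (ltW uvn) vT.
have hi := @clock_le _ _ cc T phi cphi (u n) (v n) (c (phi t) + e) u0 (ltW uvn) vT.
have {}lo : (c (phi t) - e) * (v n - u n) <= clock c phi (u n) (v n).
  by apply: lo => s /near_t; rewrite ler_norml; lra.
have {}hi : clock c phi (u n) (v n) <= (c (phi t) + e) * (v n - u n).
  by apply: hi => s /near_t; rewrite ler_norml; lra.
rewrite -ler_pdivlMr ?subr_gt0 // in lo; rewrite -ler_pdivrMr ?subr_gt0 // in hi.
by rewrite ler_norml; lra.
Qed.

Variable s : R.
Hypothesis Js : forall n l, (0 < n)%N -> grid_rate n l phi <= s.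

Let D (n i : nat) := phi (grid n i.+1) - phi (grid n i).
Let C (n i : nat) := clock c phi (grid n i) (grid n i.+1).
Let Q (n i : nat) : set R := [set beta * D n i - Lam (- beta) * C n i | beta in setT].
Let q (n i : nat) : R := sup (Q n i).

Lemma cell_legendre_has_sup n (i : 'I_n) : has_sup (Q n i).
Proof.
split; first by exists (0 * D n i - Lam (- 0) * C n i), 0.
exists s => _ [beta _ <-].
(* Multipliers that vanish off the cell [i] leave only its own term, as [Lam 0 = 0]. *)
have := @Js n (fun j => if j == i then - beta else 0) (leq_ltn_trans (leq0n i) (ltn_ord i)).
rewrite /grid_rate (bigD1 i) //= eqxx opprK big1 ?addr0 // => j ji.
by rewrite val_eqE (negbTE ji) oppr0 mul0r Lam0 mul0r subrr.
Qed.

Lemma cell_legendre_ge n (i : 'I_n) beta : beta * D n i - Lam (- beta) * C n i <= q n i.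
Proof. by apply: sup_ubound; [exact: (cell_legendre_has_sup i).2|exists beta]. Qed.

Lemma cell_legendre_ge0 n (i : 'I_n) : 0 <= q n i.
Proof. by have := cell_legendre_ge i 0; rewrite oppr0 Lam0 !mul0r subr0. Qed.

(** The multipliers of different cells can be chosen freely, so near-maximizers, each within [e / n]
    of its supremum, combine into one admissible family. *)
Lemma sum_cell_legendre n : (0 < n)%N -> \sum_(i < n) q n i <= s.
Proof.
move=> n0; apply/ler_addgt0Pr => e e0.
have en0 : 0 < e / n%:R by rewrite divr_gt0 ?ltr0n.
have near_sup (i : 'I_n) : exists beta, q n i - e / n%:R < beta * D n i - Lam (- beta) * C n i.
  by have [_ [beta _ <-] h] := sup_adherent en0 (cell_legendre_has_sup i); exists beta.
have /choice[b Hb] := near_sup.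
pose l (j : nat) := if insub j is Some i then - b i else 0.
have lE (i : 'I_n) : l i = - b i by rewrite /l valK.
rewrite -lerBlDr; apply: le_trans (Js l n0).
have -> : \sum_(i < n) q n i - e = \sum_(i < n) (q n i - e / n%:R).
  by rewrite sumrB sumr_const card_ord -[_ / _ *+ n]mulr_natr divfK // pnatr_eq0 -lt0n.
by apply: ler_sum => i _; rewrite lE opprK; apply: ltW; exact: Hb.
Qed.

(** A discrete Lagrangian: on each cell, the optimal rate of the cell per unit time. Its integral is
    at most [s], and its lower limit dominates the Lagrangian, which is the setting of Fatou's
    lemma. *)
Let f (n : nat) (t : R) : \bar R :=
  (\sum_(i < n.+1) (q n.+1 i * (n.+1%:R / T)) * \1_(`[grid n.+1 i, grid n.+1 i.+1[) t)%:E.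

Lemma step_ge0 n t : (0 <= f n t)%E.
Proof.
rewrite lee_fin; apply: sumr_ge0 => i _; rewrite mulr_ge0 //.
by rewrite mulr_ge0 ?cell_legendre_ge0 // divr_ge0 // ltW.
Qed.

Lemma measurable_step n : measurable_fun setT (f n).
Proof.
apply/measurable_EFinP; apply: measurable_sum => i.
by apply: measurable_funM => //; exact: measurable_indic.
Qed.

Lemma integral_step n : (\int[mu]_(t in `[0%R, T]) f n t <= s%:E)%E.
Proof.
rewrite /f; under eq_integral do rewrite -sumEFin.
rewrite ge0_integral_sum //; last 2 first.
- by move=> i; apply: measurable_funTS; apply/measurable_EFinP; apply: measurable_funM => //; exact: measurable_indic.
- by move=> i t _; rewrite lee_fin mulr_ge0 // mulr_ge0 ?cell_legendre_ge0 // divr_ge0 // ltW.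
apply: (@le_trans _ _ (\sum_(i < n.+1) (q n.+1 i)%:E)%E); last first.
  by rewrite sumEFin lee_fin; exact: sum_cell_legendre.
apply: lee_sum => i _.
under eq_integral do rewrite EFinM.
rewrite ge0_integralZl_EFin //; last 2 first.
- by apply: measurable_funTS; apply/measurable_EFinP; exact: measurable_indic.
- by rewrite mulr_ge0 ?cell_legendre_ge0 // divr_ge0 // ltW.
rewrite integral_indic //.
apply: (@le_trans _ _ ((q n.+1 i * (n.+1%:R / T))%:E * mu `[grid n.+1 i, grid n.+1 i.+1[)%E).
  apply: lee_wpmul2l; first by rewrite lee_fin mulr_ge0 ?cell_legendre_ge0 // divr_ge0 // ltW.
  by apply: le_measure; rewrite ?inE //; exact: measurableI.
rewrite (_ : mu _ = (grid n.+1 i.+1 - grid n.+1 i)%:E); last first.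
  have := lebesgue_measure_itv `[grid n.+1 i, grid n.+1 i.+1[ => /= ->.
  rewrite lte_fin ifT // -subr_gt0 grid_step divr_gt0 //.
by rewrite grid_step -EFinM lee_fin -mulrA -[_ / T]invf_div mulVf ?mulr1 // mulf_neq0 ?invr_eq0 ?gt_eqF.
Qed.

Lemma grid_cell n t : 0 <= t < T ->
  exists i : 'I_n.+1, grid n.+1 i <= t < grid n.+1 i.+1.
Proof.
move=> /andP[t0 tT]; pose y := t / T * n.+1%:R.
have y0 : 0 <= y by rewrite mulr_ge0 // divr_ge0 // ltW.
have yn : y < n.+1%:R by rewrite /y gtr_pMl // ltr_pdivrMr // mul1r.
have in_ : (Num.truncn y < n.+1)%N by rewrite truncn_lt_nat.
exists (Ordinal in_) => /=; have /andP[lo hi] := truncn_itv y0.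
rewrite /grid ![T * _]mulrC -ler_pdivlMr // ler_pdivrMr ?ltr0n // lo /=.
by rewrite -ltr_pdivrMr // ltr_pdivlMr ?ltr0n.
Qed.

Lemma step_cell n (i : 'I_n.+1) t : grid n.+1 i <= t < grid n.+1 i.+1 ->
  f n t = (q n.+1 i * (n.+1%:R / T))%:E.
Proof.
move=> /andP[it ti]; rewrite /f (bigD1 i) //= big1 ?addr0.
  by rewrite indicE mem_set ?mulr1 //= in_itv /= it.
move=> j ji; rewrite indicE memNset ?mulr0 //= in_itv /= => /andP[jt tj].
have : (j < i)%N || (i < j)%N by rewrite -neq_ltn.
case/orP => lt.
  by have := le_lt_trans (le_trans (grid_le n.+1 lt) it) tj; rewrite ltxx.
by have := le_lt_trans (le_trans (grid_le n.+1 lt) jt) ti; rewrite ltxx.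
Qed.

Lemma le_limn_einf (a b : nat -> \bar R) : (forall n, a n <= b n)%E ->
  (limn_einf a <= limn_einf b)%E.
Proof.
move=> ab; rewrite !limn_einf_lim; apply: lee_lim; try exact: is_cvg_einfs.
apply: nearW => n; apply: le_ereal_inf_tmp => _ [m /= nm <-].
by apply: le_trans (ab m); apply: ereal_inf_lbound; exists m.
Qed.

(** For fixed [beta] the quotients over the cells around [t] converge to the affine expression under
    the supremum, and each is at most [f n t]; the supremum over [beta] is taken last. *)
Lemma legendre_le_limn_einf t : 0 < t < T -> derivable phi t 1 ->
  (legendre (phi t) (derive1 phi t) <= limn_einf (f ^~ t))%E.
Proof.
move=> /andP[t0 tT] dt; apply: ge_ereal_sup => _ [beta _ <-].
have tT' : 0 <= t < T by rewrite ltW.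
pose i n := sval (cid (grid_cell n tT')).
have Hi n : grid n.+1 (i n) <= t < grid n.+1 (i n).+1 := svalP (cid (grid_cell n tT')).
pose u n := grid n.+1 (i n); pose v n := grid n.+1 (i n).+1.
have uvE n : v n - u n = T / n.+1%:R by rewrite grid_step.
have uv n : [/\ 0 <= u n, u n <= t <= v n, u n < v n & v n <= T].
  have /andP[-> /ltW ->] := Hi n; split => //; first exact: grid_ge0.
    by rewrite -subr_gt0 uvE divr_gt0.
  exact: grid_leT.
have cvg0 : (v n - u n) @[n --> \oo] --> 0.
  under eq_cvg do rewrite uvE.
  suff : T * n.+1%:R^-1 @[n --> \oo] --> T * 0 by rewrite mulr0.
  by apply: cvgM; [exact: cvg_cst|exact: cvg_harmonic].
have c1 : ((phi (v n) - phi (u n)) / (v n - u n)) @[n --> \oo] --> derive1 phi t.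
  by apply: quotient_cvg => // n; have [] := uv n.
have c2 := clock_quotient_cvg (introT andP (conj t0 tT)) uv cvg0.
pose a n := beta * ((phi (v n) - phi (u n)) / (v n - u n))
  - Lam (- beta) * (clock c phi (u n) (v n) / (v n - u n)).
have ca : a n @[n --> \oo] --> derive1 phi t * beta - c (phi t) * Lam (- beta).
  rewrite (_ : _ - _ = beta * derive1 phi t - Lam (- beta) * c (phi t)); last by ring.
  by apply: cvgB; apply: cvgM => //; exact: cvg_cst.
have cae : (a n)%:E @[n --> \oo] --> (derive1 phi t * beta - c (phi t) * Lam (- beta))%:E.
  by apply: cvg_EFin; [exact: nearW|exact: ca].
have [<- _] := cvg_limn_einf_sup cae.
apply: le_limn_einf => n; rewrite (step_cell (Hi n)) lee_fin.
have -> : a n = (beta * D n.+1 (i n) - Lam (- beta) * C n.+1 (i n)) * (n.+1%:R / T).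
  by rewrite [RHS]mulrBl /a uvE invf_div -!mulrA.
by apply: ler_wpM2r; [rewrite divr_ge0 // ltW|exact: cell_legendre_ge].
Qed.

Lemma legendre_integral_le :
  (\int[mu]_(t in `[0%R, T]) legendre (phi t) (derive1 phi t) <= s%:E)%E.
Proof.
have [g [_ _ dg]] := ac_ftc T_gt0 lipschitz_ac.
have mf n : measurable_fun `[0%R, T] (f n) by apply: measurable_funTS; exact: measurable_step.
apply: (@le_trans _ _ (\int[mu]_(t in `[0%R, T]) limn_einf (f ^~ t))%E).
  apply: ae_ge0_le_integral_upper => //.
  - rewrite /limn_einf; apply: measurableT_comp => //.
    by apply: measurable_fun_limn_esup => n; apply: measurableT_comp (mf n).
  - move=> t _; have [<- _] := @cvg_limn_einf_sup R (cst 0%E) 0%E (cvg_cst _).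
    by apply: le_limn_einf => n; exact: step_ge0.
  - by move=> t _; exact: legendre_ge0.
  have aeF := ae_filter_ringOfSetsType mu.
  move: dg (ae_neq 0) (ae_neq T); apply: filterS3 => t dt t0 tT /=.
  rewrite in_itv /= => /andP[t0' tT'].
  have tin : 0 < t < T by rewrite !lt_neqAle eq_sym t0 t0' tT tT'.
  by apply: legendre_le_limn_einf => //; have [] := dt tin.
apply: (le_trans (fatou mu _ mf _)) => //.
  by move=> n t _; exact: step_ge0.
have [<- _] := @cvg_limn_einf_sup R (cst s%:E) s%:E (cvg_cst _).
by apply: le_limn_einf => n; exact: integral_step.
Qed.

End upper.
End RateFunction.

(** * Cumulants and tilting *)

Section Cumulant.
Context d (Omega : measurableType d) (R : realType) (P : probability Omega R).
Implicit Types (Z : Omega -> R).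

Definition cumulant Z (l : R) : R := ln (fine 'E_P[fun w => expR (l * Z w)]).

Section bounded.
Variables (Z : Omega -> R) (B : R).
Hypotheses (mZ : measurable_fun setT Z) (bZ : {ae P, forall w, `|Z w| <= B}).

Let mgf (l : R) : \bar R := (\int[P]_w (expR (l * Z w))%:E)%E.

Lemma measurable_expZ l : measurable_fun setT (fun w => (expR (l * Z w))%:E).
Proof.
apply/measurable_EFinP; apply: measurableT_comp => //.
by apply: measurable_funM.
Qed.

(** Pointwise, [l' Z] exceeds [l Z] by at most [B |l' - l|]. Taking [l = 0] makes the generating
    function finite, [l' = 0] makes it positive, and logarithms make the cumulant Lipschitz. *)
Let mgf_le l l' : (mgf l' <= (expR (B * `|l' - l|))%:E * mgf l)%E.
Proof.
rewrite -ge0_integralZl_EFin //; last first.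
  exact: measurable_expZ.
apply: ae_ge0_le_integral => //.
- exact: measurable_expZ.
- apply/measurable_EFinP; apply: measurable_funM => //.
  by apply/measurable_EFinP; exact: measurable_expZ.
have aeF := ae_filter_ringOfSetsType P.
apply: filterS bZ => w bw _; rewrite -EFinM lee_fin -expRD ler_expR.
rewrite -lerBlDr -mulrBl (le_trans (ler_norm _)) // normrM mulrC.
by rewrite ler_wpM2r.
Qed.

Let mgf0 : mgf 0 = 1%E.
Proof.
rewrite /mgf; under eq_integral do rewrite mul0r expR0.
by rewrite integral_cst // mul1e; exact: probability_setT.
Qed.

Lemma cumulantE l : (\int[P]_w (expR (l * Z w))%:E = (expR (cumulant Z l))%:E)%E.
Proof.
have fin : mgf l \is a fin_num.
  rewrite ge0_fin_numE; last by apply: integral_ge0 => w _; rewrite lee_fin expR_ge0.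
  by apply: (le_lt_trans (mgf_le 0 l)); rewrite mgf0 mule1 ltry.
have pos : 0 < fine (mgf l).
  rewrite fine_gt0 // ltey_eq fin andbT lt_neqAle; apply/andP; split; last first.
    by apply: integral_ge0 => w _; rewrite lee_fin expR_ge0.
  apply/eqP => E; have := mgf_le l 0; rewrite mgf0 -E mule0.
  by rewrite lee_fin ler10.
by rewrite /cumulant unlock lnK ?posrE //= fineK.
Qed.

Lemma cumulant0 : cumulant Z 0 = 0.
Proof.
by have := cumulantE 0; rewrite -/(mgf 0) mgf0 => -[]; rewrite -{1}expR0 => /expR_inj.
Qed.

Lemma cumulant_lipschitz l l' : `|cumulant Z l' - cumulant Z l| <= B * `|l' - l|.
Proof.
have h k k' : cumulant Z k' - cumulant Z k <= B * `|k' - k|.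
  have := mgf_le k k'; rewrite /mgf !cumulantE -EFinM lee_fin -expRD ler_expR.
  by rewrite -lerBlDr.
by rewrite ler_norml h andbT lerNl opprB distrC.
Qed.

Lemma cumulant_continuous : continuous (cumulant Z).
Proof.
move=> l; apply/cvgrPdist_le => e e0.
have B1 : 0 < `|B| + 1 by rewrite ltr_wpDl.
near=> k; apply: (le_trans (cumulant_lipschitz _ _)).
apply: (@le_trans _ _ ((`|B| + 1) * `|l - k|)).
  by apply: ler_wpM2r => //; rewrite (le_trans (ler_norm _)) // lerDl.
rewrite mulrC -ler_pdivlMr //; near: k; apply: cvgr_dist_le; first exact: cvg_id.
by rewrite divr_gt0.
Unshelve. all: by end_near. Qed.

(** Invert [expR (- y) >= 1 - y] and note that [(1 - y) (1 + y + 2 y^2) = 1 + y^2 (1 - 2 y)]. *)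
Lemma expR_le_quadratic (y : R) : `|y| <= 2^-1 -> expR y <= 1 + y + 2 * y ^+ 2.
Proof.
move=> y2; have [y1 y1'] : - 2^-1 <= y /\ y <= 2^-1 by apply/andP; rewrite -ler_norml.
have py : 0 < 1 - y by lra.
have : expR y <= (1 - y)^-1.
  rewrite -[expR y]invrK lef_pV2 ?posrE ?invr_gt0 ?expR_gt0 //.
  by rewrite -expRN; exact: expR_ge1Dx.
move=> /le_trans; apply; rewrite -div1r ler_pdivrMr //; nra.
Qed.

(** This one-sided bound of second order does the work of differentiability. The slope [a] is the
    mean of [Z] under the law tilted by [expR (l * Z)]. *)
Lemma cumulant_tangent l : 0 <= B -> exists a : R, forall h : R, `|h| * B <= 2^-1 ->
  cumulant Z (l + h) - cumulant Z l <= h * a + 2 * B ^+ 2 * h ^+ 2.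
Proof.
(* Truncation turns the almost sure bound into one that holds everywhere, so that integrability and
   the sign of the majorant can be checked pointwise. *)
move=> B0; pose Y w := Num.max (- B) (Num.min B (Z w)).
have Yb w : `|Y w| <= B by rewrite ler_norml /Y le_max lexx /= ge_max ge_min lexx /= andbT; lra.
have mY : measurable_fun setT Y.
  by apply: measurable_maxr => //; exact: measurable_minr.
have YZ : {ae P, forall w, Y w = Z w}.
  have aeF := ae_filter_ringOfSetsType P.
  apply: filterS bZ => w; rewrite ler_norml => /andP[Z1 Z2].
  by rewrite /Y min_r // max_r.
pose e w := expR (l * Z w).
have me : measurable_fun setT e by apply/measurable_EFinP; exact: measurable_expZ.
have ie : P.-integrable setT (EFin \o e).
  apply/integrableP; split; first exact/measurable_EFinP.
  under eq_integral do rewrite /= ger0_norm ?expR_ge0 //.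
  by rewrite cumulantE ltry.
have iYe : P.-integrable setT (EFin \o (fun w => Y w * e w)).
  apply: (@le_integrable _ _ _ _ _ measurableT _ (fun w => B%:E * (e w)%:E)%E) => //.
  - by apply/measurable_EFinP; exact: measurable_funM.
  - move=> w _; rewrite -EFinM !abse_EFin lee_fin !normrM ler_wpM2r //.
    by rewrite [leRHS]ger0_norm.
  - exact: integrableZl.
pose m := expR (cumulant Z l).
have m0 : 0 < m by exact: expR_gt0.
have Ee : \int[P]_w e w = m by rewrite /Rintegral cumulantE.
pose a := (\int[P]_w (Y w * e w)) / m.
exists a => h hB.
set u := h * a + _.
suff : expR (cumulant Z (l + h)) <= expR (cumulant Z l) * (1 + u).
  move=> /le_trans/(_ (ler_wpM2l (ltW m0) (expR_ge1Dx u))).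
  by rewrite -expRD ler_expR lerBlDl.
pose b w := e w * (1 + 2 * B ^+ 2 * h ^+ 2) + h * (Y w * e w).
have b0 w : 0 <= b w.
  rewrite (_ : b w = e w * (1 + 2 * B ^+ 2 * h ^+ 2 + h * Y w)); last by rewrite /b; ring.
  rewrite mulr_ge0 ?expR_ge0 //.
  have : `|h * Y w| <= 2^-1 by rewrite normrM (le_trans _ hB) // ler_wpM2l.
  rewrite ler_norml; have : 0 <= 2 * B ^+ 2 * h ^+ 2 by rewrite mulr_ge0 ?sqr_ge0 // mulr_ge0 ?sqr_ge0.
  lra.
have ib1 : P.-integrable setT (EFin \o (fun w => e w * (1 + 2 * B ^+ 2 * h ^+ 2))).
  by apply: eq_integrable (integrableZr _ (1 + 2 * B ^+ 2 * h ^+ 2) ie).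
have ib2 : P.-integrable setT (EFin \o (fun w => h * (Y w * e w))).
  by apply: eq_integrable (integrableZl _ h iYe).
have ib : P.-integrable setT (EFin \o b) by apply: eq_integrable (integrableD _ ib1 ib2).
have Eb : \int[P]_w b w = m * (1 + u).
  rewrite /b RintegralD // RintegralZr // RintegralZl // Ee /u /a.
  by field; rewrite gt_eqF.
rewrite -/m -Eb -lee_fin -cumulantE /Rintegral fineK; last exact: integrable_fin_num.
apply: ae_ge0_le_integral => //.
- exact: measurable_expZ.
- by move=> w _; rewrite lee_fin.
- exact: measurable_int ib.
have aeF := ae_filter_ringOfSetsType P.
apply: filterS YZ => w YZw _; rewrite lee_fin mulrDl expRD /b -/(e w) YZw.
rewrite [h * (_ * _)]mulrA [h * Z w * _]mulrC -mulrDr ler_wpM2l ?expR_ge0 //.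
have hZ : `|h * Z w| <= 2^-1 by rewrite normrM (le_trans _ hB) // ler_wpM2l // -YZw.
apply: (le_trans (expR_le_quadratic hZ)).
have : (h * Z w) ^+ 2 <= B ^+ 2 * h ^+ 2.
  rewrite exprMn mulrC ler_wpM2r ?sqr_ge0 //.
  by rewrite -[Z w ^+ 2]real_normK ?num_real // ler_pXn2r ?nnegrE // -YZw.
lra.
Qed.


(** If [Z >= a + r] has probability [p > 0], then [E exp (l (Z - a)) >= p exp (l r)], which exceeds
    1 for large [l]. Otherwise [Z < a] almost surely, as [a] is not an atom, and dominated
    convergence sends this expectation to 0, against its lower bound [exp (- S)]. *)
Lemma cumulant_coercive (a S : R) : (forall l, 0 <= l -> l * a - cumulant Z l <= S) ->
  P [set w | Z w = a] = 0%E -> exists L : R, 0 <= L /\ forall l, L < l -> l * a - cumulant Z l < 0.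
Proof.
move=> GS Pa.
have mge (y : R) : measurable [set w | y <= Z w].
  rewrite -[X in measurable X]setTI -[X in _ `&` X](_ : Z @^-1` `[y, +oo[ = _).
    exact: mZ.
  by apply/seteqP; split => w /=; rewrite in_itv /= andbT.
have mla l : measurable_fun setT (fun w => (expR (l * (Z w - a)))%:E).
  apply/measurable_EFinP; apply: measurableT_comp => //.
  by apply: measurable_funM => //; exact: measurable_funB.
have EZa l : (\int[P]_w (expR (l * (Z w - a)))%:E)%E = (expR (- (l * a - cumulant Z l)))%:E.
  have -> : - (l * a - cumulant Z l) = cumulant Z l + - (l * a) by rewrite opprB addrC.
  transitivity (\int[P]_w ((expR (- (l * a)))%:E * (expR (l * Z w))%:E))%E.
    by apply: eq_integral => w _; rewrite -EFinM -expRD mulrBr addrC.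
  rewrite ge0_integralZl_EFin //; last exact: measurable_expZ.
  by rewrite cumulantE expRD EFinM muleC.
have [r r0 pr] : exists2 r : R, 0 < r & (0 < P [set w | (a + r <= Z w)%R])%E.
  apply: contrapT => H.
  have aeF := ae_filter_ringOfSetsType P.
  have Pn n : {ae P, forall w, Z w < a + n.+1%:R^-1}.
    exists [set w | a + n.+1%:R^-1 <= Z w]; split => //.
      apply/eqP; rewrite eq_le measure_ge0 andbT leNgt; apply/negP => Pn; apply: H.
      by exists n.+1%:R^-1 => //; rewrite invr_gt0.
    by move=> w /= /negP; rewrite -leNgt.
  have Pa' : {ae P, forall w, Z w <> a}.
    exists [set w | Z w = a]; split => //; last by move=> w /= /contrapT.
    rewrite -[X in measurable X]setTI -[X in _ `&` X](_ : Z @^-1` [set a] = _) //.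
    exact: mZ.
  have Za : {ae P, forall w, Z w < a}.
    have := ae_foralln Pn; move: Pa'; apply: filterS2 => w Zwa Hn.
    rewrite lt_neqAle; apply/andP; split; first exact/eqP.
    rewrite leNgt; apply/negP => aZ.
    have := Hn (Num.truncn (Z w - a)^-1); apply/negP; rewrite -leNgt.
    rewrite -lerBrDl -[leRHS]invrK lef_pV2 ?posrE ?invr_gt0 ?subr_gt0 //.
    by apply/ltW/truncnS_gt.
  have := @dominated_convergence _ _ _ P setT measurableT
    (fun n w => (expR (n%:R * (Z w - a)))%:E) (cst 0%E) (cst 1%E) (fun n => mla n%:R).
  case=> //.
  - apply: filterS Za => w Zwa _; apply: cvg_EFin; first exact: nearW.
    rewrite (_ : fine \o _ = GRing.exp (expR (Z w - a))); last first.
      by apply/funext => n /=; rewrite mulrC expRM_natr.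
    by apply: cvg_expr; rewrite ger0_norm ?expR_ge0 // -expR0 ltr_expR subr_lt0.
  - by apply: finite_measure_integrable_cst.
  - apply: filterS Za => w Zwa n _; rewrite abse_EFin lee_fin ger0_norm ?expR_ge0 //.
    by rewrite -expR0 ler_expR mulr_ge0_le0 // subr_le0 ltW.
  move=> _ _; rewrite integral0 => cv0.
  have : ((expR (- S))%:E <= 0 :> \bar R)%E.
    apply: (@cvge_ge _ _ _ _ _ _ _ _ cv0).
    by apply: nearW => n /=; rewrite EZa lee_fin ler_expR lerN2 GS.
  by rewrite lee_fin leNgt expR_gt0.
set A := [set w | _] in pr; set p := fine (P A).
have mA : measurable A by exact: mge.
have PA : P A = p%:E by rewrite /p fineK // fin_num_measure //; exact: mge.
have p0 : 0 < p by rewrite PA lte_fin in pr.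
exists (Num.max 0 (- ln p / r)); split; first by rewrite le_max lexx.
move=> l; rewrite gt_max ltr_pdivrMr // => /andP[l0 lr].
rewrite -oppr_gt0 -ltr_expR expR0 -lte_fin -EZa.
apply: (@lt_le_trans _ _ (expR (l * r) * p)%:E).
  by rewrite lte_fin -[p]lnK ?posrE // -expRD -expR0 ltr_expR; lra.
apply: (@le_trans _ _ (\int[P]_w ((expR (l * r) * \1_A w)%:E))%E).
  under eq_integral do rewrite EFinM.
  rewrite ge0_integralZl_EFin //; last by apply/measurable_EFinP; exact: measurable_indic.
  have -> : (\int[P]_x (\1_A x)%:E)%E = p%:E by rewrite integral_indic // setIT; exact: PA.
  by rewrite EFinM.
apply: ge0_le_integral => //.
- by apply/measurable_EFinP; apply: measurable_funM => //; exact: measurable_indic.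
move=> w _; rewrite lee_fin indicE; have [/set_mem wA|_] := boolP (w \in A).
  by rewrite mulr1 ler_expR ler_wpM2l ?(ltW l0) // lerBrDl.
by rewrite mulr0 expR_ge0.
Qed.

End bounded.

Lemma cumulantN Z l : cumulant (fun w => - Z w) l = cumulant Z (- l).
Proof. by rewrite /cumulant; congr (ln (fine 'E_P[_])); apply/funext => w; rewrite mulrN mulNr. Qed.

(** Coercivity for [Z] and for [- Z] leaves a compact interval; outside it the objective is
    negative, while it vanishes at 0, so the maximum over the interval is global. *)
Lemma cumulant_maximizer Z (B a S : R) : measurable_fun setT Z ->
  {ae P, forall w, `|Z w| <= B} -> P [set w | Z w = a] = 0%E ->
  (forall l, l * a - cumulant Z l <= S) ->
  exists l0, forall l, l * a - cumulant Z l <= l0 * a - cumulant Z l0.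
Proof.
move=> mZ bZ Pa GS.
have [L1 [L10 H1]] := cumulant_coercive mZ bZ (fun l _ => GS l) Pa.
have mNZ : measurable_fun setT (fun w => - Z w) by exact: measurableT_comp.
have bNZ : {ae P, forall w, `|- Z w| <= B}.
  by have aeF := ae_filter_ringOfSetsType P; apply: filterS bZ => w; rewrite normrN.
have PNa : P [set w | - Z w = - a] = 0%E.
  by rewrite -[RHS]Pa; congr (P _); apply/seteqP; split => w /= => [/oppr_inj|->].
have [|L2 [L20 H2]] := @cumulant_coercive _ _ mNZ bNZ (- a) S _ PNa.
  by move=> l _; rewrite cumulantN mulrN -mulNr GS.
pose G l := l * a - cumulant Z l.
have cG : continuous G.
  move=> l; apply: cvgB; last exact: (cumulant_continuous mZ bZ).
  by apply: cvgM; [exact: cvg_id|exact: cvg_cst].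
have L12 : - L2 <= L1 by lra.
have [l0 l0in Hl0] := EVT_max L12 (continuous_subspaceT cG).
exists l0 => l; have G0 : 0 <= G l0.
  have := Hl0 0; rewrite {1}/G mul0r (cumulant0 mZ bZ) subr0; apply.
  by rewrite in_itv /=; lra.
have [lL1|L1l] := leP l L1; last by apply: le_trans G0; apply/ltW/H1.
have [lL2|L2l] := leP (- L2) l; first by apply: Hl0; rewrite in_itv /= lL2.
have := H2 (- l); rewrite cumulantN opprK mulrNN ltrNr => /(_ L2l) /ltW /le_trans; exact.
Qed.

End Cumulant.

(** * Independence from the past *)

Section Independence.
Context d (Omega : measurableType d) (R : realType) (P : probability Omega R).

Lemma joint_law d1 (T1 : measurableType d1) (U : Omega -> T1) (Y : Omega -> R)
    (h : T1 * R -> \bar R) :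
  measurable_fun setT U -> measurable_fun setT Y ->
  (forall A B, measurable A -> measurable B ->
     P (U @^-1` A `&` Y @^-1` B) = (P (U @^-1` A) * P (Y @^-1` B))%E) ->
  measurable_fun setT h -> (forall z, 0 <= h z)%E ->
  (\int[P]_w h (U w, Y w) = \int[P]_w \int[P]_w' h (U w, Y w'))%E.
Proof.
move=> mU mY ind mh h0.
pose mUm : {mfun Omega >-> T1} := HB.pack U (isMeasurableFun.Build _ _ _ _ _ mU).
pose mYm : {mfun Omega >-> R} := HB.pack Y (isMeasurableFun.Build _ _ _ _ _ mY).
have mV : measurable_fun setT (fun w => (U w, Y w)) by exact: measurable_fun_pair.
pose mVm : {mfun Omega >-> (T1 * R)%type} := HB.pack (fun w => (U w, Y w)) (isMeasurableFun.Build _ _ _ _ _ mV).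
pose PU : probability T1 R := distribution P mUm.
pose PY : probability R R := distribution P mYm.
pose PV : probability (T1 * R)%type R := distribution P mVm.
have PVE X : measurable X -> (PU \x PY)%E X = PV X.
  apply: product_measure_unique => A B mA mB.
  by rewrite /PV /PU /PY /distribution /pushforward /= -ind.
transitivity (\int[PV]_z h z)%E.
  by rewrite ge0_integral_distribution.
transitivity (\int[PU \x PY]_z h z)%E.
  by apply: eq_measure_integral => X mX _; exact/esym/PVE.
rewrite fubini_tonelli1 // ge0_integral_distribution //; last 2 first.
- exact: measurable_fun_fubini_tonelli_F.
- by move=> y; apply: integral_ge0.
apply: eq_integral => w _; rewrite /fubini_F /= ge0_integral_distribution //.
by apply: measurableT_comp => //; exact: pair1_measurable.
Qed.

Variable X : nat -> Omega -> R.
Hypotheses (mX : forall n, measurable_fun setT (X n))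
  (indX : forall n (A : nat -> set R), (forall i, measurable (A i)) ->
     P (\bigcap_(i < n) (X i @^-1` A i)) = (\prod_(i < n) P (X i @^-1` A i))%E).

(** These cylinders form a pi-system; [past_type n] is the sample space with the sigma-algebra they
    generate, so that dependence on the first [n] variables becomes plain [measurable_fun]. *)
Definition past n : set (set Omega) :=
  [set E | exists2 A : nat -> set R, (forall i, measurable (A i)) &
             E = \bigcap_(i < n) (X i @^-1` A i)].

Definition past_type n : measurableType _ := g_sigma_algebraType (past n).

Lemma mX_set n (A : set R) : measurable A -> measurable (X n @^-1` A).
Proof. by move=> mA; rewrite -[X in measurable X]setTI; exact: mX. Qed.

Lemma past_measurable n E : past n E -> measurable E.
Proof. by move=> [A mA ->]; apply: bigcap_measurableType => i _; exact: mX_set. Qed.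

Lemma past_setT n : past n setT.
Proof.
exists (fun=> setT) => //.
by apply/seteqP; split => // w _ i _.
Qed.

Lemma past_sigma_measurable n E : <<s past n >> E -> measurable E.
Proof.
move=> sE; apply: (sE measurable); split; last exact: past_measurable.
exact: sigma_algebra_measurable.
Qed.

Lemma past_measurable_fun n d' (T' : measurableType d') (f : Omega -> T') :
  measurable_fun (setT : set (past_type n)) f -> measurable_fun setT f.
Proof.
move=> mf _ Y mY; apply: (@past_sigma_measurable n).
exact: (mf measurableT Y mY).
Qed.

Lemma past_X n i : (i < n)%N -> measurable_fun (setT : set (past_type n)) (X i).
Proof.
move=> ni _ Y mY; rewrite setTI; apply: sub_sigma_algebra.
exists (fun j => if j == i then Y else setT); first by move=> j; case: ifP.
apply/seteqP; split => [w wY j /= jn|w /(_ i ni)]; last by rewrite /= eqxx.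
by rewrite /preimage /=; case: eqP => [->|].
Qed.

(** As functions of [E] both sides are finite measures. They agree on cylinders, where the event of
    [X n] adds one coordinate, hence on the generated sigma-algebra. *)
Lemma past_indep n E B : <<s past n >> E -> measurable B ->
  P (E `&` X n @^-1` B) = (P E * P (X n @^-1` B))%E.
Proof.
move=> sE mB; set C := X n @^-1` B; have mC : measurable C by exact: mX_set.
have fC : P C \is a fin_num by exact: fin_num_measure.
pose m1 := mrestr P mC.
pose r : {nonneg R} := NngNum (fine_ge0 (measure_ge0 P C)).
pose m2 := mscale r P.
suff : m1 E = m2 E by rewrite /m1 /m2 /mrestr /mscale /= fineK // muleC.
apply: (@g_sigma_algebra_measure_unique _ _ _ (past n) (@past_measurable n) (fun=> setT)) => //.
- by move=> _; exact: past_setT.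
- by rewrite bigcup_const.
- move=> _ _ [A mA ->] [A' mA' ->]; exists (fun i => A i `&` A' i).
    by move=> i; exact: measurableI.
  by apply/seteqP; split => [w [a b] i ni|w ab]; [split; [exact: a|exact: b]|split => i ni; have [] := ab i ni].
- move=> _ [A mA ->].
  rewrite -[LHS]/(P (_ `&` C)) -[RHS]/((fine (P C))%:E * P _)%E fineK //.
  pose A' i := if i == n then B else A i.
  have mA' i : measurable (A' i) by rewrite /A'; case: ifP.
  have -> : \bigcap_(i < n) (X i @^-1` A i) `&` C = \bigcap_(i < n.+1) (X i @^-1` A' i).
    apply/seteqP; split => [w [a b] i|w ab].
      rewrite /= ltnS leq_eqVlt /A'; case: eqP => [-> //|_ /= ni]; exact: a.
    split => [i /= ni|]; last by have := ab n (ltnSn n); rewrite /A' eqxx.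
    by have := ab i (ltnW ni); rewrite /A' ltn_eqF.
  rewrite !indX // big_ord_recr /= muleC; congr (_ * _)%E; first by rewrite /A' eqxx.
  by apply: eq_bigr => i _; rewrite /A' ltn_eqF.
by move=> _; rewrite -[X in (X < _)%E]/(P (setT `&` C)) setTI -ge0_fin_numE.
Qed.

Lemma past_joint_law n d1 (T1 : measurableType d1) (U : Omega -> T1) (h : T1 * R -> \bar R) :
  measurable_fun (setT : set (past_type n)) U ->
  measurable_fun setT h -> (forall z, 0 <= h z)%E ->
  (\int[P]_w h (U w, X n w) = \int[P]_w \int[P]_w' h (U w, X n w'))%E.
Proof.
move=> mU mh h0; apply: joint_law => //; first exact: past_measurable_fun mU.
move=> A B mA mB; apply: past_indep => //.
by have := mU measurableT A mA; rewrite setTI.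
Qed.

(* One step of the exponential martingale: the tilt [l] may depend on the past. *)
Lemma past_tilt n (B : R) (f l : Omega -> R) :
  measurable_fun (setT : set (past_type n)) f ->
  measurable_fun (setT : set (past_type n)) l ->
  (forall w, 0 <= f w) -> {ae P, forall w, `|X n w| <= B} ->
  (\int[P]_w (f w * expR (l w * X n w))%:E =
   \int[P]_w (f w * expR (cumulant P (X n) (l w)))%:E)%E.
Proof.
move=> mf ml f0 bX.
(* The absolute value makes [h] nonnegative on the whole space, as Tonelli requires; on the values
   of [f] it changes nothing. *)
pose h (z : (R * R) * R) : \bar R := (`|z.1.1| * expR (z.1.2 * z.2))%:E.
have m11 : measurable_fun setT (fun z : (R * R) * R => z.1.1) by exact: measurableT_comp.
have m12 : measurable_fun setT (fun z : (R * R) * R => z.1.2) by exact: measurableT_comp.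
have mh : measurable_fun setT h.
  apply/measurable_EFinP; apply: measurable_funM; first exact: measurableT_comp.
  apply: measurableT_comp => //.
  by apply: measurable_funM.
have h0 z : (0 <= h z)%E by rewrite lee_fin mulr_ge0 ?expR_ge0.
have mU : measurable_fun (setT : set (past_type n)) (fun w => (f w, l w)).
  exact: measurable_fun_pair.
transitivity (\int[P]_w h ((f w, l w), X n w))%E.
  by apply: eq_integral => w _; rewrite /h /= ger0_norm.
rewrite (past_joint_law mU mh h0); apply: eq_integral => w _.
rewrite /h /= ger0_norm //; under eq_integral do rewrite EFinM.
rewrite ge0_integralZl_EFin //; last first.
  exact: measurable_expZ.
by rewrite (cumulantE (mX n) bX) EFinM.
Qed.

End Independence.

Lemma measurable_inv (R : realType) : measurable_fun setT (fun y : R => y^-1).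
Proof.
rewrite (_ : (fun y => _) = fun y : R =>
    if 0 <= y then powR y (-1) else - powR (- y) (-1)); last first.
  apply/funext => y; case: ifPn => [y0|]; first by rewrite powR_inv1.
  by rewrite -ltNge => y0; rewrite powR_inv1 ?oppr_ge0 ?ltW // invrN opprK.
apply: measurable_fun_ifT => //.
- exact: measurable_fun_ler.
have mN := @oppr_measurable R setT.
exact: (measurableT_comp mN (measurableT_comp (@measurable_powR R (-1)) mN)).
Qed.

(** * The exponential martingale of a predictable tilt *)

Section TiltExpectation.
Context d (Omega : measurableType d) (R : realType) (P : probability Omega R).
Variables (X : nat -> Omega -> R) (B : R).
Hypotheses (mX : forall n, measurable_fun setT (X n))
  (indX : forall n (A : nat -> set R), (forall i, measurable (A i)) ->
     P (\bigcap_(i < n) (X i @^-1` A i)) = (\prod_(i < n) P (X i @^-1` A i))%E)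
  (bX : forall n, {ae P, forall w, `|X n w| <= B}).

Lemma past_leq m n E : (m <= n)%N -> <<s past X m >> E -> <<s past X n >> E.
Proof.
move=> mn; apply: sub_smallest2r; first exact: smallest_sigma_algebra.
move=> {}E [A mA ->].
exists (fun i => if (i < m)%N then A i else setT); first by move=> i; case: ifP.
apply/seteqP; split => [w wA i /= _|w wA i /= im].
  by rewrite /preimage /=; case: ifPn => // im; exact: wA.
by have := wA i (leq_trans im mn); rewrite /preimage /= im.
Qed.

Lemma past_measurable_leq m n (f : Omega -> R) : (m <= n)%N ->
  measurable_fun (setT : set (past_type X m)) f ->
  measurable_fun (setT : set (past_type X n)) f.
Proof. by move=> mn mf _ Y mY; apply: (past_leq mn); exact: (mf measurableT Y mY). Qed.

Variable l : nat -> Omega -> R.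
Hypothesis ml : forall k, measurable_fun (setT : set (past_type X k.*2)) (l k).

(** The two losses of a period share the tilt but may have different laws, hence the two
    cumulants. *)
Definition log_tilt (N : nat) (w : Omega) : R := \sum_(k < N)
  (l k w * (X k.*2 w + X k.*2.+1 w)
   - (cumulant P (X k.*2) (l k w) + cumulant P (X k.*2.+1) (l k w))).

Lemma past_cumulant n m k : (k.*2 <= n)%N ->
  measurable_fun (setT : set (past_type X n)) (fun w => cumulant P (X m) (l k w)).
Proof.
move=> kn; apply: measurableT_comp; last exact: (past_measurable_leq kn (@ml k)).
by apply: continuous_measurable_fun; exact: (cumulant_continuous (mX m) (bX m)).
Qed.

Lemma past_log_tilt N : measurable_fun (setT : set (past_type X N.*2)) (log_tilt N).
Proof.
rewrite /log_tilt; apply: measurable_sum => k.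
have kN : (k.*2.+2 <= N.*2)%N by rewrite -doubleS leq_double.
apply: measurable_funB.
  apply: measurable_funM.
    by apply: (past_measurable_leq _ (@ml k)); rewrite (leq_trans _ kN) // leqW.
  by apply: measurable_funD; apply: past_X => //; exact: leq_trans kN.
by apply: measurable_funD; apply: past_cumulant; rewrite (leq_trans _ kN) // leqW.
Qed.

(* The period [N] is removed by integrating out first [X N.*2.+1], then [X N.*2]. *)
Lemma tilt_expectation N : (\int[P]_w (expR (log_tilt N w))%:E = 1)%E.
Proof.
elim: N => [|N IH].
  under eq_integral do rewrite /log_tilt big_ord0 expR0.
  by rewrite integral_cst // mul1e; exact: probability_setT.
pose L1 w := cumulant P (X N.*2) (l N w); pose L2 w := cumulant P (X N.*2.+1) (l N w).
have mW : measurable_fun (setT : set (past_type X N.*2)) (log_tilt N) by exact: past_log_tilt.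
pose f1 w := expR (log_tilt N w - L1 w).
have mf1 : measurable_fun (setT : set (past_type X N.*2)) f1.
  by apply: measurableT_comp => //; apply: measurable_funB => //; exact: past_cumulant.
pose f2 w := expR (log_tilt N w - L1 w - L2 w + l N w * X N.*2 w).
have mf2 : measurable_fun (setT : set (past_type X N.*2.+1)) f2.
  apply: measurableT_comp => //; apply: measurable_funD; last first.
    by apply: measurable_funM; [exact: (past_measurable_leq (leqnSn _) (@ml N))|exact: past_X].
  apply: measurable_funB; last by apply: past_cumulant.
  by apply: measurable_funB; [exact: (past_measurable_leq (leqnSn _) mW)|apply: past_cumulant].
transitivity (\int[P]_w (f2 w * expR (l N w * X N.*2.+1 w))%:E)%E.
  apply: eq_integral => w _; congr EFin; rewrite /f2 -expRD; congr expR.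
  rewrite /log_tilt big_ord_recr /= -/(log_tilt N w) /L1 /L2; ring.
rewrite (past_tilt mX indX mf2 (past_measurable_leq (leqnSn _) (@ml N)) (fun=> expR_ge0 _) (bX _)).
transitivity (\int[P]_w (f1 w * expR (l N w * X N.*2 w))%:E)%E.
  apply: eq_integral => w _; congr EFin; rewrite /f2 /f1 -!expRD; congr expR; rewrite /L2; ring.
rewrite (past_tilt mX indX mf1 (@ml N) (fun=> expR_ge0 _) (bX _)) -[RHS]IH.
by apply: eq_integral => w _; congr EFin; rewrite /f1 -expRD subrK.
Qed.

End TiltExpectation.

(** * Measurability of the interpolated path *)

Section TrajectoryMeasurability.
Context d (Omega : measurableType d) (R : realType).
Variables (D q0 x eps : R) (xi eta : nat -> Omega -> R).
Hypotheses (D_gt0 : 0 < D) (q0_ltD : q0 < D) (eps_gt0 : 0 < eps).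
Let L n w := loss (xi ^~ w) (eta ^~ w) n.
Let e n w := energy x eps (xi ^~ w) (eta ^~ w) n.
Let s n w := collision D q0 x eps (xi ^~ w) (eta ^~ w) n.
Let cb t w := collisions_before D q0 x eps (xi ^~ w) (eta ^~ w) t.
Let Hhat w t := interpolated_path D q0 x eps (xi ^~ w) (eta ^~ w) t.

Lemma measurable_energy n : (forall j, (j < n)%N -> measurable_fun setT (L j)) ->
  measurable_fun setT (e n).
Proof.
move=> mL; apply: measurable_funB => //; apply: measurable_funM => //.
by apply: measurable_sum => j; exact: mL.
Qed.

(** The time of collision [n] is determined by the energies before it, that is by the losses of
    index below [n.-1]. This off-by-one makes the tilt of a pair of losses a function of the earlier
    ones: the lemma will also be applied to the sample space with a past sigma-algebra. *)
Lemma measurable_collision n : (forall j, (j < n.-1)%N -> measurable_fun setT (L j)) ->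
  measurable_fun setT (s n).
Proof.
elim: n => [_|n IH mL]; first exact: measurable_cst.
have me : measurable_fun setT (e n) by exact: measurable_energy.
apply: emeasurable_funD.
  by apply: IH => j jn; apply: mL; apply: leq_trans jn _; exact: leq_pred.
apply: measurable_fun_ifT => //; first exact: measurable_fun_ltr.
apply/measurable_EFinP; apply: measurable_funM => //.
apply: (measurableT_comp (@measurable_inv R)); apply: measurable_funM => //.
apply: (measurableT_comp (continuous_measurable_fun (@sqrt_continuous R))).
by apply: measurable_funM.
Qed.

Hypothesis mL : forall j, measurable_fun setT (L j).

Lemma measurable_between n t : measurable [set w | (s n w <= t%:E < s n.+1 w)%E].
Proof.
have ms m : measurable_fun setT (s m) by apply: measurable_collision.
have := measurableI _ _ (emeasurable_fun_infty_c measurableT (ms n) t%:E)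
  (emeasurable_fun_o_infty measurableT (ms n.+1) t%:E).
rewrite !setTI; congr measurable.
by apply/seteqP; split => w /=; [move=> [-> ->]|move=> /andP[]].
Qed.

Lemma measurable_interpolated t : measurable_fun setT (Hhat ^~ t).
Proof.
pose piece n w := e n.-1 w + (t - fine (s n w)) / (fine (s n.+1 w) - fine (s n w)) * (e n w - e n.-1 w).
have mp n : measurable_fun setT (piece n).
  have me m : measurable_fun setT (e m) by exact: measurable_energy.
  have ms m : measurable_fun setT (fine \o s m).
    by apply: measurableT_comp => //; apply: measurable_collision.
  apply: measurable_funD => //; apply: measurable_funM; last exact: measurable_funB.
  apply: measurable_funM; first by apply: measurable_funB => //; exact: ms.
  by apply: (measurableT_comp (@measurable_inv R)); apply: measurable_funB; exact: ms.
pose E n := [set w | (s n w <= t%:E < s n.+1 w)%E].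
have mE n : measurable (E n) by exact: measurable_between.
have mpY n Y : measurable Y -> measurable (piece n @^-1` Y).
  by move=> mY; rewrite -[X in measurable X]setTI; exact: mp.
move=> _ Y mY; rewrite setTI.
(* Where no [n] brackets [t], [collisions_before] takes its default 0, and the path follows
   [piece 0]. *)
rewrite (_ : _ @^-1` Y = (\bigcup_n (E n `&` piece n @^-1` Y)) `|`
    ((~` \bigcup_n E n) `&` piece 0%N @^-1` Y)).
  apply: measurableU; first by apply: bigcup_measurable => n _; apply: measurableI => //; exact: mpY.
  by apply: measurableI; [apply: measurableC; exact: bigcup_measurable|exact: mpY].
have HE w : Hhat w t = piece (cb t w) w by [].
have cbE n w : E n w -> cb t w = n by move=> En; apply: collisions_beforeE.
have cb0 w : (~` \bigcup_n E n) w -> cb t w = 0%N.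
  by move=> nE; apply: xgetPN => n En; apply: nE; exists n.
apply/seteqP; split => w.
  move=> HY; have [[n _ En]|nE] := pselect ((\bigcup_n E n) w).
    by left; exists n => //; split => //; move: HY; rewrite /preimage /= HE (cbE n).
  by right; split => //; move: HY; rewrite /preimage /= HE cb0.
case=> [[n _ [En]]|[nE]]; rewrite /preimage /= HE; first by rewrite (cbE n).
by rewrite cb0.
Qed.

(** This holds for every sample, also when all collision times stay below [t]: from then on the
    index has its default 0 and the path is constant. Continuity on [[0, T]] will come only under
    the almost sure energy bounds. *)
Lemma interpolated_right_continuous w t : 0 <= t -> Hhat w u @[u --> t^'+] --> Hhat w t.
Proof.
move=> t0; have [[n nt]|H] := pselect (exists n, (s n w <= t%:E < s n.+1 w)%E).
  have nE := collisions_beforeE D_gt0 q0_ltD eps_gt0 nt.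
  pose piece u := e n.-1 w + (u - fine (s n w)) / (fine (s n.+1 w) - fine (s n w)) * (e n w - e n.-1 w).
  rewrite {2}/Hhat /interpolated_path nE -/(piece t).
  have : piece u @[u --> t^'+] --> piece t.
    apply: cvg_at_right_filter; apply: cvgD; first exact: cvg_cst.
    apply: cvgM; last exact: cvg_cst.
    apply: cvgM; last exact: cvg_cst.
    by apply: cvgB; [exact: cvg_id|exact: cvg_cst].
  have nt2 : \forall u \near t^'+, (u%:E < s n.+1 w)%E.
    case/andP: nt => _; rewrite -/(s n.+1 w); case: (s n.+1 w) => [r| |] // tr.
      by near=> u; rewrite lte_fin; near: u; apply: nbhs_right_lt; move: tr; rewrite lte_fin.
    by near=> u; rewrite ltry.
  apply: cvg_trans; apply: near_eq_cvg; near=> u.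
  rewrite /Hhat /interpolated_path (collisions_beforeE (n := n) D_gt0 q0_ltD eps_gt0) //.
  apply/andP; split; last by near: u.
  have /andP[nt1 _] := nt; apply: (le_trans nt1); rewrite lee_fin; apply: ltW.
  by near: u; exact: nbhs_right_gt.
have le_t n : (s n w <= t%:E)%E.
  elim: n => [|n IH]; first by rewrite /s /= lee_fin.
  by rewrite leNgt; apply/negP => lt; apply: H; exists n; rewrite IH.
have Hx u : t <= u -> Hhat w u = e 0%N w.
  move=> tu; rewrite /Hhat /interpolated_path.
  have -> : collisions_before D q0 x eps (xi^~ w) (eta^~ w) u = 0%N.
    apply: xgetPN => n /= /andP[_]; apply/negP; rewrite -leNgt.
    by apply: (le_trans (le_t n.+1)); rewrite lee_fin.
  by rewrite /= subrr mulr0 addr0.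
rewrite [X in _ --> X]Hx //.
have : cst (e 0%N w) u @[u --> t^'+] --> e 0%N w by exact: cvg_cst.
apply: cvg_trans; apply: near_eq_cvg; near=> u; rewrite Hx; first by [].
by apply: ltW; near: u; exact: nbhs_right_gt.
Unshelve. all: by end_near. Qed.

End TrajectoryMeasurability.

(** * Measurability of the events of the two bounds *)

Section EventMeasurability.
Context d (Omega : measurableType d) (R : realType).
Variables (T : R) (H : Omega -> R -> R).
Hypotheses (T_gt0 : 0 < T) (mH : forall t, measurable_fun setT (H ^~ t))
  (rH : forall w t, 0 <= t -> H w u @[u --> t^'+] --> H w t).

Lemma rho_le (f g : R -> R) (a : R) :
  (rho T f g <= a%:E)%E <-> (forall t, 0 <= t <= T -> `|f t - g t| <= a).
Proof.
split=> [fg t tT|fg].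
  rewrite -lee_fin; apply: le_trans fg; apply: ereal_sup_ubound.
  by exists t => //=; rewrite in_itv.
by apply: ge_ereal_sup => _ [t + <-]; rewrite /= in_itv /= => tT; rewrite lee_fin fg.
Qed.

Lemma rho_ge0 (f g : R -> R) : (0 <= rho T f g)%E.
Proof.
apply: (@le_trans _ _ (`|f 0 - g 0|)%:E); first by rewrite lee_fin.
by apply: ereal_sup_ubound; exists 0 => //=; rewrite in_itv /= lexx ltW.
Qed.

Lemma rho_triangle (f g h : R -> R) : (rho T f h <= rho T f g + rho T g h)%E.
Proof.
apply: ge_ereal_sup => _ [t tT <-].
apply: (@le_trans _ _ ((`|f t - g t|)%:E + (`|g t - h t|)%:E)%E).
  by rewrite -EFinD lee_fin (le_trans _ (ler_normD _ _)) // addrA subrK.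
by apply: leeD; apply: ereal_sup_ubound; exists t.
Qed.

Lemma rhoC (f g : R -> R) : rho T f g = rho T g f.
Proof. by congr ereal_sup; apply/seteqP; split => _ [t tT <-]; exists t => //; rewrite distrC. Qed.

Lemma measurable_rho_le (phi : R -> R) (a : R) : {within `[0, T], continuous phi} ->
  measurable [set w | (rho T (H w) phi <= a%:E)%E].
Proof.
move=> /(continuous_within_itvP _ T_gt0)[phic phi0 phiT].
(* Clamping the rationals to [[0, T]] puts [T] itself among the test times; right-continuity could
   not reach it from inside the interval. *)
pose tau (q : rat) : R := Num.max 0 (Num.min T (ratr q)).
have tauT q : 0 <= tau q <= T by rewrite le_max lexx ge_max (ltW T_gt0) ge_min lexx.
rewrite (_ : [set w | _] = \bigcap_(q : rat) [set w | `|H w (tau q) - phi (tau q)| <= a]).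
  rewrite -[X in measurable X]setCK setC_bigcap; apply: measurableC.
  apply: bigcupT_measurable_rat => q; apply: measurableC.
  have mG : measurable_fun setT (fun w => `|H w (tau q) - phi (tau q)|).
    by apply: measurableT_comp => //; apply: measurable_funB.
  rewrite -[X in measurable X]setTI -[X in _ `&` X](_ : (fun w => `|H w (tau q) - phi (tau q)|) @^-1` `]-oo, a] = _).
    exact: mG.
  by apply/seteqP; split => w /=; rewrite in_itv.
apply/seteqP; split => w /=; first by move=> /rho_le Hw q _; exact: Hw.
move=> Hw; apply/rho_le => t /andP[t0]; rewrite le_eqVlt => /predU1P[->|tT].
  have [q _ /andP[qT _]] : exists2 q : rat, True & (T <= ratr q) && (ratr q <= T + 1 :> R).
    have : T < T + 1 by rewrite ltrDl.
    by move=> /rat_in_itvoo[q]; rewrite in_itv /= => /andP[Tq qT]; exists q; rewrite // !ltW.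
  have := Hw q I; rewrite /= /tau min_l // max_r //; exact: ltW.
rewrite leNgt; apply/negP => alt.
have phir : phi u @[u --> t^'+] --> phi t.
  move: t0; rewrite le_eqVlt => /predU1P[<- //|t0].
  by apply: cvg_at_right_filter; apply: phic; rewrite in_itv /= t0.
have : `|H w u - phi u| @[u --> t^'+] --> `|H w t - phi t|.
  by apply: cvg_norm; apply: cvgB => //; exact: rH.
move=> /cvgrPdist_lt/(_ (`|H w t - phi t| - a)); rewrite subr_gt0 => /(_ alt).
rewrite near_withinE => -[r /= r0 Hr].
have : t < Num.min T (t + r) by rewrite lt_min tT ltrDl.
move=> /rat_in_itvoo[q]; rewrite in_itv /= lt_min => /andP[tq /andP[qT qr]].
have := Hw q I; rewrite /= /tau min_r ?(ltW qT) // max_r; last by rewrite ltW // (le_lt_trans t0).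
have := Hr (ratr q); rewrite /ball /= ltr0_norm ?subr_lt0 // opprB ltrBlDl => /(_ qr tq).
by rewrite ltr_norml => /andP[_]; lra.
Qed.

Lemma measurable_rho_lt (phi : R -> R) (a : R) : {within `[0, T], continuous phi} ->
  measurable [set w | (rho T (H w) phi < a%:E)%E].
Proof.
move=> cphi.
rewrite (_ : [set w | _] = \bigcup_n [set w | (rho T (H w) phi <= (a - n.+1%:R^-1)%:E)%E]).
  by apply: bigcup_measurable => n _; exact: measurable_rho_le.
apply/seteqP; split => w /=.
  have := rho_ge0 (H w) phi; case E : (rho T (H w) phi) => [r| |] //; rewrite lte_fin => _ ra.
  have ar0 : 0 < a - r by rewrite subr_gt0.
  exists (Num.truncn (a - r)^-1) => //; rewrite /= E lee_fin lerBrDr -lerBrDl.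
  by rewrite -[leRHS]invrK lef_pV2 ?posrE ?invr_gt0 //; exact/ltW/truncnS_gt.
by move=> [n _ /= /le_lt_trans]; apply; rewrite lte_fin gtrBl invr_gt0.
Qed.

(** A countable dense part of [A] turns the infimum into a countable intersection. *)
Lemma measurable_rho_set (A : set (R -> R)) (b : nat -> R -> R) (delta : R) :
  (forall k, A (b k)) -> (forall k, {within `[0, T], continuous (b k)}) ->
  (forall psi e, A psi -> 0 < e -> exists k, (rho T (b k) psi < e%:E)%E) ->
  measurable [set w | (delta%:E <= rho_set T (H w) A)%E].
Proof.
move=> Ab cb dense.
rewrite (_ : [set w | _] = \bigcap_k ~` [set w | (rho T (H w) (b k) < delta%:E)%E]).
  by apply: bigcap_measurableType => // k _; apply: measurableC; exact: measurable_rho_lt.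
apply/seteqP; split => w /= Hw.
  move=> k _ /=; apply/negP; rewrite -leNgt; apply: (le_trans Hw).
  by apply: ereal_inf_lbound; exists (b k).
apply: le_ereal_inf_tmp => _ [psi Apsi <-]; apply/lee_addgt0Pr => e e0.
have [k bk] := dense psi e Apsi e0.
have := Hw k I => /= /negP; rewrite -leNgt => /le_trans; apply.
apply: (le_trans (rho_triangle _ psi _)); apply: leeD => //.
by rewrite rhoC ltW.
Qed.

End EventMeasurability.

(** * Collisions along a trajectory *)

Section ClockRate.
Context {R : realType}.
Implicit Types D h a b : R.

(** [eps] times the number of periods, of length [2 D] each, covered per unit time at energy [h]. *)
Definition clock_rate D h : R := Num.sqrt (2 * h) / (2 * D).

Lemma clock_rate_continuous D : continuous (clock_rate D).
Proof.
move=> h; apply: cvgM; last exact: cvg_cst.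
apply: (@continuous_comp _ _ _ (fun h : R => 2 * h) Num.sqrt); last exact: sqrt_continuous.
by apply: cvgM; [exact: cvg_cst|exact: cvg_id].
Qed.

Lemma clock_rate_lipschitz D h a b : 0 < D -> 0 < h -> h <= a -> h <= b ->
  `|clock_rate D a - clock_rate D b| <= (2 * D * Num.sqrt (2 * h))^-1 * `|a - b|.
Proof.
move=> D0 h0 ha hb; rewrite /clock_rate -mulrBl normrM [`|_^-1|]ger0_norm; last by rewrite invr_ge0 mulr_ge0 // ltW.
have -> : (2 * D * Num.sqrt (2 * h))^-1 * `|a - b| = `|a - b| / Num.sqrt (2 * h) / (2 * D).
  by rewrite [in LHS]invfM; ring.
rewrite ler_pM2r ?invr_gt0 ?mulr_gt0 //.
have s0 : 0 < Num.sqrt (2 * h) by rewrite sqrtr_gt0 mulr_gt0.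
rewrite ler_pdivlMr //.
have sa : Num.sqrt (2 * h) <= Num.sqrt (2 * a) by rewrite ler_wsqrtr // ler_pM2l.
have sb : Num.sqrt (2 * h) <= Num.sqrt (2 * b) by rewrite ler_wsqrtr // ler_pM2l.
have a0 : 0 <= 2 * a by rewrite mulr_ge0 // (le_trans (ltW h0)).
have b0 : 0 <= 2 * b by rewrite mulr_ge0 // (le_trans (ltW h0)).
have := sqr_sqrtr a0; have := sqr_sqrtr b0.
set u := Num.sqrt (2 * a) in sa *; set v := Num.sqrt (2 * b) in sb *; move=> v2 u2.
have -> : a - b = 2^-1 * ((u - v) * (u + v)) by lra.
rewrite !normrM (ger0_norm (_ : 0 <= 2^-1 :> R)) //.
rewrite (@ger0_norm _ (u + v)); last lra.
rewrite mulrCA ler_wpM2l //; lra.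
Qed.

End ClockRate.

(* The tilting parameter of the pair of losses [2k], [2k+1]: it depends on the
   earlier losses only, as those determine collision [2k+1]. *)
Definition control {R : realType} (T D q0 x eps : R) (xi eta : nat -> R)
    (G : nat) (l : nat -> R) (k : nat) : R :=
  \sum_(i < G) l i * ((grid T G i)%:E < collision D q0 x eps xi eta k.*2.+1
                         <= (grid T G i.+1)%:E)%E%:R.

Section GoodTrajectory.
Context {R : realType}.
Variables (T D q0 x eps M H0 H1 : R) (xi eta : nat -> R).
Hypotheses (T_gt0 : 0 < T) (D_gt0 : 0 < D) (q0_bnd : 0 <= q0 < D) (eps_gt0 : 0 < eps)
  (H0_gt0 : 0 < H0) (lossM : forall n, `|loss xi eta n| <= M)
  (Ebnd : forall t, 0 <= t <= T -> H0 <= energy_path D q0 x eps xi eta t <= H1).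
Let e n := energy x eps xi eta n.
Let s n := collision D q0 x eps xi eta n.
Let tau n := fine (s n).
Let cb t := collisions_before D q0 x eps xi eta t.
Let Hhat t := interpolated_path D q0 x eps xi eta t.
Let q0_ltD : q0 < D. Proof. by case/andP: q0_bnd. Qed.
Let q0_ge0 : 0 <= q0. Proof. by case/andP: q0_bnd. Qed.

Lemma lossM_ge0 : 0 <= M.
Proof. by apply: le_trans (lossM 0); exact: normr_ge0. Qed.

Lemma collision_fin n : (s n <= T%:E)%E -> s n = (tau n)%:E.
Proof.
have := collision_ge0 x xi eta D_gt0 q0_ltD eps_gt0 n; rewrite -/(s n) /tau.
by case: (s n).
Qed.

Lemma collision_time_ge0 n : 0 <= tau n.
Proof.
have := collision_ge0 x xi eta D_gt0 q0_ltD eps_gt0 n; rewrite -/(s n) /tau.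
by case: (s n).
Qed.

Lemma energy_bnd n : (s n <= T%:E)%E -> H0 <= e n <= H1.
Proof.
move=> sn; have sE := collision_fin sn.
have -> : e n = energy_path D q0 x eps xi eta (tau n).
  by rewrite /energy_path (collisions_before_at D_gt0 q0_ltD eps_gt0 sE).
by apply: Ebnd; rewrite collision_time_ge0 -lee_fin -sE.
Qed.

Lemma energy_gt0 n : (s n <= T%:E)%E -> 0 < e n.
Proof. by move=> /energy_bnd/andP[/(lt_le_trans H0_gt0)]. Qed.

Lemma H1_gt0 : 0 < H1.
Proof.
have /energy_bnd/andP[H H'] : (s 0 <= T%:E)%E by rewrite lee_fin ltW.
by rewrite (lt_le_trans H0_gt0) // (le_trans H).
Qed.

Lemma collision_next n : (s n <= T%:E)%E ->
  s n.+1 = (tau n + (wall D q0 n.+1 - wall D q0 n) / speed eps (e n))%:E.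
Proof.
move=> sn; have sE := collision_fin sn.
have -> : s n.+1 = (s n + if (0 < e n)%R
    then ((wall D q0 n.+1 - wall D q0 n) / speed eps (e n))%:E else +oo)%E by [].
by rewrite (energy_gt0 sn) sE EFinD.
Qed.

Lemma collision_stepE n : (s n <= T%:E)%E ->
  speed eps (e n) * (tau n.+1 - tau n) = wall D q0 n.+1 - wall D q0 n.
Proof.
move=> sn; rewrite [tau n.+1]/tau collision_next //= addrAC subrr add0r.
by rewrite mulrC divfK // gt_eqF // speed_gt0 // energy_gt0.
Qed.

Lemma collision_step_gt0 n : (s n <= T%:E)%E -> 0 < tau n.+1 - tau n.
Proof.
move=> sn; have := collision_stepE sn.
have w0 : 0 < wall D q0 n.+1 - wall D q0 n by rewrite subr_gt0 wall_lt.
by move=> E; rewrite -(pmulr_rgt0 _ (speed_gt0 eps_gt0 (energy_gt0 sn))) E.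
Qed.

(** The time of a full flight at the largest energy [H1]. The first flight starts at [q0] and can be
    shorter, whence the shift by one in the bounds below. *)
Let gap : R := eps * D / Num.sqrt (2 * H1).

Let gap_gt0 : 0 < gap.
Proof. by rewrite divr_gt0 ?sqrtr_gt0 ?mulr_gt0 // H1_gt0. Qed.

Lemma collision_step_ge n : (s n.+1 <= T%:E)%E -> gap <= tau n.+2 - tau n.+1.
Proof.
move=> sn; rewrite -(ler_pM2l (speed_gt0 eps_gt0 (energy_gt0 sn))) collision_stepE //.
have s1 : 0 < Num.sqrt (2 * H1) by rewrite sqrtr_gt0 mulr_gt0 // H1_gt0.
rewrite /wall -mulrBl -natr1 addrAC subrr add0r mul1r /speed /gap.
have -> : eps^-1 * Num.sqrt (2 * e n.+1) * (eps * D / Num.sqrt (2 * H1)) =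
    D * (Num.sqrt (2 * e n.+1) / Num.sqrt (2 * H1)) by field; rewrite !gt_eqF.
rewrite ger_pMr // ler_pdivrMr // mul1r ler_wsqrtr // ler_pM2l //.
by case/andP: (energy_bnd sn).
Qed.

Lemma collision_lowerb n : (s n <= T%:E)%E -> (n%:R - 1) * gap <= tau n.
Proof.
elim: n => [|n IH] sn1.
  by apply: le_trans (collision_time_ge0 _); rewrite sub0r mulN1r oppr_le0 ltW.
have sn : (s n <= T%:E)%E by apply: le_trans sn1; apply: collision_le.
case: n => [|n] in IH sn1 sn *.
  by rewrite subrr mul0r collision_time_ge0.
have := IH sn; have := collision_step_ge sn; rewrite -[n.+2%:R]natr1; lra.
Qed.

Lemma collision_gtT n : T < (n%:R - 1) * gap -> (T%:E < s n)%E.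
Proof.
move=> Tn; rewrite ltNge; apply/negP => sn.
have := collision_lowerb sn; rewrite leNgt => /negP; apply.
by apply: le_lt_trans Tn; rewrite -lee_fin -collision_fin.
Qed.

Lemma collisions_before_spec t : 0 <= t <= T -> (s (cb t) <= t%:E < s (cb t).+1)%E.
Proof.
move=> /andP[t0 tT].
have ex : exists n, (t%:E < s n)%E.
  exists (Num.truncn (T / gap)).+2.
  apply: (@le_lt_trans _ _ T%:E); first by rewrite lee_fin.
  apply: collision_gtT; rewrite -natr1 addrK -ltr_pdivrMr //; exact: truncnS_gt.
case: (ex_minnP ex) => -[|n] tn mn; first by move: tn; rewrite lte_fin ltNge t0.
have nt : (s n <= t%:E)%E by rewrite leNgt; apply/negP => /mn; rewrite ltnn.
have Hn : (s n <= t%:E < s n.+1)%E by rewrite nt.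
by rewrite /cb (collisions_beforeE D_gt0 q0_ltD eps_gt0 Hn).
Qed.

Lemma interpolated_cell n t : 0 <= t <= T -> (s n <= t%:E <= s n.+1)%E ->
  Hhat t = e n.-1 + (t - tau n) / (tau n.+1 - tau n) * (e n - e n.-1).
Proof.
move=> /andP[t0 tT] /andP[nt tn].
have snT : (s n <= T%:E)%E by apply: le_trans nt _; rewrite lee_fin.
move: tn; rewrite le_eqVlt => /predU1P[tE|tn]; last first.
  rewrite /Hhat /interpolated_path (collisions_beforeE (n := n) D_gt0 q0_ltD eps_gt0) //.
  by rewrite -/(s n) -/(s n.+1) nt.
(* At the right end the index has already jumped to [n.+1], but both lines take the value [e n]
   there. *)
have [_ _] := path_collision D_gt0 q0_ltD eps_gt0 (esym tE).
rewrite -/(Hhat t) => ->; rewrite /tau -tE /= -/(e n).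
have := collision_step_gt0 snT; rewrite /tau -tE /= => d0.
by rewrite divff ?gt_eqF // mul1r addrC subrK.
Qed.

Lemma energy_diff n : `|e n.+1 - e n| <= eps * M.
Proof.
have -> : e n.+1 - e n = - (eps * loss xi eta n).
  by rewrite /e /energy big_ord_recr /= mulrDr; ring.
rewrite normrN; by rewrite normrM gtr0_norm // ler_pM2l.
Qed.

Lemma energy_diff_pred n : `|e n - e n.-1| <= eps * M.
Proof.
case: n => [|n] /=; last exact: energy_diff.
by rewrite subrr normr0 mulr_ge0 ?lossM_ge0 // ltW.
Qed.

Lemma cell_ratio n t : 0 <= t <= T -> (s n <= t%:E <= s n.+1)%E ->
  [/\ (s n <= T%:E)%E, tau n <= t, t <= tau n.+1 &
    0 <= (t - tau n) / (tau n.+1 - tau n) <= 1].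
Proof.
move=> /andP[t0 tT] /andP[nt tn].
have snT : (s n <= T%:E)%E by apply: le_trans nt _; rewrite lee_fin.
have d0 := collision_step_gt0 snT.
have h1 : tau n <= t by rewrite -lee_fin -collision_fin.
have h2 : t <= tau n.+1.
  by rewrite -lee_fin; apply: (le_trans tn); rewrite /tau collision_next.
split => //; apply/andP; split; first by apply: divr_ge0; [rewrite subr_ge0|exact: ltW].
by rewrite ler_pdivrMr // mul1r lerD2r.
Qed.

Lemma interpolated_near n t : 0 <= t <= T -> (s n <= t%:E <= s n.+1)%E ->
  `|Hhat t - e n| <= eps * M.
Proof.
move=> tT nt; have [snT _ _ /andP[r0 r1]] := cell_ratio tT nt.
rewrite (interpolated_cell tT nt); set r := _ / _ in r0 r1 *.
have -> : e n.-1 + r * (e n - e n.-1) - e n = (r - 1) * (e n - e n.-1) by ring.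
rewrite normrM (le_trans _ (energy_diff_pred n)) // ler_piMl //.
by rewrite distrC ger0_norm ?subr_ge0 // gerBl.
Qed.

Lemma interpolated_bnd t : 0 <= t <= T -> H0 <= Hhat t <= H1.
Proof.
move=> tT; have /andP[nt tn] := collisions_before_spec tT.
move: (cb t) nt tn => n nt tn.
have cell : (s n <= t%:E <= s n.+1)%E by rewrite nt ltW.
have [snT _ _ /andP[r0 r1]] := cell_ratio tT cell.
rewrite (interpolated_cell tT cell); set r := _ / _ in r0 r1 *.
have /andP[a1 a2] := energy_bnd snT.
have /andP[b1 b2] : H0 <= e n.-1 <= H1.
  apply: energy_bnd; apply: le_trans snT; apply: collision_le => //; exact: leq_pred.
by apply/andP; split; nra.
Qed.

(** The largest loss [eps M] of one collision divided by the shortest full flight [gap]; [eps]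
    cancels. *)
Definition path_slope : R := M * Num.sqrt (2 * H1) / D.

Lemma interpolated_lipschitz u v : 0 <= u -> u <= v -> v <= T ->
  `|Hhat v - Hhat u| <= path_slope * (v - u).
Proof.
have s1 : 0 < Num.sqrt (2 * H1) by rewrite sqrtr_gt0 mulr_gt0 // H1_gt0.
have K0 : 0 <= path_slope by rewrite /path_slope divr_ge0 ?mulr_ge0 ?lossM_ge0 // ltW.
have cell n a b : 0 <= a -> a <= b -> b <= T -> (s n <= a%:E)%E -> (b%:E <= s n.+1)%E ->
    `|Hhat b - Hhat a| <= path_slope * (b - a).
  move=> a0 ab bT sa bs.
  have aT : 0 <= a <= T by rewrite a0 (le_trans ab).
  have bT' : 0 <= b <= T by rewrite bT (le_trans a0).
  have ca : (s n <= a%:E <= s n.+1)%E by rewrite sa (le_trans _ bs) // lee_fin.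
  have cb' : (s n <= b%:E <= s n.+1)%E by rewrite bs andbT (le_trans sa) // lee_fin.
  have [snT _ _ _] := cell_ratio aT ca.
  rewrite (interpolated_cell aT ca) (interpolated_cell bT' cb').
  have d0 := collision_step_gt0 snT.
  have -> : e n.-1 + (b - tau n) / (tau n.+1 - tau n) * (e n - e n.-1) -
    (e n.-1 + (a - tau n) / (tau n.+1 - tau n) * (e n - e n.-1)) =
    (e n - e n.-1) / (tau n.+1 - tau n) * (b - a) by ring.
  rewrite normrM (@ger0_norm _ (b - a)) ?subr_ge0 // ler_wpM2r ?subr_ge0 //.
  rewrite normrM normfV (@gtr0_norm _ (tau n.+1 - tau n)) // ler_pdivrMr //.
  (* On the first flight, which [gap] does not bound, the interpolation is constant. *)
  case: n => [|n] in sa bs ca cb' snT d0 *.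
    by rewrite /= subrr normr0 mulr_ge0 // ltW.
  apply: (le_trans (energy_diff n)).
  have Kg : path_slope * gap = eps * M by rewrite /path_slope /gap; field; rewrite !gt_eqF.
  by rewrite -Kg ler_wpM2l // collision_step_ge.
suff claim n : forall w, 0 <= w -> w <= T -> (w%:E <= s n.+1)%E -> forall a, 0 <= a -> a <= w ->
    `|Hhat w - Hhat a| <= path_slope * (w - a).
  move=> u0 uv vT; have v0 := le_trans u0 uv.
  have /andP[_ /ltW vs] : (s (cb v) <= v%:E < s (cb v).+1)%E by apply: collisions_before_spec; rewrite v0.
  exact: (claim (cb v)).
elim: n => [|n IH] w w0 wT ws a a0 aw.
  by apply: (cell 0%N) => //; rewrite lee_fin.
have [ws'|sw] := leP w%:E (s n.+1); first exact: IH.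
have sT : (s n.+1 <= T%:E)%E by rewrite ltW // (lt_le_trans sw) // lee_fin.
have [as'|sa] := leP (s n.+1) a%:E; first exact: (cell n.+1).
have sE := collision_fin sT.
have t0 := collision_time_ge0 n.+1.
have tT : tau n.+1 <= T by rewrite -lee_fin -sE.
have at' : a <= tau n.+1 by rewrite -lee_fin -sE ltW.
have tw : tau n.+1 <= w by rewrite -lee_fin -sE ltW.
have h1 : `|Hhat (tau n.+1) - Hhat a| <= path_slope * (tau n.+1 - a).
  by apply: IH => //; rewrite -sE.
have h2 : `|Hhat w - Hhat (tau n.+1)| <= path_slope * (w - tau n.+1).
  by apply: (cell n.+1) => //; rewrite -sE.
have -> : Hhat w - Hhat a = (Hhat w - Hhat (tau n.+1)) + (Hhat (tau n.+1) - Hhat a) by ring.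
apply: (le_trans (ler_normD _ _)); lra.
Qed.

Notation c := (clock_rate D).

Lemma interpolated_continuous : {within `[0, T], continuous Hhat}.
Proof. exact: (lipschitz_continuous T_gt0 interpolated_lipschitz). Qed.

(** In units of [eps]: the first summand comes from replacing the energy by its interpolation, the
    last from rounding the distance to a whole number of flights. *)
Definition clock_slack : R := (2 * D * Num.sqrt (2 * H0))^-1 * M * T + 1.

(* [eps * (Q_t - q0) / (2 * D)] has derivative [c (H_t)], and [H_t] is within
   [eps * M] of [Hhat t]. *)
Lemma clock_interpolated z : 0 <= z <= T ->
  `|clock c Hhat 0 z - eps * ((cb z)%:R / 2)| <= eps * clock_slack.
Proof.
have cc : continuous c by exact: clock_rate_continuous.
have cH := interpolated_continuous.
pose k := (2 * D * Num.sqrt (2 * H0))^-1 * (eps * M).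
have k0 : 0 <= k.
  by rewrite /k !mulr_ge0 ?lossM_ge0 ?invr_ge0 ?mulr_ge0 ?sqrtr_ge0 // ltW.
have clock00 : clock c Hhat 0 0 = 0.
  have T0 := ltW T_gt0.
  have := clock_split cc cH (lexx 0) (lexx 0) (lexx 0) T0.
  by set y := clock _ _ _ _; lra.
(* The distance travelled, by the formula of flight [n]. Consecutive formulas agree at the collision
   between them, so the estimate passes from flight to flight. *)
pose Q n t := wall D q0 n + speed eps (e n) * (t - tau n) - q0.
  have cell n u t : 0 <= u -> u <= t -> t <= T -> (s n <= u%:E)%E -> (t%:E <= s n.+1)%E ->
      `|clock c Hhat 0 u - eps * (Q n u / (2 * D))| <= k * u ->
      `|clock c Hhat 0 t - eps * (Q n t / (2 * D))| <= k * t.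
    move=> u0 ut tT su ts IH.
    have cv v : u <= v <= t -> `|c (Hhat v) - c (e n)| <= k.
      move=> /andP[uv vt].
      have vT : 0 <= v <= T by rewrite (le_trans u0) //= (le_trans vt).
      have sv : (s n <= v%:E <= s n.+1)%E.
        by rewrite (le_trans su) ?lee_fin //= (le_trans _ ts) // lee_fin.
      have [snT _ _ _] := cell_ratio vT sv.
      have /andP[h1 _] := interpolated_bnd vT; have /andP[h2 _] := energy_bnd snT.
      apply: (le_trans (clock_rate_lipschitz D_gt0 H0_gt0 h1 h2)).
      rewrite /k ler_wpM2l ?interpolated_near //.
      by rewrite invr_ge0 mulr_ge0 ?mulr_ge0 ?sqrtr_ge0 // ltW.
    have h1 : (c (e n) - k) * (t - u) <= clock c Hhat u t.
      by apply: clock_ge => // v /cv; rewrite ler_norml => /andP[]; lra.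
    have h2 : clock c Hhat u t <= (c (e n) + k) * (t - u).
      by apply: clock_le => // v /cv; rewrite ler_norml => /andP[]; lra.
    rewrite (clock_split cc cH (lexx 0) u0 ut tT).
    have QE : eps * (Q n t / (2 * D)) = eps * (Q n u / (2 * D)) + c (e n) * (t - u).
      rewrite /Q /clock_rate /speed; field; rewrite !gt_eqF //.
    by rewrite QE; move: IH; rewrite !ler_norml => /andP[]; lra.
have claim n : forall t, 0 <= t <= T -> (s n <= t%:E <= s n.+1)%E ->
    `|clock c Hhat 0 t - eps * (Q n t / (2 * D))| <= k * t.
  elim: n => [|n IH] t tT /andP[st ts].
    have /andP[t0 tT'] := tT.
    apply: (cell 0%N 0) => //.
    by rewrite /Q /= clock00 subrr mulr0 addr0 subrr mul0r !mulr0 subrr normr0.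
  have /andP[t0 tT'] := tT.
  have sT : (s n.+1 <= T%:E)%E by rewrite (le_trans st) // lee_fin.
  have sE := collision_fin sT.
  have ut : tau n.+1 <= t by rewrite -lee_fin -sE.
  have uT : 0 <= tau n.+1 <= T by rewrite collision_time_ge0 (le_trans ut).
  have ss : (s n <= s n.+1)%E by apply: collision_le.
  apply: (cell n.+1 (tau n.+1)) => //.
  - exact: collision_time_ge0.
  - by rewrite sE.
  have -> : Q n.+1 (tau n.+1) = Q n (tau n.+1).
    by rewrite /Q subrr mulr0 addr0 (collision_stepE (le_trans ss sT)); ring.
  by apply: IH => //; rewrite -sE ss /=.
move: z => t tT; have /andP[t0 tT'] := tT; have /andP[nt tn] := collisions_before_spec tT.
move: (cb t) nt tn => n nt tn.
have sn : (s n <= t%:E <= s n.+1)%E by rewrite nt ltW.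
have := claim n t tT sn.
have [snT h1 h2 _] := cell_ratio tT sn.
have sp := speed_gt0 eps_gt0 (energy_gt0 snT).
have a1 : 0 <= speed eps (e n) * (t - tau n) by rewrite mulr_ge0 ?subr_ge0 // ltW.
have a2 : speed eps (e n) * (t - tau n) <= wall D q0 n.+1 - wall D q0 n.
  by rewrite -(collision_stepE snT) ler_pM2l // lerD2r.
have [q1 q2] : n%:R * D - D <= Q n t /\ Q n t <= n%:R * D + D.
  rewrite /Q; case: n {nt tn sn} snT h1 h2 sp a1 a2 => [|n] snT h1 h2 sp a1 a2.
    have w1 : wall D q0 1 = D by rewrite /wall mul1r.
    have w0 : wall D q0 0 = q0 by [].
    move: a1 a2; rewrite w1 w0 mul0r; move: (speed _ _ * _) => A a1 a2; move: D_gt0 q0_ge0; split; lra.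
  have w2 : wall D q0 n.+2 = n.+1%:R * D + D by rewrite /wall -natr1 mulrDl mul1r.
  have w1 : wall D q0 n.+1 = n.+1%:R * D by [].
  move: a1 a2; rewrite w2 w1; move: (speed _ _ * _) => A a1 a2; move: q0_ltD q0_ge0; split; lra.
have b1 : n%:R / 2 - 2^-1 <= Q n t / (2 * D).
  by rewrite ler_pdivlMr ?mulr_gt0 //; lra.
have b2 : Q n t / (2 * D) <= n%:R / 2 + 2^-1.
  by rewrite ler_pdivrMr ?mulr_gt0 //; lra.
have b3 : k * t <= k * T by rewrite ler_wpM2l.
have -> : eps * clock_slack = k * T + eps by rewrite /clock_slack /k; ring.
move: b1 b2; rewrite -(ler_pM2l eps_gt0) => b1; rewrite -(ler_pM2l eps_gt0) => b2.
by rewrite !ler_norml => /andP[]; lra.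
Qed.

Lemma collision_leE n t : 0 <= t <= T -> (s n <= t%:E)%E = (n <= cb t)%N.
Proof.
move=> tT; have /andP[st ts] := collisions_before_spec tT.
apply/idP/idP => [nt|/(collision_le x xi eta D_gt0 q0_ltD eps_gt0)/le_trans]; last exact.
rewrite leqNgt; apply/negP => /(collision_le x xi eta D_gt0 q0_ltD eps_gt0) h.
by have := lt_le_trans ts h; rewrite ltNge nt.
Qed.

Variables (Lam : R -> R) (G : nat) (l : nat -> R).
Hypotheses (Lam0 : Lam 0 = 0) (G_gt0 : (0 < G)%N).
(** The number of collisions of odd index up to grid point [j]; the pairs tilted by [l i] are those
    with [a i <= k < a i.+1]. *)
Let a j := uphalf (cb (grid T G j)).

Let grid_in j : (j <= G)%N -> 0 <= grid T G j <= T.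
Proof. by move=> jG; rewrite grid_ge0 ?grid_leT. Qed.

Lemma odd_collision_leE j k : (j <= G)%N -> (s k.*2.+1 <= (grid T G j)%:E)%E = (k < a j)%N.
Proof. by move=> jG; rewrite collision_leE ?grid_in // /a; move: (cb _) => m; clear; lia. Qed.

Lemma period_mono i j : (i <= j)%N -> (j <= G)%N -> (a i <= a j)%N.
Proof.
move=> ij jG; suff : (cb (grid T G i) <= cb (grid T G j))%N by rewrite /a; move: (cb _) => m; clear; lia.
rewrite -collision_leE ?grid_in //; have /andP[h _] := collisions_before_spec (grid_in (leq_trans ij jG)).
by apply: (le_trans h); rewrite lee_fin grid_le.
Qed.

Lemma controlE k : control T D q0 x eps xi eta G l k =
  \sum_(i < G) l i * (a i <= k < a i.+1)%N%:R.
Proof.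
apply: eq_bigr => i _; congr (_ * _%:R).
rewrite -/(s k.*2.+1) (odd_collision_leE k (ltn_ord i)) ltNge.
by rewrite (odd_collision_leE k (ltnW (ltn_ord i))) -leqNgt.
Qed.

Lemma control_in i k : (i < G)%N -> (a i <= k < a i.+1)%N ->
  control T D q0 x eps xi eta G l k = l i.
Proof.
move=> iG ki; rewrite controlE (bigD1 (Ordinal iG)) //= ki mulr1 big1 ?addr0 // => j ji.
suff -> : (a j <= k < a j.+1)%N = false by rewrite mulr0.
apply/negbTE/negP => /andP[jk kj]; move/andP: ki => [ik ki].
have [h|h|h] := ltngtP j i; last by case/eqP: ji; exact: val_inj.
- by have := leq_trans kj (leq_trans (period_mono h (ltnW iG)) ik); rewrite ltnn.
- by have := leq_trans ki (leq_trans (period_mono h (ltnW (ltn_ord j))) jk); rewrite ltnn.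
Qed.

Lemma control_out k : (a G <= k)%N -> control T D q0 x eps xi eta G l k = 0.
Proof.
move=> ki; rewrite controlE big1 // => j _.
suff -> : (a j <= k < a j.+1)%N = false by rewrite mulr0.
have := leq_trans (period_mono (ltn_ord j) (leqnn G)) ki.
by rewrite leqNgt andbC => /negbTE ->.
Qed.

Lemma sum_losses i j : (i <= j)%N ->
  \sum_(i <= k < j) (loss xi eta k.*2 + loss xi eta k.*2.+1) = eps^-1 * (e i.*2 - e j.*2).
Proof.
move=> ij; rewrite (eq_bigr (fun k => - (eps^-1 * e k.+1.*2) - - (eps^-1 * e k.*2))).
  by rewrite (telescope_sumr (fun k => - (eps^-1 * e k.*2)) ij); ring.
move=> k _; rewrite /e doubleS /energy !big_ord_recr /=; field.
by rewrite gt_eqF.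
Qed.

Let tilt k : R := control T D q0 x eps xi eta G l k * (loss xi eta k.*2 + loss xi eta k.*2.+1)
  - Lam (control T D q0 x eps xi eta G l k).

Lemma tilt_cells j : (j <= G)%N -> \sum_(0 <= k < a j) tilt k =
  \sum_(i < j) (l i * (eps^-1 * (e (a i).*2 - e (a i.+1).*2)) - Lam (l i) * ((a i.+1)%:R - (a i)%:R)).
Proof.
elim: j => [_|j IH jG].
  have TT : 0 <= (0 : R) <= T by rewrite lexx ltW.
  have : ~~ (1 <= cb 0)%N.
    rewrite -collision_leE // -ltNge.
    exact: (@collision_lt _ D q0 x eps xi eta D_gt0 q0_ltD eps_gt0 0%N).
  by rewrite -leqNgt leqn0 big_ord0 /a grid0 => /eqP ->; rewrite big_geq.
have aj : (a j <= a j.+1)%N by exact: period_mono.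
rewrite big_ord_recr /= -(IH (ltnW jG)) (big_cat_nat (n := a j)) //=; congr (_ + _).
rewrite (eq_big_nat _ _ (F2 := fun k => l j * (loss xi eta k.*2 + loss xi eta k.*2.+1) - Lam (l j))).
  by rewrite sumrB -mulr_sumr sum_losses // sumr_const_nat -[Lam (l j) *+ _]mulr_natr natrB.
by move=> k kj; rewrite /tilt (control_in jG kj).
Qed.

(** Within a cell the losses telescope to an energy difference. At each end, passing to [Hhat] costs
    [M] for the interpolation and [M] for the parity of the collision index, and the period count
    costs [clock_slack] plus one half for rounding up. Two ends give [4 M] and [2 clock_slack + 1],
    free of [eps]. *)
Lemma grid_rate_tilt N : T < (N.*2%:R - 1) * gap ->
  `|\sum_(k < N) tilt k - eps^-1 * grid_rate c Lam T G l Hhat| <=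
  \sum_(i < G) (`|l i| * (4 * M) + `|Lam (l i)| * (2 * clock_slack + 1)).
Proof.
move=> /collision_gtT TN.
have aN : (a G <= N)%N.
  have TT : 0 <= T <= T by rewrite lexx ltW.
  have : ~~ (N.*2 <= cb T)%N by rewrite -collision_leE // -ltNge.
  by rewrite /a gridn //; move: (cb T) => m; clear; lia.
rewrite -(big_mkord xpredT tilt) (big_cat_nat (n := a G)) //= tilt_cells //.
(* Pairs whose odd collision comes after [T] have zero control and, as [Lam 0 = 0], zero tilt. *)
rewrite [X in _ + X - _]big1_seq ?addr0; last first.
  move=> k /=; rewrite mem_index_iota => /andP[ak _].
  by rewrite /tilt control_out // mul0r Lam0 subrr.
rewrite /grid_rate mulr_sumr -sumrB; apply: (le_trans (ler_norm_sum _ _ _)).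
apply: ler_sum => i _; have iG := ltnW (ltn_ord i).
have near j : (j <= G)%N -> `|eps^-1 * (e (a j).*2 - Hhat (grid T G j))| <= 2 * M.
  move=> jG; have sp := collisions_before_spec (grid_in jG).
  have sp' : (s (cb (grid T G j)) <= (grid T G j)%:E <= s (cb (grid T G j)).+1)%E.
    by have /andP[-> /ltW ->] := sp.
  have := interpolated_near (grid_in jG) sp'.
  have : `|e (a j).*2 - e (cb (grid T G j))| <= eps * M.
    have [->|->] : (a j).*2 = cb (grid T G j) \/ (a j).*2 = (cb (grid T G j)).+1 by rewrite /a; move: (cb _) => m; clear; lia.
      by rewrite subrr normr0 mulr_ge0 ?lossM_ge0 // ltW.
    exact: energy_diff.
  rewrite normrM (@gtr0_norm _ eps^-1) ?invr_gt0 // [eps^-1 * _]mulrC ler_pdivrMr // !ler_norml.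
  by move=> /andP[? ?] /andP[? ?]; lra.
have clk j : (j <= G)%N ->
    `|(a j)%:R - eps^-1 * clock c Hhat 0 (grid T G j)| <= clock_slack + 2^-1.
  move=> jG; have := clock_interpolated (grid_in jG).
  have aE : `|(a j)%:R - (cb (grid T G j))%:R / 2| <= 2^-1 :> R.
    have [<-|E] : (a j).*2 = cb (grid T G j) \/ (a j).*2 = (cb (grid T G j)).+1 by rewrite /a; move: (cb _) => m; clear; lia.
      by rewrite -muln2 natrM mulfK // subrr normr0.
    have : (a j).*2%:R = (cb (grid T G j)).+1%:R :> R by rewrite E.
    rewrite -muln2 natrM -[(cb _).+1%:R]natr1 => E'; rewrite ler_norml; apply/andP; split; lra.
  rewrite -ler_pdivrMl // => clk.
  have -> : (a j)%:R - eps^-1 * clock c Hhat 0 (grid T G j) = (a j)%:R - (cb (grid T G j))%:R / 2 -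
      eps^-1 * (clock c Hhat 0 (grid T G j) - eps * ((cb (grid T G j))%:R / 2)).
    by rewrite mulrBr [eps^-1 * (eps * _)]mulrA mulVf ?gt_eqF // mul1r; ring.
  apply: (le_trans (ler_normB _ _)); rewrite addrC lerD //.
  by rewrite normrM gtr0_norm ?invr_gt0.
have split : clock c Hhat 0 (grid T G i.+1) =
    clock c Hhat 0 (grid T G i) + clock c Hhat (grid T G i) (grid T G i.+1).
  apply: (clock_split (@clock_rate_continuous R D) interpolated_continuous) => //.
  - by rewrite grid_ge0.
  - by rewrite grid_le.
  - by rewrite grid_leT.
have := near i iG; have := near i.+1 (ltn_ord i); have := clk i iG; have := clk i.+1 (ltn_ord i).
rewrite split => c2 c1 n2 n1.
set X1 := eps^-1 * (e (a i).*2 - Hhat _) in n1; set X2 := eps^-1 * (e (a i.+1).*2 - Hhat _) in n2.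
set Y1 := _ - _ in c1; set Y2 := _ - _ in c2.
have -> : l i * (eps^-1 * (e (a i).*2 - e (a i.+1).*2)) - Lam (l i) * ((a i.+1)%:R - (a i)%:R) -
  eps^-1 * (- l i * (Hhat (grid T G i.+1) - Hhat (grid T G i)) -
   Lam (l i) * clock c Hhat (grid T G i) (grid T G i.+1)) = l i * (X1 - X2) - Lam (l i) * (Y2 - Y1).
  by rewrite /X1 /X2 /Y1 /Y2; ring.
apply: (le_trans (ler_normB _ _)); rewrite !normrM; apply: lerD; apply: ler_wpM2l => //.
  by apply: (le_trans (ler_normB _ _)); lra.
by apply: (le_trans (ler_normB _ _)); lra.
Qed.

End GoodTrajectory.

(** * Compact sets of paths *)

Lemma fmap_ultra (U V : Type) (f : U -> V) (F : set_system U) :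
  UltraFilter F -> UltraFilter (f @ F).
Proof.
move=> FU; split; first exact: fmap_proper_filter.
move=> G PG FG; apply/seteqP; split => [A GA|]; last exact: FG.
have [//|FnA] := in_ultra_setVsetC (f @^-1` A) FU.
have : G (A `&` ~` A) by apply: filterI => //; exact: FG.
by rewrite setICr => /filter_not_empty.
Qed.

Section PathCompactness.
Context {R : realType}.
Variable T : R.
Hypothesis T_gt0 : 0 < T.
Notation paths := {uniform` `[0, T] -> R}.

Definition close_to (chi : R -> R) (e : R) : set (R -> R) :=
  [set psi | forall t, 0 <= t <= T -> `|psi t - chi t| < e].

Lemma close_to_nbhs chi e : 0 < e -> nbhs (chi : paths) (close_to chi e).
Proof.
move=> e0; apply/uniform_nbhs; exists [set xy | `|xy.1 - xy.2| < e]; split.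
  by apply: entourage_ball (PosNum e0).
by move=> psi H t tT; rewrite distrC; apply: H; rewrite /= in_itv.
Qed.

Lemma close_to_cvg (F : set_system paths) (g : paths) : Filter F ->
  (forall e, 0 < e -> F (close_to g e)) -> F --> g.
Proof.
move=> FF H P /uniform_nbhs[E [entE EP]].
have [e e0 eE] : exists2 e : R, 0 < e & forall a b : R, `|a - b| < e -> E (a, b).
  move: entE; rewrite -entourage_ballE => -[e e0 eE].
  by exists e => // a b ab; apply: eE.
apply: filterS (H e e0) => psi He; apply: EP => t; rewrite /= in_itv /= => tT.
by apply: eE; rewrite distrC; exact: He.
Qed.

Lemma grid_index (n : nat) t : (0 < n)%N -> 0 <= t <= T ->
  exists2 i, (i <= n)%N & grid T n i <= t <= grid T n i + T / n%:R.
Proof.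
move=> n0 /andP[t0 tT]; have n0' : 0 < n%:R :> R by rewrite ltr0n.
have r0 : 0 <= t * n%:R / T by rewrite divr_ge0 ?mulr_ge0 // ltW.
have /andP[i1 i2] := truncn_itv r0.
exists (Num.truncn (t * n%:R / T)).
  by rewrite -(ler_nat R) (le_trans i1) // ler_pdivrMr // [_ * T]mulrC ler_pM2r.
move: (Num.truncn _) i1 i2 => i; rewrite ler_pdivlMr // ltr_pdivrMr // -natr1 => i1 i2.
rewrite /grid; apply/andP; split.
  by rewrite mulrA ler_pdivrMr // mulrC.
by rewrite mulrA -mulrDl ler_pdivlMr //; lra.
Qed.

Variables (K H0 H1 x : R).

Definition lipschitz_paths : set (R -> R) := [set phi |
  [/\ forall u v, 0 <= u -> u <= v -> v <= T -> `|phi v - phi u| <= K * (v - u),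
      forall t, 0 <= t <= T -> H0 <= phi t <= H1 & phi 0 = x]].

(** Arzela-Ascoli by ultrafilters: pointwise limits exist because the values stay in [[H0, H1]], and
    the common Lipschitz bound turns convergence on a finite grid into uniform convergence. The
    limit is set to 0 off [[0, T]], where the topology does not look. *)
Lemma lipschitz_paths_compact (A : set (R -> R)) : A `<=` lipschitz_paths ->
  (forall g, lipschitz_paths g ->
     (forall e, 0 < e -> exists2 psi, A psi & close_to g e psi) -> A g) ->
  compact (A : set paths).
Proof.
move=> AK Acl; rewrite compact_ultra => F UF FA.
have PF : ProperFilter F by exact: ultra_proper.
have ev t : 0 <= t <= T -> exists l : R, psi t @[psi --> F] --> l.
  move=> tT; have := @segment_compact R H0 H1; rewrite compact_ultra.
  move=> /(_ _ (fmap_ultra (fun psi : paths => psi t) UF)) [].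
    apply: (@filterS _ F _ _ _ _ FA) => psi /AK[_ /(_ t tT) H _].
    by rewrite /preimage /= in_itv /= H.
  by move=> l [_ Fl]; exists l.
pose g t := if pselect (0 <= t <= T) is left tT then sval (cid (ev t tT)) else 0.
have gE t : 0 <= t <= T -> psi t @[psi --> F] --> g t.
  by rewrite /g => tT; case: pselect => // tT'; exact: (svalP (cid (ev t tT'))).
have Kg : lipschitz_paths g.
  split.
  - move=> u v u0 uv vT.
    have gu : psi u @[psi --> F] --> g u by apply: gE; rewrite u0 (le_trans uv).
    have gv : psi v @[psi --> F] --> g v by apply: gE; rewrite vT (le_trans u0).
    have cv : `|psi v - psi u| @[psi --> F] --> `|g v - g u| by apply: cvg_norm; apply: cvgB.
    apply: (@closed_cvg _ _ F _ _ [set y : R | y <= K * (v - u)] _ _ _ cv); first exact: closed_le.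
    by apply: filterS FA => psi /AK[+ _ _]; exact.
  - move=> t tT; apply/andP; split.
      apply: (@closed_cvg _ _ F _ _ [set y : R | H0 <= y] _ _ _ (gE t tT)); first exact: closed_ge.
      by apply: filterS FA => psi /AK[_ /(_ t tT)/andP[]].
    apply: (@closed_cvg _ _ F _ _ [set y : R | y <= H1] _ _ _ (gE t tT)); first exact: closed_le.
    by apply: filterS FA => psi /AK[_ /(_ t tT)/andP[]].
  - have T0 : 0 <= (0 : R) <= T by rewrite lexx ltW.
    apply: (@closed_cvg _ _ F _ _ [set y : R | y = x] _ _ _ (gE 0 T0)); first exact: closed_eq.
    by apply: filterS FA => psi /AK[].
have Fg e : 0 < e -> F (close_to g e).
  move=> e0; pose n := (Num.truncn (`|K| * T / (e / 3))).+1.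
  have n0 : 0 < n%:R :> R by rewrite ltr0n.
  have Kn : `|K| * (T / n%:R) < e / 3.
    rewrite mulrA ltr_pdivrMr // [e / 3 * _]mulrC -ltr_pdivrMr ?divr_gt0 //; exact: truncnS_gt.
  have : F [set psi | forall i : 'I_n.+1, `|psi (grid T n i) - g (grid T n i)| < e / 3].
    apply: filter_forall => i.
    have iT : 0 <= grid T n i <= T by rewrite grid_ge0 ?grid_leT // -ltnS.
    have /cvgrPdist_lt/(_ (e / 3)) := gE _ iT; rewrite divr_gt0 // => /(_ isT).
    by apply: filterS => psi; rewrite distrC.
  apply: filterS2 FA => psi /AK[Lpsi _ _] near t tT.
  have [i ni /andP[it ti]] := grid_index (ltn0Sn _ : (0 < n)%N) tT.
  have := near (Ordinal (ni : (i < n.+1)%N)); rewrite /= => neari.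
  have /andP[t0 tT'] := tT.
  have L1 := Lpsi _ _ (grid_ge0 T_gt0 n i) it tT'.
  have [Lg _ _] := Kg; have L2 := Lg _ _ (grid_ge0 T_gt0 n i) it tT'.
  have Kt : K * (t - grid T n i) <= `|K| * (T / n%:R).
    apply: (@le_trans _ _ (`|K| * (t - grid T n i))).
      by rewrite ler_wpM2r ?ler_norm // subr_ge0.
    by rewrite ler_wpM2l //; lra.
  have -> : psi t - g t = (psi t - psi (grid T n i)) + (psi (grid T n i) - g (grid T n i)) - (g t - g (grid T n i)) by ring.
  apply: (le_lt_trans (ler_normB _ _)).
  have := ler_normD (psi t - psi (grid T n i)) (psi (grid T n i) - g (grid T n i)); lra.
exists g; split; last exact: close_to_cvg.
apply: Acl => // e e0; have [psi [Apsi gpsi]] := filter_ex (filterI FA (Fg e e0)).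
by exists psi.
Qed.

Lemma compact_cover_close (A : set (R -> R)) (V : (R -> R) -> R) :
  compact (A : set paths) -> (forall psi, A psi -> 0 < V psi) ->
  exists (N : nat) (c : nat -> R -> R), (forall i, (i < N)%N -> A (c i)) /\
    forall psi, A psi -> exists2 i, (i < N)%N & close_to (c i) (V (c i)) psi.
Proof.
move=> cA V0.
pose pT : ptopologicalType := HB.pack paths (Pointed.class paths) (Topological.class paths).
have : @compact pT A by [].
rewrite compact_cover => /(_ _ (A : set paths) (fun chi => interior (close_to chi (V chi) : set paths))) [].
- by move=> chi _; exact: open_interior.
- by move=> psi Apsi; exists psi => //; apply: close_to_nbhs; exact: V0.
move=> D' D'A cov; pose s : seq (R -> R) := finmap.enum_fset D'.
exists (size s), (nth (cst 0) s); split.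
  move=> i iN; have := D'A (nth (cst 0) s i).
  by move=> /(_ (mem_nth (cst 0) iN)); rewrite inE.
move=> psi /cov[chi /= chiD chipsi].
have chis : (chi : R -> R) \in s by [].
exists (index (chi : R -> R) s); first by rewrite index_mem.
by rewrite nth_index //; exact: interior_subset chipsi.
Qed.

(** The centres of finite covers by balls of radius [1 / (m + 1)], for all [m], in one enumeration;
    codes of no centre are sent to [psi0]. *)
Lemma compact_dense_seq (A : set (R -> R)) (psi0 : R -> R) :
  compact (A : set paths) -> A psi0 ->
  exists b : nat -> R -> R, (forall k, A (b k)) /\
    forall psi e, A psi -> 0 < e -> exists k, close_to (b k) e psi.
Proof.
move=> cA A0.
have /choice[f Hf] : forall m : nat, exists Nc : nat * (nat -> R -> R),
    (forall i, (i < Nc.1)%N -> A (Nc.2 i)) /\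
    forall psi, A psi -> exists2 i, (i < Nc.1)%N & close_to (Nc.2 i) m.+1%:R^-1 psi.
  move=> m; have [N [c H]] := compact_cover_close (V := fun=> m.+1%:R^-1) cA (fun _ _ => ltac:(by rewrite invr_gt0)).
  by exists (N, c).
pose b k := if unpickle k is Some mi then
  if (mi.2 < (f mi.1).1)%N then (f mi.1).2 mi.2 else psi0 else psi0.
exists b; split.
  move=> k; rewrite /b; case: (unpickle k) => // -[m i] /=; case: ifP => // im.
  by have [+ _] := Hf m; exact.
move=> psi e Apsi e0; pose m := Num.truncn e^-1.
have [_ /(_ psi Apsi)[i iN ci]] := Hf m.
exists (pickle (m, i)); rewrite /b pickleK /= iN => t tT.
apply: (lt_trans (ci t tT)); rewrite -[e]invrK ltf_pV2 ?posrE ?invr_gt0 //.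
exact: truncnS_gt.
Qed.

End PathCompactness.

(** * The law of the losses *)

Section Losses.
Context (R : realType) d (Omega : measurableType d) (P : probability Omega R).
Variables (xi eta : nat -> {RV P >-> R}) (M : R).
Hypotheses
  (indep : independent_family
     (fun i : nat + nat => match i with inl k => xi k | inr k => eta k end))
  (xi_id : identically_distributed xi) (eta_id : identically_distributed eta)
  (eta_dens : forall k, has_continuous_density (eta k))
  (xi_bnd : forall k, P [set w | `|xi k w| <= M] = 1%E)
  (eta_bnd : forall k, P [set w | `|eta k w| <= M] = 1%E).

Definition losses (n : nat) (w : Omega) : R := loss (xi ^~ w) (eta ^~ w) n.

Lemma losses_even k : losses k.*2 = xi k.
Proof. by apply/funext => w; rewrite /losses /loss odd_double doubleK. Qed.

Lemma losses_odd k : losses k.*2.+1 = eta k.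
Proof. by apply/funext => w; rewrite /losses /loss /= odd_double /= uphalf_double. Qed.

Lemma losses_cases n : exists i : nat + nat,
  losses n = (match i with inl k => xi k | inr k => eta k end : {RV P >-> R}).
Proof.
have := odd_double_half n; case: (odd n) => /= <-.
  by exists (inr n./2); rewrite add1n losses_odd.
by exists (inl n./2); rewrite add0n losses_even.
Qed.

Lemma measurable_losses n : measurable_fun setT (losses n).
Proof. by have [i ->] := losses_cases n; exact: measurable_funPT. Qed.

Lemma prob1_ae (A : set Omega) : measurable A -> P A = 1%E -> {ae P, forall w, A w}.
Proof.
move=> mA PA; exists (~` A); split => //; first exact: measurableC.
by rewrite probability_setC // PA subee.
Qed.

Lemma losses_bnd n : {ae P, forall w, `|losses n w| <= M}.
Proof.
have mB : measurable [set w | `|losses n w| <= M].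
  have mG : measurable_fun setT (fun w => `|losses n w|).
    by apply: measurableT_comp => //; exact: measurable_losses.
  rewrite -[X in measurable X]setTI -[X in _ `&` X](_ : (fun w => `|losses n w|) @^-1` `]-oo, M] = _).
    exact: mG.
  by apply/seteqP; split => w /=; rewrite in_itv.
by apply: (prob1_ae mB); have [[k|k] ->] := losses_cases n.
Qed.

Lemma losses_independent n (A : nat -> set R) : (forall i, measurable (A i)) ->
  P (\bigcap_(i < n) (losses i @^-1` A i)) = (\prod_(i < n) P (losses i @^-1` A i))%E.
Proof.
move=> mA; pose idx i : nat + nat := if odd i then inr i./2 else inl i./2.
pose unidx (i : nat + nat) := match i with inl k => k.*2 | inr k => k.*2.+1 end.
have idxK i : unidx (idx i) = i.
  by rewrite /idx /unidx -[RHS](odd_double_half i); case: (odd i); rewrite ?add1n.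
have lossE i : losses i = (match idx i with inl k => xi k | inr k => eta k end : {RV P >-> R}).
  by rewrite -[in LHS](idxK i); case: (idx i) => k /=; rewrite ?losses_even ?losses_odd.
have := @indep (map idx (iota 0 n)) (A \o unidx).
rewrite map_inj_uniq ?iota_uniq; last exact: can_inj idxK.
move=> /(_ isT (fun i => mA _)).
rewrite big_map -(big_mkord xpredT (fun i => P (losses i @^-1` A i))) /index_iota subn0.
rewrite (_ : \bigcap_(i in _) _ = \bigcap_(i < n) (losses i @^-1` A i)).
  by move=> ->; apply: eq_bigr => i _; rewrite lossE /= idxK.
apply/seteqP; split => w wA i /=.
  move=> iN; have := wA (idx i); rewrite /= idxK lossE; apply.
  by rewrite map_f // mem_iota.
by move=> /mapP[j]; rewrite mem_iota add0n => /= jn ->; have := wA j jn; rewrite lossE /= idxK.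
Qed.

Lemma eq_distribution_cumulant (X Y : {RV P >-> R}) l :
  (forall A, measurable A -> distribution P X A = distribution P Y A) ->
  cumulant P X l = cumulant P Y l.
Proof.
move=> XY; have mE : measurable_fun setT (fun y : R => (expR (l * y))%:E).
  by apply/measurable_EFinP; apply: measurableT_comp => //; exact: measurable_funM.
have E0 (y : R) : (0 <= (expR (l * y))%:E)%E by rewrite lee_fin expR_ge0.
rewrite /cumulant !unlock; congr (ln (fine _)).
rewrite -(ge0_integral_distribution X mE E0) -(ge0_integral_distribution Y mE E0).
by apply: eq_measure_integral => A mA _; exact: XY.
Qed.

Lemma cumulant_even k l : cumulant P (losses k.*2) l = cumulant P (losses 0) l.
Proof.
rewrite losses_even (_ : losses 0 = xi 0%N); first exact/eq_distribution_cumulant/xi_id.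
exact: (losses_even 0).
Qed.

Lemma cumulant_odd k l : cumulant P (losses k.*2.+1) l = cumulant P (losses 1) l.
Proof.
rewrite losses_odd (_ : losses 1 = eta 0%N); first exact/eq_distribution_cumulant/eta_id.
exact: (losses_odd 0).
Qed.

Definition period_loss (w : Omega) : R := xi 0%N w + eta 0%N w.

Lemma measurable_period_loss : measurable_fun setT period_loss.
Proof. exact: measurable_funD. Qed.

Lemma period_loss_bnd : {ae P, forall w, `|period_loss w| <= 2 * M}.
Proof.
have aeF := ae_filter_ringOfSetsType P.
apply: filterS2 (losses_bnd 0) (losses_bnd 1) => w.
rewrite (losses_even 0) (losses_odd 0) /period_loss => h1 h2.
by apply: (le_trans (ler_normD _ _)); lra.
Qed.

(** Independence enters as one step of the tilting, with the first loss as the past of the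
    second. *)
Lemma cumulant_period l : cumulant P period_loss l =
  cumulant P (losses 0) l + cumulant P (losses 1) l.
Proof.
have cE := cumulantE measurable_period_loss period_loss_bnd l.
have mf : measurable_fun (setT : set (past_type losses 1)) (fun w => expR (l * losses 0 w)).
  apply: measurableT_comp => //; apply: measurable_funM => //.
  by apply: past_X => //; exact: measurable_losses.
have ml : measurable_fun (setT : set (past_type losses 1)) (fun _ => l) by exact: measurable_cst.
have := past_tilt measurable_losses losses_independent mf ml (fun=> expR_ge0 _) (losses_bnd 1).
under eq_integral do rewrite -expRD -mulrDr.
rewrite (_ : (fun w => _) = fun w => (expR (l * period_loss w))%:E); last first.
  by apply/funext => w; rewrite (losses_even 0) (losses_odd 0).
rewrite cE; under eq_integral do rewrite mulrC EFinM.
rewrite ge0_integralZl_EFin ?expR_ge0 //; last exact: measurable_expZ (measurable_losses 0) l.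
rewrite (cumulantE (measurable_losses 0) (losses_bnd 0)) -EFinM -expRD => -[/expR_inj ->].
by rewrite addrC.
Qed.

(** Given [xi], the event asks [eta] for one prescribed value, which has probability 0 because [eta]
    has a density. *)
Lemma period_loss_atomless (a : R) : P [set w | period_loss w = a] = 0%E.
Proof.
pose h (z : R * R) : \bar R := (\1_[set z : R * R | z.1 + z.2 = a] z)%:E.
have mS : measurable [set z : R * R | z.1 + z.2 = a].
  have mD : measurable_fun setT (fun z : R * R => z.1 + z.2).
    by apply: measurable_funD; [exact: measurable_fst|exact: measurable_snd].
  rewrite (_ : [set z | _] = setT `&` (fun z : R * R => z.1 + z.2) @^-1` [set a]); last by rewrite setTI.
  exact: (mD measurableT _ (measurable_set1 a)).
have mh : measurable_fun setT h by apply/measurable_EFinP; exact: measurable_indic.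
have ind2 (A B : set R) : measurable A -> measurable B ->
    P (xi 0%N @^-1` A `&` eta 0%N @^-1` B) = (P (xi 0%N @^-1` A) * P (eta 0%N @^-1` B))%E.
  move=> mA mB; pose C (i : nat) := if i == 0%N then A else B.
  have := losses_independent 2 (A := C); rewrite !big_ord_recl big_ord0 /= mule1.
  rewrite (losses_even 0) (losses_odd 0) => <-; last by move=> i; rewrite /C; case: ifP.
  congr (P _); apply/seteqP; split => w.
    by move=> [wA wB] [|[|i]] //= _; rewrite ?(losses_even 0) ?(losses_odd 0).
  by move=> H; split; [have := H 0%N isT|have := H 1%N isT]; rewrite /= ?(losses_even 0) ?(losses_odd 0).
have := joint_law (h := h) (measurable_funPT (xi 0%N)) (measurable_funPT (eta 0%N)) ind2 mh.
have h0 z : (0 <= h z)%E by rewrite /h lee_fin.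
move=> /(_ h0); rewrite [X in _ = X -> _](_ : _ = 0%E).
  move=> <-; rewrite -[X in P X]setIT -integral_indic //.
  rewrite (_ : [set w | _] = setT `&` period_loss @^-1` [set a]); last by rewrite setTI.
  exact: (measurable_period_loss measurableT (measurable_set1 a)).
apply: integral0_eq => w _.
have [f [_ _ fE]] := eta_dens 0.
transitivity (distribution P (eta 0%N) [set a - xi 0%N w]); last first.
  by rewrite fE ?integral_set1 //; exact: measurable_set1.
rewrite -[RHS]/(P (eta 0%N @^-1` [set a - xi 0%N w])) -[X in P X]setIT -integral_indic //.
apply: eq_integral => w' _; rewrite /h !indicE; congr (_%:R%:E).
by congr nat_of_bool; apply/idP/idP; rewrite !inE /= => ?; lra.
Qed.

End Losses.

(** * The action as a supremum of grid rates *)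

Section RateOfPaths.
Context {R : realType}.
Variables (T D M H0 H1 x : R) (Lam : R -> R).
Hypotheses (T_gt0 : 0 < T) (D_gt0 : 0 < D) (M_gt0 : 0 < M) (H0_gt0 : 0 < H0)
  (Lam0 : Lam 0 = 0) (LamB : forall l, `|Lam l| <= 2 * M * `|l|).
Notation c := (clock_rate D).
Notation K := (path_slope D M H1).
Notation Kset := (lipschitz_paths T K H0 H1 x).
Notation J := (grid_rate c Lam T).

Definition clock_lip : R := (2 * D * Num.sqrt (2 * H0))^-1.

Lemma clock_lip_ge0 : 0 <= clock_lip.
Proof. by rewrite invr_ge0 !mulr_ge0 ?sqrtr_ge0 // ltW. Qed.

Lemma path_continuous phi : Kset phi -> {within `[0, T], continuous phi}.
Proof. by move=> [lip _ _]; exact: (lipschitz_continuous T_gt0 lip). Qed.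

Lemma path_slope_ge0 : 0 <= K.
Proof. by rewrite divr_ge0 ?mulr_ge0 ?sqrtr_ge0 // ltW. Qed.

Lemma clock_bounds phi u v : {within `[0, T], continuous phi} ->
  (forall t, 0 <= t <= T -> H0 <= phi t <= H1) -> 0 <= u -> u <= v -> v <= T ->
  c H0 * (v - u) <= clock c phi u v <= c H1 * (v - u).
Proof.
move=> cphi bphi u0 uv vT; have cc : continuous c by exact: clock_rate_continuous.
have mono a b : a <= b -> c a <= c b.
  move=> ab; rewrite /clock_rate ler_wpM2r ?invr_ge0 ?mulr_ge0 ?(ltW D_gt0) //.
  by rewrite ler_wsqrtr // ler_pM2l.
have tT t : u <= t <= v -> 0 <= t <= T.
  by move=> /andP[ut tv]; rewrite (le_trans u0 ut) (le_trans tv vT).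
apply/andP; split.
  by apply: (clock_ge cc cphi) => // t /tT/bphi/andP[+ _]; exact: mono.
by apply: (clock_le cc cphi) => // t /tT/bphi/andP[_]; exact: mono.
Qed.

Lemma clock_near phi psi u v (r : R) : Kset phi -> Kset psi -> 0 <= u -> u <= v -> v <= T ->
  (forall t, u <= t <= v -> `|phi t - psi t| <= r) ->
  `|clock c phi u v - clock c psi u v| <= clock_lip * r * (v - u).
Proof.
move=> Kphi Kpsi u0 uv vT near; have cc : continuous c by exact: clock_rate_continuous.
apply: (clock_dist cc (path_continuous Kphi) (path_continuous Kpsi)) => // t utv.
have tT : 0 <= t <= T.
  by case/andP: utv => ut tv; rewrite (le_trans u0 ut) (le_trans tv vT).
have [_ /(_ t tT)/andP[a1 _] _] := Kphi; have [_ /(_ t tT)/andP[a2 _] _] := Kpsi.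
apply: (le_trans (clock_rate_lipschitz D_gt0 H0_gt0 a1 a2)).
by rewrite ler_wpM2l ?clock_lip_ge0 // near.
Qed.

Definition rate_lip n (l : nat -> R) : R :=
  \sum_(i < n) (2 * `|l i| + `|Lam (l i)| * clock_lip * (T / n%:R)).

Lemma rate_lip_ge0 n l : 0 <= rate_lip n l.
Proof.
apply: sumr_ge0 => i _; rewrite addr_ge0 ?mulr_ge0 ?clock_lip_ge0 ?invr_ge0 //.
exact: ltW.
Qed.

Lemma grid_rate_dist n l phi psi (r : R) : Kset phi -> Kset psi ->
  (forall t, 0 <= t <= T -> `|phi t - psi t| <= r) ->
  `|J n l phi - J n l psi| <= rate_lip n l * r.
Proof.
move=> Kphi Kpsi near; rewrite /grid_rate /rate_lip -sumrB mulr_suml.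
apply: (le_trans (ler_norm_sum _ _ _)); apply: ler_sum => i _.
have g0 := grid_ge0 T_gt0 n i; have gT := grid_leT T_gt0 (ltn_ord i).
have gg := grid_le T_gt0 n (leqnSn i).
have cn : `|clock c phi (grid T n i) (grid T n i.+1) - clock c psi (grid T n i) (grid T n i.+1)|
    <= clock_lip * r * (T / n%:R).
  rewrite -(grid_step T n i); apply: clock_near => // t /andP[ut tv].
  by apply: near; rewrite (le_trans g0 ut) (le_trans tv gT).
have n1 : `|phi (grid T n i) - psi (grid T n i)| <= r by apply: near; rewrite g0 (le_trans gg).
have n2 : `|phi (grid T n i.+1) - psi (grid T n i.+1)| <= r by apply: near; rewrite gT (le_trans g0).
set a := phi _ in n1 *; set b := phi _ in n2 *; set a' := psi _ in n1 *; set b' := psi _ in n2 *.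
set p := clock _ _ _ _ in cn *; set q := clock _ _ _ _ in cn *.
have -> : - l i * (b - a) - Lam (l i) * p - (- l i * (b' - a') - Lam (l i) * q) =
  l i * ((a - a') - (b - b')) - Lam (l i) * (p - q) by ring.
apply: (le_trans (ler_normB _ _)); rewrite !normrM mulrDl lerD //.
  rewrite mulrAC [leRHS]mulrC ler_wpM2l // (le_trans (ler_normB _ _)) //; lra.
apply: (le_trans (ler_wpM2l _ cn)) => //.
by rewrite le_eqVlt (_ : _ == _ = true) //; apply/eqP; ring.
Qed.

(* Let [l] tend to infinity. *)
Lemma increment_le (d C s : R) : 0 <= C -> (forall l, - l * d - Lam l * C <= s) -> `|d| <= 2 * M * C.
Proof.
move=> C0 H; rewrite leNgt; apply/negP; rewrite -subr_gt0; set g := _ - _ => g0.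
pose y := (`|s| + 1) / g; have y0 : 0 < y by rewrite divr_gt0 // ltr_wpDl.
pose l := - Num.sg d * y.
have nl : `|l| <= y.
  rewrite normrM normrN (gtr0_norm y0) ler_piMl ?(ltW y0) //.
  by rewrite normr_sg lern1; case: eqP.
have h1 : - l * d = y * `|d| by rewrite /l normrEsg; ring.
have h2 : Lam l * C <= 2 * M * y * C.
  apply: ler_wpM2r => //; apply: (le_trans (ler_norm _)); apply: (le_trans (LamB _)).
  by rewrite ler_wpM2l // mulr_ge0 // ltW.
have h3 : y * g = `|s| + 1 by rewrite /y divfK // gt_eqF.
have := H l; rewrite h1; have := ler_norm s; rewrite /g in h3; lra.
Qed.

Notation rate phi := (\int[lebesgue_measure]_(t in `[0%R, T]) legendre c Lam (phi t) (derive1 phi t))%E.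

(** A single cell shows that a finite rate bounds the slope: the increment over [[u, v]] is at most
    [2 M] times the clock, and the clock at most [c H1] times the length. The product [2 M c H1] is
    exactly [path_slope], so these paths lie in the compact set of the interpolated energies. *)
Lemma rate_leP phi s : path_space T H0 H1 phi ->
  (absolutely_continuous_on 0 T phi /\ phi 0 = x /\ (rate phi <= s%:E)%E) <->
  (Kset phi /\ forall n l, (0 < n)%N -> J n l phi <= s).
Proof.
have cc : continuous c by exact: clock_rate_continuous.
move=> [cphi bphi]; split=> [[ac [p0 rs]]|[[lip _ p0] Js]]; last first.
  split; first exact: lipschitz_ac lip.
  by split=> //; apply: (legendre_integral_le cc Lam0 T_gt0 lip).
have [g [ig gE dg]] := ac_ftc T_gt0 ac.
split; last first.
  move=> n l n0; rewrite -lee_fin; apply: le_trans rs.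
  exact: (grid_rate_le cc Lam0 T_gt0 cphi ig gE dg).
split=> // u v u0 uv vT.
have /andP[C0 C1] := clock_bounds cphi bphi u0 uv vT.
have cH0 : 0 <= c H0 by rewrite divr_ge0 ?sqrtr_ge0 // mulr_ge0 // ltW.
have : `|phi v - phi u| <= 2 * M * clock c phi u v.
  apply: (@increment_le _ _ s); first by rewrite (le_trans _ C0) // mulr_ge0 ?subr_ge0.
  move=> l; rewrite -lee_fin; apply: le_trans rs.
  exact: (cell_rate_le cc Lam0 T_gt0 cphi ig gE dg).
move=> /le_trans; apply.
apply: (@le_trans _ _ (2 * M * (c H1 * (v - u)))); first by rewrite ler_wpM2l // mulr_ge0 // ltW.
rewrite mulrA ler_wpM2r ?subr_ge0 // /clock_rate /path_slope.
by rewrite le_eqVlt (_ : _ == _ = true) //; apply/eqP; field; rewrite gt_eqF.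
Qed.

(** Each [J n l] is continuous on Lipschitz paths, so the bounds survive uniform limits. *)
Lemma rate_level_compact s : compact ([set phi | Kset phi /\
  forall n l, (0 < n)%N -> J n l phi <= s] : set {uniform` `[0, T] -> R}).
Proof.
apply: (lipschitz_paths_compact T_gt0 (K := K) (H0 := H0) (H1 := H1) (x := x)).
  by move=> phi [].
move=> g Kg near; split=> // n l n0; apply/ler_addgt0Pr => e e0.
have L0 : 0 < rate_lip n l + 1 by rewrite ltr_wpDl ?rate_lip_ge0.
have [psi [Kpsi Jpsi] gpsi] := near (e / (rate_lip n l + 1)) (divr_gt0 e0 L0).
have h : rate_lip n l * (e / (rate_lip n l + 1)) <= e.
  by rewrite mulrCA ger_pMr // ler_pdivrMr // mul1r lerDl.
have H : `|J n l g - J n l psi| <= rate_lip n l * (e / (rate_lip n l + 1)).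
  by apply: grid_rate_dist => // t tT; rewrite distrC ltW // gpsi.
by move: H; rewrite ler_norml => /andP[_]; have := Jpsi n l n0; lra.
Qed.

Hypotheses
  (maxi : forall a S, (forall l, l * a - Lam l <= S) ->
     exists l0, forall l, l * a - Lam l <= l0 * a - Lam l0)
  (tang : forall l, exists a, forall h, `|h| * (2 * M) <= 2^-1 ->
     Lam (l + h) - Lam l <= h * a + 2 * (2 * M) ^+ 2 * h ^+ 2).

Lemma small_parameter (p q : R) : 0 <= p -> 0 <= q ->
  exists t : R, [/\ 0 < t, t * p <= 2^-1 & t * q <= 2^-1].
Proof.
move=> p0 q0; have s0 : 0 < p + q + 1 by rewrite ltr_wpDl ?addr_ge0.
exists (2^-1 / (p + q + 1)); split; first by rewrite divr_gt0.
  by rewrite mulrAC ler_pdivrMr // ler_pM2l //; lra.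
by rewrite mulrAC ler_pdivrMr // ler_pM2l //; lra.
Qed.

(** The slope [a'] of the quadratic bound at a maximizer must be [a]: otherwise shifting [l0] by
    [t * g], with [g = a - a'], would gain [t * g ^+ 2] and lose at most a quarter of it. *)
Lemma maximizer_tangent (a l0 h : R) : (forall l, l * a - Lam l <= l0 * a - Lam l0) ->
  `|h| * (2 * M) <= 2^-1 -> Lam (l0 + h) - Lam l0 <= h * a + 2 * (2 * M) ^+ 2 * h ^+ 2.
Proof.
move=> max hM; have [a' Ha'] := tang l0; suff -> : a = a' by exact: Ha'.
apply/eqP; rewrite -subr_eq0; apply/negPn/negP => g0; set g := a - a' in g0.
have [t [t0 t1 t2]] := @small_parameter (`|g| * (2 * M)) (4 * (2 * M) ^+ 2)
  (mulr_ge0 (normr_ge0 _) (mulr_ge0 (ler0n _ 2) (ltW M_gt0)))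
  (mulr_ge0 (ler0n _ 4) (sqr_ge0 _)).
rewrite mulrA in t1; have := Ha' (t * g); rewrite normrM (gtr0_norm t0) => /(_ t1).
have := max (l0 + t * g); rewrite mulrDl => h1 h2.
have gg : 0 < g ^+ 2 by rewrite exprn_even_gt0.
have h3 : t * g * g <= 2 * (2 * M) ^+ 2 * (t * g) ^+ 2 by rewrite {2}/g; lra.
have h4 : 2 * (2 * M) ^+ 2 * (t * g) ^+ 2 = (t * (4 * (2 * M) ^+ 2)) * 2^-1 * (t * g ^+ 2) by field.
have h5 : t * g * g = t * g ^+ 2 by ring.
have tg : 0 < t * g ^+ 2 by rewrite mulr_gt0.
have : (t * (4 * (2 * M) ^+ 2)) * 2^-1 * (t * g ^+ 2) <= 2^-1 * 2^-1 * (t * g ^+ 2).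
  by rewrite ler_wpM2r ?(ltW tg) // ler_wpM2r.
lra.
Qed.

(** To first order a shift of [l0] by [h] changes the cell by [- h (d + a C)], so a small shift
    against the sign of [g] is an improvement. *)
Lemma improve_cell (a l0 d C : R) : (forall l, l * a - Lam l <= l0 * a - Lam l0) -> 0 <= C ->
  d != - (a * C) -> exists l', - l0 * d - Lam l0 * C < - l' * d - Lam l' * C.
Proof.
move=> max C0; rewrite -subr_eq0 opprK; set g := d + a * C => g0.
have [t [t0 t1 t2]] := @small_parameter (`|g| * (2 * M)) (4 * (2 * M) ^+ 2 * C)
  (mulr_ge0 (normr_ge0 _) (mulr_ge0 (ler0n _ 2) (ltW M_gt0)))
  (mulr_ge0 (mulr_ge0 (ler0n _ 4) (sqr_ge0 _)) C0).
rewrite mulrA in t1; have := @maximizer_tangent a l0 (- (t * g)) max.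
rewrite normrN normrM (gtr0_norm t0) sqrrN => /(_ t1) h1.
exists (l0 + - (t * g)).
have h2 : (Lam (l0 + - (t * g)) - Lam l0) * C <= (- (t * g) * a + 2 * (2 * M) ^+ 2 * (t * g) ^+ 2) * C.
  exact: ler_wpM2r.
have gg : 0 < g ^+ 2 by rewrite exprn_even_gt0.
have tg : 0 < t * g ^+ 2 by rewrite mulr_gt0.
have h3 : 2 * (2 * M) ^+ 2 * (t * g) ^+ 2 * C = (t * (4 * (2 * M) ^+ 2 * C)) * 2^-1 * (t * g ^+ 2) by field.
have h4 : (t * (4 * (2 * M) ^+ 2 * C)) * 2^-1 * (t * g ^+ 2) <= 2^-1 * 2^-1 * (t * g ^+ 2).
  by rewrite ler_wpM2r ?(ltW tg) // ler_wpM2r.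
have h5 : (t * g) * d + (t * g) * a * C = t * g ^+ 2 by rewrite /g; ring.
have h6 : (- (t * g) * a + 2 * (2 * M) ^+ 2 * (t * g) ^+ 2) * C =
  - ((t * g) * a * C) + 2 * (2 * M) ^+ 2 * (t * g) ^+ 2 * C by ring.
have h7 : - (l0 + - (t * g)) * d = - l0 * d + (t * g) * d by ring.
have h8 : (Lam (l0 + - (t * g)) - Lam l0) * C = Lam (l0 + - (t * g)) * C - Lam l0 * C by ring.
lra.
Qed.

Lemma grid_rate_update n l i (l' : R) psi : (i < n)%N ->
  J n (fun j => if j == i then l' else l j) psi - J n l psi =
  (- l' * (psi (grid T n i.+1) - psi (grid T n i)) - Lam l' * clock c psi (grid T n i) (grid T n i.+1)) -
  (- l i * (psi (grid T n i.+1) - psi (grid T n i)) - Lam (l i) * clock c psi (grid T n i) (grid T n i.+1)).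
Proof.
move=> ni; rewrite /grid_rate -sumrB (bigD1 (Ordinal ni)) //= eqxx big1 ?addr0 // => j ji.
by rewrite -val_eqE /= in ji; rewrite (negbTE ji) subrr.
Qed.

Lemma grid_rate0 n psi : J n (fun=> 0) psi = 0.
Proof. by rewrite /grid_rate big1 // => i _; rewrite Lam0 oppr0 !mul0r subrr. Qed.

(* If no change of a single [l i] increases the rate of [psi], then [psi] has the
   increments [- a i * C psi i], which are those of an Euler scheme for [phi]. *)
Lemma select_control phi S delta nu : Kset phi -> (forall n l, (0 < n)%N -> J n l phi <= S) ->
  0 < delta -> 0 < nu -> exists n l, (0 < n)%N /\ forall psi, Kset psi ->
    (exists l', J n l psi < J n l' psi) \/
    (close_to T phi delta psi /\ J n l psi <= S + nu).
Proof.
move=> Kphi JS delta0 nu0; have [lipphi bphi phi0] := Kphi.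
have cphi := path_continuous Kphi.
have S0 : 0 <= S by rewrite -(grid_rate0 1 phi) JS.
have cm0 : 0 < c H0 by rewrite divr_gt0 ?sqrtr_gt0 ?mulr_gt0.
have Lc0 := clock_lip_ge0; have K0 := path_slope_ge0.
have M0 := ltW M_gt0; have T0 := ltW T_gt0.
(* Gronwall constants: a step of the Euler scheme multiplies the distance at grid points by at most
   [1 + A / n] and adds at most [E / n^2]; the oscillation within a cell contributes [2 K T / n]. *)
pose A := 2 * M * clock_lip * T; pose E := 4 * M * clock_lip * K * T ^+ 2.
pose c2 := E * expR A + 2 * K * T.
have A0 : 0 <= A by rewrite !mulr_ge0.
have E0 : 0 <= E by rewrite mulr_ge0 ?exprn_ge0 // mulr_ge0 // mulr_ge0 // mulr_ge0.
have c20 : 0 <= c2.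
  by apply: addr_ge0; [rewrite mulr_ge0 ?expR_ge0|rewrite mulr_ge0 // mulr_ge0].
(* The two summands ensure [c2 / n < delta] and [S * th <= nu], with [th] the relative clock error
   introduced below. *)
pose n := (Num.truncn (c2 / delta + S * clock_lip * c2 / c H0 / nu)).+1.
have n0 : 0 < n%:R :> R by rewrite ltr0n.
have nbig : c2 / delta + S * clock_lip * c2 / c H0 / nu < n%:R by exact: truncnS_gt.
have p1 : 0 <= c2 / delta by rewrite divr_ge0 // ltW.
have p2 : 0 <= S * clock_lip * c2 / c H0 / nu by rewrite !divr_ge0 ?mulr_ge0 // ltW.
have n1 : c2 / n%:R < delta.
  by rewrite ltr_pdivrMr // mulrC -ltr_pdivrMr // (le_lt_trans _ nbig) // lerDl.
have n2 : S * (clock_lip * (c2 / n%:R) / c H0) <= nu.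
  have -> : S * (clock_lip * (c2 / n%:R) / c H0) = (S * clock_lip * c2 / c H0) / n%:R by ring.
  by rewrite ler_pdivrMr // [nu * _]mulrC -ler_pdivrMr // (le_trans _ (ltW nbig)) // lerDr.
pose t i := grid T n i; pose C psi i := clock c psi (t i) (t i.+1).
pose dl (psi : R -> R) i := psi (t i.+1) - psi (t i).
have t_ge0 i : 0 <= t i by exact: grid_ge0.
have t_le i : t i <= t i.+1 by exact: grid_le.
have t_leT i : (i < n)%N -> t i.+1 <= T by exact: grid_leT.
have t_step i : t i.+1 - t i = T / n%:R by exact: grid_step.
have Tn0 : 0 < T / n%:R by rewrite divr_gt0.
have Cge psi i : Kset psi -> (i < n)%N -> c H0 * (T / n%:R) <= C psi i.
  move=> Kpsi ni; have [_ bpsi _] := Kpsi; rewrite -(t_step i).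
  by have /andP[] := clock_bounds (path_continuous Kpsi) bpsi (t_ge0 i) (t_le i) (t_leT i ni).
have Cgt0 psi i : Kset psi -> (i < n)%N -> 0 < C psi i.
  by move=> Kpsi ni; apply: lt_le_trans (Cge psi i Kpsi ni); rewrite mulr_gt0.
have cell i l : (i < n)%N -> - l * dl phi i - Lam l * C phi i <= S.
  move=> ni; have := JS n (fun j => if j == i then l else 0) (ltn0Sn _).
  have := grid_rate_update (fun=> 0) l phi ni.
  rewrite grid_rate0 subr0 Lam0 oppr0 !mul0r subr0 subr0 => ->; exact.
pose a i := - dl phi i / C phi i.
have aC i : (i < n)%N -> a i * C phi i = - dl phi i.
  by move=> ni; rewrite /a divfK // gt_eqF // Cgt0.
have aM i : (i < n)%N -> `|a i| <= 2 * M.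
  move=> ni; have C0 := Cgt0 phi i Kphi ni.
  have := @increment_le (dl phi i) (C phi i) S (ltW C0) (fun l => cell i l ni).
  by rewrite /a normrM normrN normfV (gtr0_norm C0) ler_pdivrMr.
have /choice[l lmax] : forall i, exists l0, (i < n)%N ->
    forall l, l * a i - Lam l <= l0 * a i - Lam l0.
  move=> i; have [ni|] := ltnP i n; last by exists 0.
  have C0 := Cgt0 phi i Kphi ni.
  (* The rate bound on the single cell [i], divided by its clock, bounds the objective from
     above. *)
  have [|l0 Hl0] := @maxi (a i) (S / C phi i); last by exists l0.
  move=> l; rewrite ler_pdivlMr // mulrBl -mulrA aC //.
  by have := cell i l ni; lra.
exists n, l; split=> // psi Kpsi; have [lippsi bpsi psi0] := Kpsi.
have disj : (forall i, (i < n)%N -> dl psi i = - (a i * C psi i)) \/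
    exists i, (i < n)%N /\ dl psi i != - (a i * C psi i).
  have [H|H] := pselect (forall i, (i < n)%N -> dl psi i = - (a i * C psi i)); first by left.
  by right; move/existsNP: H => [i /not_implyP[ni /eqP H]]; exists i.
case: disj => [good|[i [ni bad]]]; last first.
  left; have [l' Hl'] := improve_cell (lmax i ni) (ltW (Cgt0 psi i Kpsi ni)) bad.
  exists (fun j => if j == i then l' else l j).
  by have := grid_rate_update l l' psi ni; rewrite -/(dl psi i) -/(C psi i); lra.
right; pose d i := psi (t i) - phi (t i).
have inT i s : (i < n)%N -> t i <= s <= t i.+1 -> 0 <= s <= T.
  by move=> ni /andP[h1 h2]; rewrite (le_trans (t_ge0 i) h1) (le_trans h2 (t_leT i ni)).
have nearcell i s : (i <= n)%N -> t i <= s -> s <= T -> s - t i <= T / n%:R ->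
    `|psi s - phi s| <= `|d i| + 2 * K * (T / n%:R).
  move=> ni h1 h2 h3.
  have q1 := lippsi _ _ (t_ge0 i) h1 h2; have q2 := lipphi _ _ (t_ge0 i) h1 h2.
  have q3 : K * (s - t i) <= K * (T / n%:R) by rewrite ler_wpM2l.
  have -> : psi s - phi s = d i + ((psi s - psi (t i)) - (phi s - phi (t i))) by rewrite /d; ring.
  apply: (le_trans (ler_normD _ _)); rewrite lerD2l.
  by apply: (le_trans (ler_normB _ _)); lra.
pose q := 1 + A / n%:R.
have q1 : 1 <= q by rewrite lerDl divr_ge0 // ltW.
have dbound i : (i <= n)%N -> `|d i| <= i%:R * (E / n%:R ^+ 2) * q ^+ i.
  elim: i => [_|i IH ni].
    by rewrite /d /t grid0 phi0 psi0 subrr normr0 !mul0r.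
  have {}IH := IH (ltnW ni).
  have Cn : `|C psi i - C phi i| <= clock_lip * (`|d i| + 2 * K * (T / n%:R)) * (T / n%:R).
    rewrite -[X in _ <= _ * X](t_step i); apply: clock_near => //; first exact: t_leT.
    move=> s /andP[h1 h2]; have /andP[_ sT] := inT i s ni (introT andP (conj h1 h2)).
    by apply: nearcell => //; [exact: ltnW|rewrite -(t_step i) lerD2r].
  have dE : d i.+1 = d i - a i * (C psi i - C phi i).
    by have := good i ni; have := aC i ni; rewrite /d /dl mulrBr; lra.
  have aCn : `|a i * (C psi i - C phi i)| <=
      2 * M * (clock_lip * (`|d i| + 2 * K * (T / n%:R)) * (T / n%:R)).
    by rewrite normrM ler_pM // aM.
  have dstep : `|d i.+1| <= `|d i| * q + E / n%:R ^+ 2.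
    rewrite dE; apply: (le_trans (ler_normB _ _)).
    have -> : `|d i| * q + E / n%:R ^+ 2 =
       `|d i| + 2 * M * (clock_lip * (`|d i| + 2 * K * (T / n%:R)) * (T / n%:R)).
      by rewrite /q /E /A; field; rewrite gt_eqF.
    by rewrite lerD2l.
  apply: (le_trans dstep).
  apply: (@le_trans _ _ (i%:R * (E / n%:R ^+ 2) * q ^+ i * q + E / n%:R ^+ 2 * q ^+ i.+1)).
    apply: lerD; first by rewrite ler_wpM2r // (le_trans _ q1).
    by rewrite ler_peMr ?exprn_ege1 // divr_ge0 ?sqr_ge0.
  rewrite -[i.+1%:R]natr1 [q ^+ i.+1]exprSr; move: (E / _) (q ^+ i) => y z.
  by rewrite le_eqVlt (_ : _ == _ = true) //; apply/eqP; ring.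
have qn : q ^+ n <= expR A.
  have -> : expR A = expR (A / n%:R) ^+ n by rewrite -expRM_natl mulrC divfK // gt_eqF.
  by rewrite lerXn2r ?nnegrE ?expR_ge0 ?expR_ge1Dx // (le_trans _ q1).
have dsmall i : (i <= n)%N -> `|d i| <= E * expR A / n%:R.
  move=> ni; apply: (le_trans (dbound i ni)).
  have -> : E * expR A / n%:R = n%:R * (E / n%:R ^+ 2) * expR A by field; rewrite gt_eqF.
  have e0 : 0 <= E / n%:R ^+ 2 by rewrite divr_ge0 ?sqr_ge0.
  apply: ler_pM; first by rewrite mulr_ge0.
  - by rewrite exprn_ge0 // (le_trans _ q1).
  - by rewrite ler_wpM2r // ler_nat.
  - by apply: le_trans qn; rewrite ler_weXn2l.
have close s : 0 <= s <= T -> `|psi s - phi s| <= c2 / n%:R.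
  move=> sT; have [i ni /andP[h1 h2]] := grid_index T_gt0 (ltn0Sn _ : (0 < n)%N) sT.
  have /andP[_ sT'] := sT.
  apply: (le_trans (nearcell i s ni h1 sT' _)); first by rewrite lerBlDl.
  have -> : c2 / n%:R = E * expR A / n%:R + 2 * K * (T / n%:R) by rewrite /c2; ring.
  by rewrite lerD2r dsmall.
split; first by move=> s sT; rewrite (le_lt_trans (close s sT)).
(* Per unit clock, cell [i] of either path has the rate [l i * a i - Lam (l i)], nonnegative by
   comparison with the multiplier 0. Hence the two rates compare like the clocks, whose ratio is at
   most [1 + th]. *)
pose th := clock_lip * (c2 / n%:R) / c H0.
have th0 : 0 <= th by rewrite divr_ge0 ?(ltW cm0) // mulr_ge0 // divr_ge0.
have : J n l psi <= (1 + th) * J n l phi.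
  rewrite /grid_rate mulr_sumr; apply: ler_sum => i _; have ni := ltn_ord i.
  rewrite -/(t i) -/(t i.+1) -/(C psi i) -/(C phi i) -/(dl psi i) -/(dl phi i).
  have -> : dl phi i = - (a i * C phi i) by rewrite aC // opprK.
  rewrite (good i ni).
  have -> : - l i * - (a i * C psi i) - Lam (l i) * C psi i = (l i * a i - Lam (l i)) * C psi i by ring.
  have -> : (1 + th) * (- l i * - (a i * C phi i) - Lam (l i) * C phi i) =
     (l i * a i - Lam (l i)) * ((1 + th) * C phi i) by ring.
  rewrite ler_wpM2l //.
    by have := lmax i ni 0; rewrite mul0r Lam0 subrr.
  have h1 : `|C psi i - C phi i| <= clock_lip * (c2 / n%:R) * (T / n%:R).
    by rewrite -[X in _ <= _ * X](t_step i); apply: clock_near => //; [exact: t_leT|move=> s /(inT i s ni); exact: close].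
  have h2 : clock_lip * (c2 / n%:R) * (T / n%:R) <= th * C phi i.
    have -> : clock_lip * (c2 / n%:R) * (T / n%:R) = th * (c H0 * (T / n%:R)).
      by rewrite /th; field; rewrite !gt_eqF.
    by rewrite ler_wpM2l // Cge.
  by move: h1; rewrite ler_norml [(1 + th) * _]mulrDl mul1r => /andP[_ h1]; rewrite -lerBlDl (le_trans h1).
move=> /le_trans; apply; have Jphi := JS n l (ltn0Sn _).
apply: (@le_trans _ _ ((1 + th) * S)); first by rewrite ler_wpM2l // addr_ge0.
by rewrite mulrDl mul1r lerD2l mulrC.
Qed.

End RateOfPaths.

(** * The two bounds *)

Lemma sum_exp_small (R : realType) (N : nat) (g C : nat -> R) (e : R) : 0 < e ->
  (forall j, (j < N)%N -> 0 < g j) -> exists2 eps0 : R, 0 < eps0 &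
  forall eps, 0 < eps <= eps0 -> \sum_(j < N) expR (C j - eps^-1 * g j) <= e.
Proof.
elim: N e => [|N IH] e e0 g0.
  by exists 1 => // eps _; rewrite big_ord0 ltW.
have [|j jN|eps1 e1 H1] := IH (e / 2); [by rewrite divr_gt0|exact: g0 (ltnW _)|].
pose a := `|C N - ln (e / 2)| + 1; have a0 : 0 < a by rewrite ltr_wpDl.
have gN : 0 < g N by exact: g0.
exists (Num.min eps1 (g N / a)); first by rewrite lt_min e1 divr_gt0.
move=> eps /andP[eps0]; rewrite le_min => /andP[ee1 eea].
rewrite big_ord_recr /= [leRHS](splitr e) lerD //; first by apply: H1; rewrite eps0.
rewrite -[e / 2]lnK ?posrE ?divr_gt0 // ler_expR lerBlDr -lerBlDl.
have h : a <= eps^-1 * g N.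
  by rewrite mulrC ler_pdivlMr // mulrC -ler_pdivlMr.
by apply: le_trans h; rewrite /a (le_trans (ler_norm _)) // lerDl.
Qed.

(** * Estimates of probabilities by variables of mean 1 *)

Section TiltIntegral.
Context d (Omega : measurableType d) (R : realType) (P : probability Omega R).
Variables (N : nat) (W : nat -> Omega -> R) (b : nat -> R).
Hypotheses (mW : forall j, measurable_fun setT (W j)) (W0 : forall j w, 0 <= W j w)
  (W1 : forall j, (\int[P]_w (W j w)%:E = 1)%E) (b0 : forall j, 0 <= b j).

Lemma measurable_tilt_comb : measurable_fun setT (fun w => \sum_(j < N) b j * W j w).
Proof. by apply: measurable_sum => j; apply: measurable_funM. Qed.

Lemma integral_tilt_comb :
  (\int[P]_w (\sum_(j < N) b j * W j w)%:E = (\sum_(j < N) b j)%:E)%E.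
Proof.
elim: N => [|n IH].
  by under eq_integral do rewrite big_ord0; rewrite integral0 big_ord0.
under eq_integral do rewrite big_ord_recr EFinD /=.
rewrite ge0_integralD //=.
- rewrite IH big_ord_recr EFinD /=; congr (_ + _)%E.
  under eq_integral do rewrite EFinM.
  rewrite ge0_integralZl_EFin //.
  + by rewrite W1 mule1.
  + by move=> w _; rewrite lee_fin.
  + by apply/measurable_EFinP; exact: mW.
- by move=> w _; rewrite lee_fin sumr_ge0 // => j _; rewrite mulr_ge0.
- apply/measurable_EFinP; apply: measurable_sum => j; apply: measurable_funM => //.
- by move=> w _; rewrite lee_fin mulr_ge0.
- by apply/measurable_EFinP; apply: measurable_funM.
Qed.

Lemma prob_le_tilt (A : set Omega) : measurable A ->
  {ae P, forall w, A w -> 1 <= \sum_(j < N) b j * W j w} ->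
  (P A <= (\sum_(j < N) b j)%:E)%E.
Proof.
move=> mA AW; rewrite -[A in P A]setIT -integral_indic // -integral_tilt_comb.
apply: ae_ge0_le_integral => //.
- by apply/measurable_EFinP; exact: measurable_indic.
- by move=> w _; rewrite lee_fin sumr_ge0 // => j _; rewrite mulr_ge0.
- by apply/measurable_EFinP; exact: measurable_tilt_comb.
have aeF := ae_filter_ringOfSetsType P; apply: filterS AW => w Aw _.
rewrite lee_fin indicE; case: (boolP (w \in A)) => [|_]; first by rewrite inE => /Aw.
by rewrite sumr_ge0 // => j _; rewrite mulr_ge0.
Qed.

(** Integrate the pointwise bound: the mean 1 of [V] must come from [A] unless the other tilts carry
    it. *)
Lemma prob_ge_tilt (A : set Omega) (V : Omega -> R) (B : R) : measurable A -> 0 <= B ->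
  measurable_fun setT V -> (forall w, 0 <= V w) -> (\int[P]_w (V w)%:E = 1)%E ->
  {ae P, forall w, V w <= B * \1_A w + \sum_(j < N) b j * W j w} ->
  1 <= B * fine (P A) + \sum_(j < N) b j.
Proof.
move=> mA B0 mV V0 V1 VW.
rewrite -lee_fin -V1 EFinD EFinM fineK ?fin_num_measure // -integral_tilt_comb.
rewrite -[A in P A]setIT -integral_indic //.
have mI : measurable_fun setT (fun w => (\1_A w)%:E : \bar R).
  by apply/measurable_EFinP; exact: measurable_indic.
rewrite -ge0_integralZl_EFin //.
have s0 w : 0 <= \sum_(j < N) b j * W j w.
  by rewrite sumr_ge0 // => j _; rewrite mulr_ge0.
rewrite -ge0_integralD //=.
- apply: ae_ge0_le_integral => //.
  + by move=> w _; rewrite lee_fin.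
  + by apply/measurable_EFinP.
  + by move=> w _; rewrite adde_ge0 // ?mule_ge0 // lee_fin.
  + apply: emeasurable_funD; last by apply/measurable_EFinP; exact: measurable_tilt_comb.
    by apply: measurable_funeM.
  have aeF := ae_filter_ringOfSetsType P; apply: filterS VW => w h _.
  by rewrite -EFinM -EFinD lee_fin.
- by move=> w _; rewrite mule_ge0 // lee_fin.
- by apply: measurable_funeM.
- by move=> w _; rewrite lee_fin.
- by apply/measurable_EFinP; exact: measurable_tilt_comb.
Qed.

End TiltIntegral.

(** * The upper and lower bounds for the one-well system *)

Section LargeDeviations.
Context (R : realType) d (Omega : measurableType d) (P : probability Omega R).
Variables (D q0 x T M H0 H1 eps1 : R) (xi eta : nat -> {RV P >-> R}).
Hypotheses (D_gt0 : 0 < D) (q0_bnd : 0 <= q0 < D) (T_gt0 : 0 < T)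
  (indep : independent_family
     (fun i : nat + nat => match i with inl k => xi k | inr k => eta k end))
  (xi_id : identically_distributed xi) (eta_id : identically_distributed eta)
  (eta_dens : forall k, has_continuous_density (eta k)) (M_gt0 : 0 < M)
  (xi_bnd : forall k, P [set w | `|xi k w| <= M] = 1%E)
  (eta_bnd : forall k, P [set w | `|eta k w| <= M] = 1%E)
  (H0_gt0 : 0 < H0) (eps1_gt0 : 0 < eps1)
  (H_bnd : forall eps : R, 0 < eps <= eps1 ->
     {ae P, forall w, forall t : R, 0 <= t <= T ->
        H0 <= energy_path D q0 x eps (xi ^~ w) (eta ^~ w) t <= H1}).
Let Lam := cumulant P (period_loss xi eta).
Notation c := (clock_rate D).
Notation K := (path_slope D M H1).
Notation Kset := (lipschitz_paths T K H0 H1 x).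
Notation J := (grid_rate c Lam T).
Let Hhat (eps : R) (w : Omega) : R -> R :=
  interpolated_path D q0 x eps (xi ^~ w) (eta ^~ w).
Let q0_ltD : q0 < D. Proof. by case/andP: q0_bnd. Qed.
Let mL := @measurable_losses _ _ _ P xi eta.
Let bL := @losses_bnd _ _ _ P xi eta M xi_bnd eta_bnd.
Let mZ := measurable_period_loss xi eta.
Let bZ := period_loss_bnd xi_bnd eta_bnd.

Let Lam0 : Lam 0 = 0.
Proof. exact: cumulant0 mZ bZ. Qed.

Let LamB l : `|Lam l| <= 2 * M * `|l|.
Proof. by have := cumulant_lipschitz mZ bZ 0 l; rewrite -/Lam -/(Lam 0) -/(Lam l) Lam0 !subr0. Qed.

(** Collision [2k+1] involves only losses of index below [2k], so [measurable_collision] applies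
    with the past sigma-algebra on the sample space. *)
Lemma measurable_control eps n l k :
  measurable_fun (setT : set (past_type (losses xi eta) k.*2))
    (fun w => control T D q0 x eps (xi ^~ w) (eta ^~ w) n l k).
Proof.
have ms := @measurable_collision _ (past_type (losses xi eta) k.*2) R D q0 x eps
  (fun j w => xi j w) (fun j w => eta j w) k.*2.+1 (fun j jk => past_X (X := losses xi eta) jk).
apply: measurable_sum => i; apply: measurable_funM; first exact: measurable_cst.
pose E := [set w | ((grid T n i)%:E < collision D q0 x eps (xi ^~ w) (eta ^~ w) k.*2.+1
  <= (grid T n i.+1)%:E)%E].
have mE : measurable (E : set (past_type (losses xi eta) k.*2)).
  have := measurableI _ _ (emeasurable_fun_o_infty measurableT ms (grid T n i)%:E)
    (emeasurable_fun_infty_c measurableT ms (grid T n i.+1)%:E).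
  rewrite !setTI; congr measurable.
  by apply/seteqP; split => w /=; [move=> [h1 h2]; rewrite /E /= h1|move=> /andP[]].
rewrite (_ : (fun w => _) = \1_E); first exact: measurable_indic.
by apply/funext => w; rewrite indicE /=; congr (nat_of_bool _)%:R; apply/idP/idP; rewrite inE.
Qed.

(** The bound of [grid_rate_tilt]. It does not involve [eps], so finitely many such errors are
    negligible on the scale [eps^-1]. *)
Definition tilt_error n (l : nat -> R) : R :=
  \sum_(i < n) (`|l i| * (4 * M) + `|Lam (l i)| * (2 * clock_slack T D M H0 + 1)).

Lemma tilt_family eps n l : 0 < eps <= eps1 -> (0 < n)%N ->
  exists W : Omega -> R, [/\ measurable_fun setT W, forall w, 0 <= W w,
    (\int[P]_w (W w)%:E = 1)%E & {ae P, forall w, Kset (Hhat eps w) /\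
      expR (eps^-1 * J n l (Hhat eps w) - tilt_error n l) <= W w <=
      expR (eps^-1 * J n l (Hhat eps w) + tilt_error n l)}].
Proof.
move=> epsb n0; have /andP[eps_gt0 _] := epsb.
pose gap : R := eps * D / Num.sqrt (2 * H1).
(* Enough periods to pass time [T], as collisions after the first are at least [gap] apart. *)
pose N := (Num.truncn ((T / gap + 1) / 2)).+1.
pose lam k w := control T D q0 x eps (xi ^~ w) (eta ^~ w) n l k.
have indL := losses_independent indep.
have ml k : measurable_fun (setT : set (past_type (losses xi eta) k.*2)) (lam k).
  exact: measurable_control.
have W1 := tilt_expectation mL indL bL ml N.
have mlog : measurable_fun setT (log_tilt P (losses xi eta) lam N).
  have h := @past_log_tilt _ _ _ P _ M mL bL _ ml N.
  exact: (past_measurable_fun mL h).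
exists (fun w => expR (log_tilt P (losses xi eta) lam N w)); split => //; first exact: measurableT_comp.
have aeF := ae_filter_ringOfSetsType P.
apply: filterS2 (H_bnd epsb) (ae_foralln bL) => w Eb Lb.
split.
  split.
  - exact: (interpolated_lipschitz T_gt0 D_gt0 q0_bnd eps_gt0 H0_gt0 Lb Eb).
  - exact: (interpolated_bnd T_gt0 D_gt0 q0_bnd eps_gt0 H0_gt0 Eb).
  - by have [_ _] := path0 x (xi ^~ w) (eta ^~ w) D_gt0 q0_ltD eps_gt0.
have H1_gt0' := H1_gt0 T_gt0 D_gt0 q0_bnd eps_gt0 H0_gt0 Eb.
have gap0 : 0 < gap by rewrite divr_gt0 ?sqrtr_gt0 ?mulr_gt0.
have TN : T < (N.*2%:R - 1) * gap.
  rewrite -ltr_pdivrMr // ltrBrDr -muln2 natrM -ltr_pdivrMr //; exact: truncnS_gt.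
have := grid_rate_tilt T_gt0 D_gt0 q0_bnd eps_gt0 H0_gt0 Lb Eb l Lam0 n0 TN.
rewrite /= -/(tilt_error n l).
rewrite (_ : \sum_(k < N) _ = log_tilt P (losses xi eta) lam N w); last first.
  apply: eq_bigr => k _; rewrite -/(lam k w); congr (_ - _).
  rewrite /Lam (cumulant_period indep xi_bnd eta_bnd).
  by rewrite (cumulant_even eta xi_id) (cumulant_odd xi eta_id).
rewrite ler_norml => /andP[h1 h2]; rewrite !ler_expR.
by apply/andP; split; [rewrite lerBlDr -lerBlDl; lra|rewrite -lerBlDl].
Qed.

Let Sact := action D (xi 0%N) (eta 0%N) T x.
Let Phi := level_set D (xi 0%N) (eta 0%N) T x H0 H1.
Let level s := [set phi | Kset phi /\ forall n l, (0 < n)%N -> J n l phi <= s].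

Lemma actionE phi : absolutely_continuous_on 0 T phi -> phi 0 = x ->
  Sact phi = (\int[lebesgue_measure]_(t in `[0%R, T]) legendre c Lam (phi t) (derive1 phi t))%E.
Proof. by move=> ac p0; rewrite /Sact /action asboolT. Qed.

Lemma level_setE s : Phi s = level s.
Proof.
apply/seteqP; split => phi.
  move=> [pphi]; rewrite /action; case: asboolP => [[ac p0] rs|_]; last by rewrite leye_eq.
  by apply/(rate_leP x T_gt0 D_gt0 M_gt0 Lam0 LamB s pphi).
move=> [Kphi Js]; have [lip bphi p0] := Kphi.
have pphi : path_space T H0 H1 phi by split=> //; exact: path_continuous Kphi.
split=> //; have [|ac [_ rs]] := (rate_leP x T_gt0 D_gt0 M_gt0 Lam0 LamB s pphi).2 _; first by [].
by rewrite -/(Sact phi) actionE.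
Qed.

Lemma action_ge0 phi : (0 <= Sact phi)%E.
Proof.
rewrite /Sact /action; case: ifP => // _; apply: integral_ge0 => t _.
exact: legendre_ge0 Lam0 _ _.
Qed.

Lemma paths_compact : compact (Kset : set {uniform` `[0, T] -> R}).
Proof. by apply: (lipschitz_paths_compact T_gt0 (K := K) (H0 := H0) (H1 := H1) (x := x)) => // g Kg _. Qed.

Lemma close_rho phi psi e : close_to T phi e psi -> (rho T psi phi <= e%:E)%E.
Proof. by move=> h; apply/rho_le => t tT; rewrite ltW // h. Qed.

Let mH eps : 0 < eps -> forall t, measurable_fun setT (Hhat eps ^~ t).
Proof.
by move=> e0; exact: (@measurable_interpolated _ Omega R D q0 x eps
  (fun j w => xi j w) (fun j w => eta j w) D_gt0 q0_ltD e0 mL).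
Qed.

Let rH eps : 0 < eps -> forall w t, 0 <= t -> Hhat eps w u @[u --> t^'+] --> Hhat eps w t.
Proof.
by move=> e0 w t t0; exact: (@interpolated_right_continuous _ Omega R D q0 x eps
  (fun j w => xi j w) (fun j w => eta j w) D_gt0 q0_ltD e0 w t t0).
Qed.

Lemma measurable_far eps delta s : 0 < eps ->
  measurable [set w | (delta%:E <= rho_set T (Hhat eps w) (Phi s))%E].
Proof.
(* An empty level set is at distance [+oo], so the event is the whole space. *)
move=> e0; have [->|/set0P[psi0 Phi0]] := eqVneq (Phi s) set0.
  rewrite (_ : [set w | _] = setT) //; apply/seteqP; split => // w _ /=.
  by rewrite /rho_set image_set0 ereal_inf0 leey.
have cPhi : compact (Phi s : set {uniform` `[0, T] -> R}).
  by rewrite level_setE; exact: rate_level_compact.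
have [b [bPhi bdense]] := compact_dense_seq cPhi Phi0.
apply: (measurable_rho_set (b := b) T_gt0 (mH e0) (rH e0)) => //.
  by move=> k; have [[]] := bPhi k.
move=> psi e Ppsi e_gt0; have [|k bk] := bdense psi (e / 2) Ppsi; first by rewrite divr_gt0.
exists k; rewrite rhoC; apply: (le_lt_trans (close_rho bk)).
by rewrite lte_fin ltr_pdivrMr // ltr_pMr // ltr1n.
Qed.

Lemma upper_bound delta nu s : 0 < delta -> 0 < nu ->
  exists2 eps0 : R, 0 < eps0 & forall eps : R, 0 < eps <= eps0 ->
    (P [set w | delta%:E <= rho_set T (Hhat eps w) (Phi s)] <=
     expeR (- ((eps^-1)%:E * (s - nu)%:E)))%E.
Proof.
move=> delta0 nu0.
(* Each path gets a radius, a grid and multipliers such that every path in its ball satisfies one of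
   the alternatives; off [Kset] the data are dummies. *)
have /choice[f Hf] : forall psi, exists z : R * (nat * (nat -> R)), Kset psi -> 0 < z.1 /\
    forall psi', Kset psi' -> close_to T psi z.1 psi' ->
      (rho_set T psi' (Phi s) < delta%:E)%E \/ s <= J z.2.1.+1 z.2.2 psi'.
  move=> psi; have [Kpsi|] := pselect (Kset psi); last by exists (0, (0%N, fun=> 0)).
  have [Ppsi|nP] := pselect (Phi s psi).
    exists (delta / 2, (0%N, fun=> 0)) => _ /=; split; first by rewrite divr_gt0.
    move=> psi' _ near; left.
    apply: (@le_lt_trans _ _ (rho T psi' psi)); first by apply: ereal_inf_lbound; exists psi.
    apply: (le_lt_trans (close_rho near)).
    by rewrite lte_fin ltr_pdivrMr // ltr_pMr // ltr1n.
  have [n [l Jn]] : exists n l, s < J n.+1 l psi.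
    apply: contrapT => no; apply: nP; rewrite level_setE; split=> // -[//|n] l _.
    by rewrite leNgt; apply/negP => h; apply: no; exists n, l.
  have L0 := rate_lip_ge0 H0 Lam T_gt0 D_gt0 n.+1 l.
  set L := rate_lip _ _ _ _ _ _ in L0.
  (* Within this radius [J] cannot fall from its value at [psi] below [s]. *)
  pose r := (J n.+1 l psi - s) / (L + 1); have L1 : 0 < L + 1 by rewrite ltr_wpDl.
  have r0 : 0 < r by rewrite divr_gt0 ?subr_gt0.
  exists (r, (n, l)) => _ /=; split=> // psi' Kpsi' near; right.
  have near' t : 0 <= t <= T -> `|psi' t - psi t| <= r by move=> tT; rewrite ltW // near.
  have := grid_rate_dist Lam T_gt0 D_gt0 H0_gt0 n.+1 l Kpsi' Kpsi near'; rewrite -/L.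
  have : (L + 1) * r = J n.+1 l psi - s by rewrite mulrC divfK // gt_eqF.
  by rewrite ler_norml => E /andP[h _]; lra.
have [N [cs [csK cover]]] := compact_cover_close paths_compact (V := fun psi => (f psi).1)
  (fun psi Kpsi => (Hf psi Kpsi).1).
pose n j := (f (cs j)).2.1.+1; pose l j := (f (cs j)).2.2.
(* This is what remains of the Markov bound once [exp (- (s - nu) / eps)] is factored out: the
   margin [nu] pays for the number of tilts and for their errors. *)
have [eps0 e0 small] := @sum_exp_small R N (fun=> nu) (fun j => tilt_error (n j) (l j)) 1
  ltr01 (fun _ _ => nu0).
exists (Num.min eps0 eps1); first by rewrite lt_min e0.
move=> eps /andP[eps_gt0]; rewrite le_min => /andP[ee0 ee1].
have epsb : 0 < eps <= eps1 by rewrite eps_gt0.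
have /choice[W HW] : forall j, exists W : Omega -> R, [/\ measurable_fun setT W,
    forall w, 0 <= W w, (\int[P]_w (W w)%:E = 1)%E & {ae P, forall w, Kset (Hhat eps w) /\
      expR (eps^-1 * J (n j) (l j) (Hhat eps w) - tilt_error (n j) (l j)) <= W w <=
      expR (eps^-1 * J (n j) (l j) (Hhat eps w) + tilt_error (n j) (l j))}].
  by move=> j; exact: tilt_family.
(* With this weight [b j * W j] is at least 1 wherever the rate [J] of the [j]-th tilt reaches
   [s]. *)
pose b j := expR (tilt_error (n j) (l j) - eps^-1 * s).
have aeW : {ae P, forall w, forall j, Kset (Hhat eps w) /\
      expR (eps^-1 * J (n j) (l j) (Hhat eps w) - tilt_error (n j) (l j)) <= W j w <=
      expR (eps^-1 * J (n j) (l j) (Hhat eps w) + tilt_error (n j) (l j))}.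
  by apply: ae_foralln => j; have [] := HW j.
apply: (@le_trans _ _ (\sum_(j < N) b j)%:E).
  apply: (prob_le_tilt (W := W)).
  - by move=> j; have [] := HW j.
  - by move=> j; have [] := HW j.
  - by move=> j; have [] := HW j.
  - by move=> j; exact: expR_ge0.
  - exact: measurable_far.
  have aeF := ae_filter_ringOfSetsType P; apply: filterS aeW => w Hw far.
  have [KH _] := Hw 0%N; have [i iN near] := cover _ KH.
  have [_ /(_ _ KH near)[|Js]] := Hf _ (csK i iN); first by rewrite ltNge far.
  have [_ /andP[Wge _]] := Hw i.
  have term : 1 <= b i * W i w.
    rewrite -[1]expR0 -(_ : tilt_error (n i) (l i) - eps^-1 * s +
      (eps^-1 * s - tilt_error (n i) (l i)) = 0); last ring.
    rewrite expRD ler_wpM2l ?expR_ge0 // (le_trans _ Wge) // ler_expR lerB //.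
    by rewrite ler_wpM2l // invr_ge0 ltW.
  rewrite (bigD1 (Ordinal iN)) //= (le_trans term) // lerDl sumr_ge0 // => j _.
  by rewrite mulr_ge0 ?expR_ge0 //; have [_ + _ _] := HW j; exact.
rewrite -EFinM -EFinN /= lee_fin.
have -> : \sum_(j < N) b j = expR (- (eps^-1 * (s - nu))) *
    \sum_(j < N) expR (tilt_error (n j) (l j) - eps^-1 * nu).
  by rewrite mulr_sumr; apply: eq_bigr => j _; rewrite /b -expRD; congr expR; ring.
by rewrite ler_piMr ?expR_ge0 // small // eps_gt0.
Qed.

Lemma lower_bound nu delta phi : 0 < nu -> 0 < delta -> path_space T H0 H1 phi ->
  exists2 eps0 : R, 0 < eps0 & forall eps : R, 0 < eps <= eps0 ->
    (expeR (- ((eps^-1)%:E * (Sact phi + nu%:E))) <=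
     P [set w | rho T (Hhat eps w) phi < delta%:E])%E.
Proof.
move=> nu0 delta0 pphi; have := action_ge0 phi.
(* For infinite action the left-hand side of the bound is 0. *)
case SE : (Sact phi) => [S| |] // _; last first.
  exists 1 => // eps /andP[e0 _]; rewrite addye // gt0_muley ?lte_fin ?invr_gt0 //=.
have [Kphi JS] : level S phi by rewrite -level_setE; split=> //; rewrite -/(Sact phi) SE.
have maxi a S' : (forall l, l * a - Lam l <= S') -> exists l0, forall l, l * a - Lam l <= l0 * a - Lam l0.
  exact: (cumulant_maximizer mZ bZ (period_loss_atomless indep eta_dens a)).
have tang l : exists a, forall h, `|h| * (2 * M) <= 2^-1 ->
    Lam (l + h) - Lam l <= h * a + 2 * (2 * M) ^+ 2 * h ^+ 2.
  by apply: (cumulant_tangent mZ bZ); rewrite mulr_ge0 // ltW.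
(* One quarter of [delta] goes to the centre of a ball and one to its radius, leaving [delta / 2] to
   make the final inequality strict. Half of [nu] is spent likewise; the other half absorbs the
   error of the tilt. *)
have d4 : 0 < delta / 4 by rewrite divr_gt0.
have n4 : 0 < nu / 4 by rewrite divr_gt0.
have [n [l [n0 sel]]] := select_control T_gt0 D_gt0 M_gt0 H0_gt0 Lam0 LamB maxi tang
  Kphi JS d4 n4.
have L0 l' := rate_lip_ge0 H0 Lam T_gt0 D_gt0 n l'.
pose L l' := rate_lip T D H0 Lam n l'.
have /choice[f Hf] : forall psi, exists z : R * (R * (nat -> R)), Kset psi ->
    [/\ 0 < z.1, 0 < z.2.1 & forall psi', Kset psi' -> close_to T psi z.1 psi' ->
      J n l psi' + z.2.1 <= J n z.2.2 psi' \/
      (close_to T phi (delta / 2) psi' /\ J n l psi' <= S + nu / 2)].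
  move=> psi; have [Kpsi|] := pselect (Kset psi); last by exists (0, (0, fun=> 0)).
  have [[l' lt]|[near1 J1]] := sel psi Kpsi.
    (* Half of the gain at [psi] survives on the ball, whose radius keeps the variation of the two
       rates together below [g]. *)
    pose g := (J n l' psi - J n l psi) / 2; have g0 : 0 < g by rewrite divr_gt0 ?subr_gt0.
    have L1 : 0 < L l + L l' + 1 by rewrite ltr_wpDl ?addr_ge0 ?L0.
    exists (g / (L l + L l' + 1), (g, l')) => _ /=; split=> //; first by rewrite divr_gt0.
    move=> psi' Kpsi' near; left; set r := g / _ in near.
    have near' t : 0 <= t <= T -> `|psi' t - psi t| <= r by move=> tT; rewrite ltW // near.
    have := grid_rate_dist Lam T_gt0 D_gt0 H0_gt0 n l Kpsi' Kpsi near'.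
    have := grid_rate_dist Lam T_gt0 D_gt0 H0_gt0 n l' Kpsi' Kpsi near'.
    rewrite -/(L l) -/(L l') !ler_norml => /andP[h1 _] /andP[_ h2].
    have rE : (L l + L l' + 1) * r = g by rewrite mulrC divfK // gt_eqF.
    have r0 : 0 < r by rewrite divr_gt0.
    have gE : 2 * g = J n l' psi - J n l psi by rewrite mulrC divfK.
    by rewrite !mulrDl mul1r in rE; lra.
  have L1 : 0 < L l + 1 by rewrite ltr_wpDl ?L0.
  have q0' : 0 < nu / 4 / (L l + 1) by rewrite divr_gt0.
  exists (Num.min (delta / 4) (nu / 4 / (L l + 1)), (1, fun=> 0)) => _ /=; split=> //.
    by rewrite lt_min d4.
  move=> psi' Kpsi' near; right; split.
    move=> t tT; have := near t tT; rewrite lt_min => /andP[h _]; have := near1 t tT.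
    have -> : psi' t - phi t = (psi' t - psi t) + (psi t - phi t) by ring.
    by move=> h'; apply: (le_lt_trans (ler_normD _ _)); lra.
  have near' t : 0 <= t <= T -> `|psi' t - psi t| <= nu / 4 / (L l + 1).
    by move=> tT; have := near t tT; rewrite lt_min => /andP[_ /ltW].
  have := grid_rate_dist Lam T_gt0 D_gt0 H0_gt0 n l Kpsi' Kpsi near'.
  rewrite -/(L l) ler_norml => /andP[_ h].
  have rE : (L l + 1) * (nu / 4 / (L l + 1)) = nu / 4 by rewrite mulrC divfK // gt_eqF.
  by rewrite mulrDl mul1r in rE; lra.
have Vpos psi : Kset psi -> 0 < (f psi).1 by move=> /Hf[].
have [N [cs [csK cover]]] := compact_cover_close paths_compact Vpos.
pose g j := if (j < N)%N then (f (cs j)).2.1 else 1; pose l' j := (f (cs j)).2.2.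
pose err := tilt_error n l.
have gpos j : 0 < g j by rewrite /g; case: ifP => // jN; have [] := Hf _ (csK j jN).
(* The paths on which [l] is not optimal may carry at most half of the mean of [V]; the other half
   must lie on the target event. *)
have [eps2 e2 small] := @sum_exp_small R N g (fun j => err + tilt_error n (l' j)) 2^-1
  ltac:(by rewrite invr_gt0) (fun j _ => gpos j).
have [eps3 e3 small'] := @sum_exp_small R 1 (fun=> nu / 2) (fun=> err) 2^-1
  ltac:(by rewrite invr_gt0) (fun _ _ => divr_gt0 nu0 (ltr0Sn R 1)).
exists (Num.min eps1 (Num.min eps2 eps3)); first by rewrite !lt_min eps1_gt0 e2.
move=> eps /andP[eps_gt0]; rewrite !le_min => /andP[ee1 /andP[ee2 ee3]].
have epsb : 0 < eps <= eps1 by rewrite eps_gt0.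
have [V [mV V0 V1 aeV]] := tilt_family l epsb n0.
have /choice[W HW] : forall j, exists W : Omega -> R, [/\ measurable_fun setT W,
    forall w, 0 <= W w, (\int[P]_w (W w)%:E = 1)%E & {ae P, forall w, Kset (Hhat eps w) /\
      expR (eps^-1 * J n (l' j) (Hhat eps w) - tilt_error n (l' j)) <= W w <=
      expR (eps^-1 * J n (l' j) (Hhat eps w) + tilt_error n (l' j))}].
  by move=> j; exact: tilt_family.
have aeW : {ae P, forall w, forall j, Kset (Hhat eps w) /\
      expR (eps^-1 * J n (l' j) (Hhat eps w) - tilt_error n (l' j)) <= W j w <=
      expR (eps^-1 * J n (l' j) (Hhat eps w) + tilt_error n (l' j))}.
  by apply: ae_foralln => j; have [] := HW j.
set A := [set w | _].
have mA : measurable A.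
  apply: (measurable_rho_lt T_gt0 (mH eps_gt0) (rH eps_gt0)); exact: path_continuous Kphi.
(* A bound for the ratio of [V] to [W j] on a ball where the multipliers [l' j] gain at least
   [g j]. *)
pose b j := expR (err + tilt_error n (l' j) - eps^-1 * g j).
pose B := expR (eps^-1 * (S + nu / 2) + err).
have ei0 : 0 <= eps^-1 by rewrite invr_ge0 ltW.
have main : 1 <= B * fine (P A) + \sum_(j < N) b j.
  apply: (@prob_ge_tilt _ Omega R P N W b _ _ _ _ A V B) => //.
  - by move=> j; have [] := HW j.
  - by move=> j; have [] := HW j.
  - by move=> j; have [] := HW j.
  - by move=> j; exact: expR_ge0.
  - exact: expR_ge0.
  have aeF := ae_filter_ringOfSetsType P; apply: filterS2 aeV aeW => w [KH /andP[_ Vle]] Hw.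
  have bW0 j : 0 <= b j * W j w.
    by rewrite mulr_ge0 ?expR_ge0 //; have [_ + _ _] := HW j; exact.
  have [i iN near] := cover _ KH.
  have [_ _ /(_ _ KH near)[Jl|[nearphi Jl]]] := Hf _ (csK i iN).
    have [_ /andP[Wge _]] := Hw i.
    have term : V w <= b i * W i w.
      apply: (le_trans Vle); apply: (@le_trans _ _ (b i *
        expR (eps^-1 * J n (l' i) (Hhat eps w) - tilt_error n (l' i)))); last first.
        by rewrite ler_wpM2l ?expR_ge0.
      rewrite /b -expRD ler_expR /g iN -/err.
      have : eps^-1 * (J n l (Hhat eps w) + (f (cs i)).2.1) <= eps^-1 * J n (l' i) (Hhat eps w).
        by rewrite ler_wpM2l.
      by rewrite mulrDr; lra.
    rewrite (bigD1 (Ordinal iN)) //=; apply: (le_trans term).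
    rewrite addrCA lerDl addr_ge0 ?mulr_ge0 ?expR_ge0 // sumr_ge0 // => j _; exact: bW0.
  have Aw : A w.
    rewrite /A /=; apply: (le_lt_trans (close_rho nearphi)).
    by rewrite lte_fin ltr_pdivrMr // ltr_pMr // ltr1n.
  rewrite indicE mem_set // mulr1; apply: (le_trans Vle).
  apply: (@le_trans _ _ B); last by rewrite lerDl sumr_ge0 // => j _; exact: bW0.
  by rewrite ler_expR lerD2r ler_wpM2l.
have half : 2^-1 <= B * fine (P A).
  have : \sum_(j < N) b j <= 2^-1 by apply: small; rewrite eps_gt0.
  by move=> h; lra.
have fA : P A = (fine (P A))%:E by rewrite fineK // fin_num_measure.
rewrite fA -EFinD -EFinM -EFinN /= lee_fin.
have := small' eps; rewrite eps_gt0 ee3 big_ord1 => /(_ isT) h.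
have B0 : 0 < B by exact: expR_gt0.
(* [B] times the claimed lower bound is [exp (err - nu / (2 eps))], at most one half by the choice
   of [eps3]. *)
rewrite -(ler_pM2l B0); apply: le_trans half; apply: le_trans h.
rewrite /B -expRD ler_expR le_eqVlt; apply/orP; left; apply/eqP.
by move: (err) (eps^-1) => y z; field.
Qed.

End LargeDeviations.

Theorem theorem3p1 (R : realType) (d : measure_display)
    (Omega : measurableType d) (P : probability Omega R)
    (D q0 x T M H0 H1 eps1 : R) (xi eta : nat -> {RV P >-> R})
    (D_gt0 : 0 < D) (q0_bnd : 0 <= q0 < D) (T_gt0 : 0 < T)
    (indep : independent_family
       (fun i : nat + nat => match i with inl k => xi k | inr k => eta k end))
    (xi_id : identically_distributed xi)
    (eta_id : identically_distributed eta)
    (xi_dens : forall k, has_continuous_density (xi k))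
    (eta_dens : forall k, has_continuous_density (eta k))
    (M_gt0 : 0 < M)
    (xi_bnd : forall k, P [set w | `|xi k w| <= M] = 1%E)
    (eta_bnd : forall k, P [set w | `|eta k w| <= M] = 1%E)
    (mean_gt0 : forall k, (0 < 'E_P[fun w => (xi k w + eta k w)%R])%E)
    (H0_gt0 : 0 < H0) (eps1_gt0 : 0 < eps1)
    (H_bnd : forall eps : R, 0 < eps <= eps1 ->
       {ae P, forall w, forall t : R, 0 <= t <= T ->
          H0 <= energy_path D q0 x eps (xi ^~ w) (eta ^~ w) t <= H1}) :
  let Hhat (eps : R) (w : Omega) : R -> R :=
    interpolated_path D q0 x eps (xi ^~ w) (eta ^~ w) in
  let S : (R -> R) -> \bar R := action D (xi 0%N) (eta 0%N) T x in
  let Phi (s : R) : set (R -> R) :=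
    level_set D (xi 0%N) (eta 0%N) T x H0 H1 s in
  [/\ (* (0) *)
      forall s : R, 0 <= s -> compact (Phi s : set {uniform` `[0, T] -> R}),
      (* (I) *)
      forall (nu delta : R) (phi : R -> R), 0 < nu -> 0 < delta ->
        path_space T H0 H1 phi ->
        exists2 eps0 : R, 0 < eps0 & forall eps : R, 0 < eps <= eps0 ->
          (expeR (- ((eps^-1)%:E * (S phi + nu%:E))) <=
           P [set w | rho T (Hhat eps w) phi < delta%:E])%E
    & (* (II) *)
      forall delta nu s : R, 0 < delta -> 0 < nu -> 0 < s ->
        exists2 eps0 : R, 0 < eps0 & forall eps : R, 0 < eps <= eps0 ->
          (P [set w | delta%:E <= rho_set T (Hhat eps w) (Phi s)] <=
           expeR (- ((eps^-1)%:E * (s - nu)%:E)))%E].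
Proof.
split.
- move=> s _; rewrite (level_setE x H0 H1 D_gt0 T_gt0 M_gt0 xi_bnd eta_bnd).
  exact: rate_level_compact.
- by move=> nu delta phi; exact: (lower_bound D_gt0 q0_bnd T_gt0 indep xi_id eta_id eta_dens
    M_gt0 xi_bnd eta_bnd H0_gt0 eps1_gt0 H_bnd).
- by move=> delta nu s delta0 nu0 _; exact: (upper_bound D_gt0 q0_bnd T_gt0 indep xi_id eta_id
    M_gt0 xi_bnd eta_bnd H0_gt0 eps1_gt0 H_bnd s delta0 nu0).
Qed.
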